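(* Consider the orthogonal regression model described in the context, with $\sigma$ unknown to the selection rule, and let Assumptions (B) and (C) below hold. Let $d\in\mathbb R$ be a fixed constant, let $L=L_m$ be integers with $$L=o\left(\frac{n}{(\log n+2\log m)^2\log m}\right)\quad\text{as }n\to\infty,$$ and, for some $\eta>0$ and all sufficiently large $n$, $L\ge mp(\log n)^{1+\eta}$. Consider the mBIC rule which, among all models $M$ with $k(M)\le L$ regressors in addition to the intercept, selects the one minimizing $$n\log RSS_M+k(\log n+2\log m+d),\qquad k=k(M).$$ (i) If $mp\to s\in(0,\infty]$ and $\frac{\log(mp)}{\log n}\to0$, then this rule is ABOS. (ii) If $mp\to s\in(0,\infty]$ and $mp\sqrt{\frac{\log n}{n}}\to0$, then this rule is consistent.
   Context: Setting. All quantities are indexed by $m$, all limits are for $m\to\infty$, and the index $m$ is suppressed. $n=n_m\in\mathbb N$, $p=p_m\in(0,1)$, $\delta_0,\delta_A>0$ may depend on $m$; $\sigma>0$ and $\nu$ are fixed, $\nu$ being a probability measure on $\mathbb R$ with $\nu(\{0\})=0$, $\nu(-\infty,0)>0$, $\nu(0,\infty)>0$. The model is $Y=X\beta+\epsilon$ with $Y\in\mathbb R^n$, a deterministic $n\times(m+1)$ design matrix $X$ whose first column consists of ones and which satisfies $X'X=nI_{(m+1)\times(m+1)}$ (so $m<n$), and $\epsilon\sim N(0,\sigma^2I_{n\times n})$. The regression coefficients $\beta_1,\dots,\beta_m$ are i.i.d. with law $(1-p)d_0+p\nu$ ($d_0$ = Dirac measure at $0$), independent of $\epsilon$. The intercept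 is always included; a model $M$ is a subset of the $m$ regressors, $k(M)$ is the number of its regressors (intercept not counted), and $RSS_M$ is the residual sum of squares of the least squares fit. $\hat\beta_i$ is the least squares estimate of $\beta_i$. Put $\delta=\delta_0/\delta_A$, $f=(1-p)/p$. The risk $R$ of a selection rule is $\delta_0$ times the expected number of selected regressors with $\beta_i=0$ plus $\delta_A$ times the expected number of non-selected regressors with $\beta_i\neq0$. The Bayes oracle (for large $n$) selects regressor $i$ iff $\hat\beta_i\notin(a_n,b_n)$, where $a_n<0<b_n$ are the unique solutions $a$ of $(1-p)\delta_0=p\,\delta_A\int_{\mathbb R}\exp\left(n\left(a\frac{\mu}{\sigma^2}-\frac{\mu^2}{2\sigma^2}\right)\right)d\nu(\mu)$; its risk is $R^B$. A rule with risk $R$ is ABOS (asymptotically Bayes optimal under sparsity) if $R/R^B\to1$. A rule is consistent if the probability of selecting the true model $\{i:\beta_i\ne0\}$ converges to $1$ as $m\to\infty$. Assumption (B): $n\to\infty$, $p\to0$, $\log\delta=o(\log p)$, and $\delta$ is bounded from above. Assumption (C) (with $C=0$): there is $\epsilon_0>0$ such that $\nu$ has a positive bounded density $\rho$ w.r.t. Lebesgue measure on $[-\epsilon_0,\epsilon_0]$, and $\rho(0^-)=\lim_{\mu\uparrow0}\rho(\mu)$, $\rho(0^+)=\lim_{\mu\downarrow0}\rho(\mu)$ exist and are finite and positive. *)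

(* Defs.v *)
From HB Require Import structures.
From mathcomp Require Import all_boot all_order all_algebra.
From mathcomp Require Import all_classical all_reals all_analysis.

Set Implicit Arguments.
Unset Strict Implicit.
Unset Printing Implicit Defensive.

Import Order.TTheory GRing.Theory Num.Theory.
Import numFieldNormedType.Exports.

Local Open Scope classical_set_scope.
Local Open Scope ring_scope.

(* The design matrix has columns ['I_m.+1]: column [ord0] is the intercept and
   column [lift ord0 i] is regressor [i : 'I_m].  A model is a subset
   [M : {set 'I_m}] of the regressors; the intercept always belongs to the
   model and is not counted in [#|M|]. *)

Section LeastSquares.
Context {R : realType} {n m : nat}.
Implicit Types (X : 'M[R]_(n, m.+1)) (y : 'cV[R]_n) (b : 'cV[R]_m.+1).
Implicit Types (M : {set 'I_m}).

Definition orthogonal_design X : Prop :=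
  (forall j, X j ord0 = 1) /\ X^T *m X = (n%:R)%:M.

Definition with_intercept (b0 : R) (b : 'I_m -> R) : 'cV[R]_m.+1 :=
  \col_j (if unlift ord0 j is Some i then b i else b0).

Definition response {T : Type} X (b0 : R) (beta : 'I_m -> T -> R)
    (eps : 'I_n -> T -> R) (w : T) : 'cV[R]_n :=
  X *m with_intercept b0 (beta ^~ w) + \col_j eps j w.

Definition sum_squares (v : 'cV[R]_n) : R := \sum_j v j ord0 ^+ 2.

Definition coefs_of M : set 'cV[R]_m.+1 :=
  [set b | forall i, i \notin M -> b (lift ord0 i) ord0 = 0].

Definition least_squares X M y : set 'cV[R]_m.+1 :=
  [set b | coefs_of M b /\
    forall b', coefs_of M b' ->
      sum_squares (y - X *m b) <= sum_squares (y - X *m b')].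

(* The minimizer exists for every [X], and is unique for an orthogonal design
   with [0 < n]. *)
Definition lse X M y : 'cV[R]_m.+1 := get (least_squares X M y).

Definition RSS X M y : R := sum_squares (y - X *m lse X M y).

Definition beta_hat X y (i : 'I_m) : R := lse X [set: 'I_m] y (lift ord0 i) ord0.

Definition mBIC X (d : R) y M : R :=
  n%:R * ln (RSS X M y) + #|M|%:R * (ln n%:R + 2 * ln m%:R + d).

(* Ties are broken arbitrarily. *)
Definition mBIC_rule X (d : R) (L : nat) (sel : 'cV[R]_n -> {set 'I_m}) : Prop :=
  forall y, (#|sel y| <= L)%N /\
    forall M, (#|M| <= L)%N -> mBIC X d y (sel y) <= mBIC X d y M.

End LeastSquares.

Section Model.
Context {R : realType} {disp : measure_display} {T : measurableType disp}.
Variable P : probability T R.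

Definition mutually_independent (I : finType) (Z : I -> {RV P >-> R}) : Prop :=
  forall (J : {set I}) (A : I -> set R),
    (forall i, i \in J -> measurable (A i)) ->
    P (\bigcap_(i in [set` J]) (Z i @^-1` A i)) =
      (\prod_(i in J) P (Z i @^-1` A i))%E.

Definition spike_slab_law (p : R) (nu : probability R R) (A : set R) : \bar R :=
  ((1 - p)%:E * \d_(0%R : R) A + p%:E * nu A)%E.

(* Joint independence of all the coefficients and all the noise coordinates
   says at once that the coefficients are independent, that the noise vector
   is N(0, sigma^2 I), and that the two are independent. *)
Definition random_regression (m n : nat) (p sigma : R) (nu : probability R R)
    (beta : 'I_m -> {RV P >-> R}) (eps : 'I_n -> {RV P >-> R}) : Prop :=
  [/\ forall i A, measurable A ->
        distribution P (beta i) A = spike_slab_law p nu A,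
      forall j A, measurable A ->
        distribution P (eps j) A = normal_prob 0 sigma A &
      mutually_independent
        (fun k : 'I_m + 'I_n =>
           match k with inl i => beta i | inr j => eps j end)].

Definition true_model (m : nat) (beta : 'I_m -> T -> R) (w : T) : {set 'I_m} :=
  [set i | beta i w != 0].

Definition risk (m : nat) (delta0 deltaA : R) (beta : 'I_m -> T -> R)
    (S : T -> {set 'I_m}) : \bar R :=
  (delta0%:E * 'E_P[fun w => #|S w :\: true_model beta w|%:R : R]
   + deltaA%:E * 'E_P[fun w => #|true_model beta w :\: S w|%:R : R])%E.

End Model.

Section Oracle.
Context {R : realType}.
Variables (n : nat) (p delta0 deltaA sigma : R) (nu : probability R R).

Definition oracle_equation (a : R) : Prop :=
  ((1 - p) * delta0)%:E =
  ((p * deltaA)%:E *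
   \int[nu]_mu (expR (n%:R * (a * (mu / sigma ^+ 2)
                              - mu ^+ 2 / (2 * sigma ^+ 2))))%:E)%E.

(* Under [assumption_B] each threshold exists and is unique for large indices. *)
Definition oracle_lower : R := get [set a | a < 0 /\ oracle_equation a].
Definition oracle_upper : R := get [set b | 0 < b /\ oracle_equation b].

Definition Bayes_oracle (m : nat) (X : 'M[R]_(n, m.+1)) (y : 'cV[R]_n)
    : {set 'I_m} :=
  [set i | ~~ (oracle_lower < beta_hat X y i < oracle_upper)].

End Oracle.

Definition ABOS {R : realType} (risk_rule risk_oracle : nat -> \bar R) : Prop :=
  (fun m => fine (risk_rule m) / fine (risk_oracle m)) @ \oo --> (1 : R).

Section Assumptions.
Context {R : realType}.

Definition assumption_B (n : nat -> nat) (p delta0 deltaA : nat -> R) : Prop :=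
  [/\ n @ \oo --> \oo,
      p @ \oo --> (0 : R),
      (fun m => ln (delta0 m / deltaA m)) =o_\oo (fun m => ln (p m)) &
      exists K : R, forall m, delta0 m / deltaA m <= K].

Definition assumption_C (nu : probability R R) : Prop :=
  exists (e0 : R) (rho : R -> R),
    [/\ 0 < e0,
        measurable_fun `[- e0, e0] rho,
        exists K : R, forall x, x \in `[- e0, e0] -> 0 < rho x <= K,
        forall A, measurable A -> A `<=` `[- e0, e0] ->
          nu A = (\int[lebesgue_measure]_(x in A) (rho x)%:E)%E &
        exists rhom rhop : R,
          [/\ 0 < rhom, 0 < rhop, rho x @[x --> 0^'-] --> rhom &
              rho x @[x --> 0^'+] --> rhop]].

End Assumptions.

(* Main.v *)
Require Import Defs.
From HB Require Import structures.
From mathcomp Require Import all_boot all_order all_algebra.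
From mathcomp Require Import all_classical all_reals all_analysis.
From mathcomp Require Import measurable_realfun ring lra.

Set Implicit Arguments.
Unset Strict Implicit.
Unset Printing Implicit Defensive.

Import Order.TTheory GRing.Theory Num.Theory.
Import numFieldNormedType.Exports.

Local Open Scope classical_set_scope.
Local Open Scope ring_scope.

(* In the scores u_i + z_i = sqrt n * beta_hat_i / sigma, where u_i is the
   scaled coefficient and z_i the scaled noise, the orthogonal design makes
   RSS_M separable.  Outside an event of probability O(n^-3), where the noise
   energy is off by a relative n^(-1/4), some z_j^2 exceeds 8 log n, or there
   are more than L signals, comparing the minimizer S with S minus i and with
   S plus i shows that mBIC thresholds the squared scores at
   c^2 = (log n + 2 log m + d)(1 + o(1)); if S is full, a missed signal instead
   has a score below the noise score of some false inclusion.  False inclusions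
   are then negligible, and a signal is missed with probability
   p nu[-c sigma / sqrt n, c sigma / sqrt n] (1 + o(1))
   = p (rho(0-) + rho(0+)) c sigma / sqrt n (1 + o(1)).
   For the Bayes oracle the same holds with c^2 = log n - 2 log p, by a Laplace
   estimate of the likelihood ratio at its thresholds.  The two values of c^2
   differ by 2 log (m p) + d, which is o(log n) under the assumption of (i).
   For (ii), the expected number of errors is O(m p sqrt (log n / n)). *)

(** * Products of functions of independent variables *)

(** The obstacle is precision. Since [m] may be as large as [n - 1], the full model can leave no
    residual at all; the cap [L] prevents this. A candidate model and the signals together involve
    at most [2 L + 1] scores, counting the intercept, and these absorb noise energy
    [O(L log n) = o(n / penalty)]. Selection therefore forces a squared score above the penalty
    minus a constant. A relative error would not do here: the expected number of false inclusions is
    of order [n^(-1/2)], against about [m p sqrt(penalty / n)] missed signals, and when [m p] stays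
    bounded only the factor [sqrt(penalty)] separates the two. For misses a relative error suffices,
    but a noise excursion of a small fraction of [c] must be paired with a small signal:
    independence gives a product of two probabilities, whereas the Gaussian factor alone may exceed
    [p c / sqrt n]. The exceptional event is harmless because [m p] bounded below and [m < n] make
    [p] at least of order [1 / n], so that the main term is at least of order [n^(-3/2)]. *)

Section ChangeOfMeasure.
Context {R : realType} {disp disp' : measure_display}
  {T : measurableType disp} {U : measurableType disp'}.
Variables (mu : {measure set T -> \bar R}) (nu : {measure set U -> \bar R}).
Local Open Scope ereal_scope.
Import HBNNSimple.

(** The last hypothesis says that [nu] is the image under [X] of the measure with density [W];
    monotone convergence along simple functions extends it from indicators. Treating image and
    density together covers both uses: [X] one random variable and [W] the product of the other
    factors, or [X = id] and [W] a density on the line. *)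
Lemma ge0_integral_density (X : T -> U) (W : T -> R) (f : U -> R) :
  measurable_fun setT X ->
  measurable_fun setT W -> (forall w, (0 <= W w)%R) ->
  measurable_fun [set: U] f -> (forall x, (0 <= f x)%R) ->
  (forall A, measurable A -> \int[mu]_w (\1_A (X w) * W w)%:E = nu A) ->
  \int[mu]_w (f (X w) * W w)%:E = \int[nu]_x (f x)%:E.
Proof.
move=> mX mW W0 mf f0 HA.
have mfE : measurable_fun [set: U] (EFin \o f) by exact/measurable_EFinP.
pose g := nnsfun_approx measurableT mfE.
have cg x : EFin \o g ^~ x @ \oo --> (f x)%:E.
  by apply: cvg_nnsfun_approx => // y _; rewrite lee_fin.
have ndg x m n : (m <= n)%N -> (g m x <= g n x)%R.
  by move=> mn; exact/lefP/nd_nnsfun_approx.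
have mXg k : measurable_fun setT (fun w => g k (X w)) by exact: measurableT_comp.
have step k : \int[mu]_w (g k (X w) * W w)%:E = \int[nu]_x (g k x)%:E.
  pose B r := g k @^-1` [set r].
  have mB r : measurable (B r) by exact: measurable_funPTI.
  pose s : seq R := finmap.enum_fset (fset_set (range (g k))).
  (* The absolute value is harmless on the range of a nonnegative function and makes every
     coefficient visibly nonnegative, whatever [r] is. *)
  have E x : g k x = (\sum_(r <- s) `|r| * \1_(B r) x)%R.
    rewrite fimfunE fsbig_finite//= big_seq [RHS]big_seq.
    apply: eq_bigr => r; rewrite [_ \in _]in_fset_set// inE => -[y _ <-].
    by rewrite ger0_norm.
  have m2 r : measurable_fun [set: U] (\1_(B r) : U -> R).
    exact: measurable_indic.
  have m1 r : measurable_fun setT (fun w => \1_(B r) (X w) : R).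
    exact: (measurableT_comp (m2 r)).
  have i0 (r : R) (x : U) : (0 <= \1_(B r) x :> R)%R by rewrite indicE ler0n.
  have -> : \int[mu]_w (g k (X w) * W w)%:E = \sum_(r <- s) (`|r|%:E * nu (B r)).
    under eq_integral do rewrite E mulr_suml -sumEFin.
    rewrite ge0_integral_sum//=.
    - apply: eq_bigr => r _; under eq_integral do rewrite -mulrA EFinM.
      rewrite ge0_integralZl_EFin//; first by rewrite HA.
        by move=> w _; rewrite lee_fin mulr_ge0.
      exact/measurable_EFinP/measurable_funM.
    - by move=> r; apply/measurable_EFinP/measurable_funM => //; exact: measurable_funM.
    - by move=> r w _; rewrite lee_fin !mulr_ge0.
  under [RHS]eq_integral do rewrite E -sumEFin.
  rewrite ge0_integral_sum//=.
  - apply: eq_bigr => r _; under eq_integral do rewrite EFinM.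
    rewrite ge0_integralZl_EFin//; last exact/measurable_EFinP.
    by rewrite integral_indic ?setIT.
  - by move=> r; apply/measurable_EFinP/measurable_funM.
have c1 : \int[mu]_w (g k (X w) * W w)%:E @[k --> \oo] -->
   \int[mu]_w (f (X w) * W w)%:E.
  have -> : \int[mu]_w (f (X w) * W w)%:E = \int[mu]_w limn (fun k => (g k (X w) * W w)%:E).
    apply: eq_integral => w _; apply/esym/cvg_lim => //.
    under eq_fun do rewrite EFinM.
    by rewrite EFinM; apply: cvgeZr => //; exact: cg.
  apply: cvg_monotone_convergence => //.
  - by move=> k; apply/measurable_EFinP/measurable_funM.
  - by move=> k w _; rewrite lee_fin mulr_ge0.
  - by move=> w _ m n mn; rewrite lee_fin ler_wpM2r// ndg.
have c2 : \int[nu]_x (g k x)%:E @[k --> \oo] --> \int[nu]_x (f x)%:E.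
  have -> : \int[nu]_x (f x)%:E = \int[nu]_x limn (fun k => (g k x)%:E).
    apply: eq_integral => w _; apply/esym/cvg_lim => //.
    exact: cg.
  apply: cvg_monotone_convergence => //.
  - by move=> k; exact/measurable_EFinP.
  - by move=> k w _; rewrite lee_fin.
  - by move=> w _ m n mn; rewrite lee_fin ndg.
apply: (cvg_unique _ c1) => //.
by rewrite /= (eq_cvg _ _ step).
Qed.

End ChangeOfMeasure.

Section IndependentProducts.
Context {R : realType} {disp : measure_display} {T : measurableType disp}.
Variable P : probability T R.
Local Open Scope ereal_scope.

Lemma integral_indic_comp (X : {RV P >-> R}) (A : set R) : measurable A ->
  \int[P]_w (\1_A (X w))%:E = P (X @^-1` A).
Proof.
move=> mA.
have -> : (fun w => (\1_A (X w))%:E) = (fun w => (\1_(X @^-1` A) w)%:E) :> (T -> \bar R).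
  by apply/funext => w; rewrite !indicE.
by rewrite integral_indic ?setIT//; exact: measurable_funPTI.
Qed.

(** Independence is given for events only, that is, for indicator factors. The induction replaces
    one indicator at a time by a general factor, all the other factors serving as a weight. *)
Lemma integral_prod_independent (I : finType) (Z : I -> {RV P >-> R})
    (g : I -> R -> R) :
  mutually_independent Z ->
  (forall k, measurable_fun [set: R] (g k)) -> (forall k x, (0 <= g k x)%R) ->
  (forall k, \int[P]_w (g k (Z k w))%:E \is a fin_num) ->
  \int[P]_w (\prod_k g k (Z k w))%:E = \prod_k \int[P]_w (g k (Z k w))%:E.
Proof.
move=> indep mg g0 gfin.
(* [s] lists the indices whose factor may be other than an indicator; for empty [s] the claim is
   independence of events. *)
suff H (s : seq I) (h : I -> R -> R) : uniq s ->
    (forall k, measurable_fun [set: R] (h k)) -> (forall k x, (0 <= h k x)%R) ->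
    (forall k, \int[P]_w (h k (Z k w))%:E \is a fin_num) ->
    (forall k, k \notin s -> exists2 A, measurable A & h k = \1_A) ->
  \int[P]_w (\prod_k h k (Z k w))%:E = \prod_k \int[P]_w (h k (Z k w))%:E.
  by apply: (H (enum I)); rewrite ?enum_uniq// => k; rewrite mem_enum.
elim: s h => [|k s IH] h.
  move=> _ mh h0 hfin hA.
  have {}hA k : exists A, measurable A /\ h k = \1_A.
    by have [A mA hkA] := hA k isT; exists A.
  have [A HA] := choice hA.
  have E w : (\prod_k h k (Z k w))%R = \1_(\bigcap_(i in [set` [set: I]%SET]) (Z i @^-1` A i)) w.
    rewrite indicE; have [|] := boolP (_ \in _).
      rewrite inE => Aw; rewrite big1// => i _; rewrite (HA i).2 indicE mem_set//.
      by apply: (Aw i); rewrite /= finset.in_setT.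
    move/negP => nA; apply/eqP/prodf_eq0.
    have [i iw] : exists i, ~ A i (Z i w).
      apply: contrapT => H; apply: nA; rewrite inE => i _ /=.
      by apply: contrapT => ?; apply: H; exists i.
    by exists i => //; rewrite (HA i).2 indicE memNset.
  under eq_integral do rewrite E.
  rewrite integral_indic ?setIT//; last first.
    apply: fin_bigcap_measurable => // i _; apply: measurable_funPTI.
    exact: (HA i).1.
  apply: (etrans (indep [set: I]%SET A (fun i _ => (HA i).1))).
  apply: eq_big => [i|i _]; first by rewrite finset.in_setT.
  by rewrite (HA i).2 integral_indic_comp//; exact: (HA i).1.
move=> /= /andP[ks us] mh h0 hfin hA.
pose W w := (\prod_(j | j != k) h j (Z j w))%R.
pose c := \prod_(j | j != k) \int[P]_w (h j (Z j w))%:E.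
have mW : measurable_fun setT W.
  rewrite /W; under eq_fun do rewrite -big_filter.
  by apply: measurable_prod => j _; exact: measurableT_comp.
have W0 w : (0 <= W w)%R by apply: prodr_ge0 => j _.
under eq_integral do rewrite (bigD1 k)//=.
rewrite [RHS](bigD1 k)//=.
have [c0 cfin] : 0 <= c /\ c \is a fin_num.
  split; first by apply: prode_ge0 => j _; apply: integral_ge0 => w _; rewrite lee_fin.
  by rewrite /c; elim/big_ind: _ => // x y; exact: fin_numM.
have c0' : (0 <= fine c)%R by rewrite fine_ge0.
(* The measure compared with is the law of [Z k] scaled by [c], the product of the other integrals,
   whose finiteness allows a real scaling factor. *)
rewrite (ge0_integral_density (nu := mscale (NngNum c0') (distribution P (Z k))) (X := Z k))//.
  rewrite ge0_integral_mscale//=; last 2 first.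
  - exact/measurable_EFinP.
  - by move=> x _; rewrite lee_fin.
  rewrite fineK// muleC; congr (_ * _).
  rewrite (ge0_integral_distribution (Z k) (f := EFin \o h k))//.
    exact/measurable_EFinP.
  by move=> y; rewrite lee_fin.
move=> A mA.
transitivity (P (Z k @^-1` A) * c); last by rewrite -[c in LHS]fineK// muleC.
pose h' j := if j == k then \1_A else h j.
have h'k : h' k = \1_A by rewrite /h' eqxx.
have h'j j : j != k -> h' j = h j by rewrite /h' => /negbTE ->.
have -> : P (Z k @^-1` A) * c = \prod_j \int[P]_w (h' j (Z j w))%:E.
  rewrite (bigD1 k)//= h'k integral_indic_comp//; congr (_ * _).
  by apply: eq_bigr => j jk; rewrite h'j.
rewrite -IH//.
- apply: eq_integral => w _; rewrite [in RHS](bigD1 k)//= h'k.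
  by congr (_ * _)%:E; apply: eq_bigr => j jk; rewrite h'j.
- move=> j; have [->|jk] := eqVneq j k; last by rewrite h'j.
  by rewrite h'k; exact: measurable_indic.
- move=> j x; have [->|jk] := eqVneq j k; last by rewrite h'j.
  by rewrite h'k indicE ler0n.
- move=> j; have [->|jk] := eqVneq j k; last by rewrite h'j.
  by rewrite h'k integral_indic_comp// fin_num_measure//; exact: measurable_funPTI.
- move=> j js; have [->|jk] := eqVneq j k; first by rewrite h'k; exists A.
  by rewrite h'j//; apply: hA; rewrite inE negb_or jk.
Qed.

End IndependentProducts.

(** * Exponential moments of a normal variable and of its square *)

Section GaussianMgf.
Context {R : realType}.
Implicit Types (t : R) (f : R -> R).
Local Open Scope ereal_scope.

Lemma integral_normal_law (s : R) (nu : {measure set R -> \bar R}) f :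
  (forall A, measurable A -> nu A = normal_prob 0 s A) ->
  measurable_fun [set: R] f -> (forall x, (0 <= f x)%R) ->
  \int[nu]_x (f x)%:E =
  \int[lebesgue_measure]_x (f x * normal_pdf 0 s x)%:E.
Proof.
move=> nuE mf f0.
apply/esym.
apply: (@ge0_integral_density R _ _ _ R lebesgue_measure nu id (normal_pdf 0 s) f) => //.
- exact: measurable_normal_pdf.
- by move=> x; exact: normal_pdf_ge0.
move=> A mA; rewrite nuE// /normal_prob [RHS]integral_mkcond.
apply: eq_integral => x _; rewrite /= patchE indicE.
by case: ifPn => _; rewrite ?mul1r ?mul0r.
Qed.

Variables (s : R) (nu : {measure set R -> \bar R}).
Hypothesis s0 : (0 < s)%R.
Hypothesis nuE : forall A, measurable A -> nu A = normal_prob 0 s A.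

(** Completing the square: exponential tilting turns the density into a normal one with mean
    [s ^+ 2 * t], up to the stated constant. *)
Lemma normal_mgf t :
  \int[nu]_x (expR (t * x))%:E = (expR (s ^+ 2 * t ^+ 2 / 2))%:E.
Proof.
rewrite (integral_normal_law nuE)//; last first.
  by apply: measurableT_comp => //; exact: measurable_funM.
have sN0 : s != 0%R by rewrite gt_eqF.
under eq_integral.
  move=> x _.
  have -> : (expR (t * x) * normal_pdf 0 s x =
     expR (s ^+ 2 * t ^+ 2 / 2) * normal_pdf (s ^+ 2 * t) s x)%R.
    rewrite !normal_pdfE// mulrCA [RHS]mulrCA; congr (_ * _)%R.
    rewrite /normal_fun -!expRD; congr expR.
    by field.
  over.
under eq_integral do rewrite EFinM.
rewrite ge0_integralZl_EFin//.
- by rewrite integral_normal_pdf mule1.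
- by move=> x _; rewrite lee_fin normal_pdf_ge0.
- by apply/measurable_EFinP; exact: measurable_normal_pdf.
Qed.

(** Tilting by the square only changes the variance, to [s ^+ 2 / (1 - 2 * t * s ^+ 2)]; the
    constant is the ratio of the standard deviations. *)
Lemma normal_sqr_mgf t : (2 * t * s ^+ 2 < 1)%R ->
  \int[nu]_x (expR (t * x ^+ 2))%:E =
  (Num.sqrt (1 - 2 * t * s ^+ 2))^-1%:E.
Proof.
move=> ts; rewrite (integral_normal_law nuE)//; last first.
  by apply: measurableT_comp => //; exact: measurable_funM.
have sN0 : s != 0%R by rewrite gt_eqF.
have D0 : (0 < 1 - 2 * t * s ^+ 2)%R by rewrite subr_gt0.
pose r := (s / Num.sqrt (1 - 2 * t * s ^+ 2))%R.
have r0 : (0 < r)%R by rewrite divr_gt0// sqrtr_gt0.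
have rN0 : r != 0%R by rewrite gt_eqF.
have r2 : (r ^+ 2 = s ^+ 2 / (1 - 2 * t * s ^+ 2))%R.
  by rewrite expr_div_n sqr_sqrtr// ltW.
under eq_integral.
  move=> x _.
  have -> : (expR (t * x ^+ 2) * normal_pdf 0 s x =
     (Num.sqrt (1 - 2 * t * s ^+ 2))^-1 * normal_pdf 0 r x)%R.
    rewrite !normal_pdfE// mulrCA [RHS]mulrA; congr (_ * _)%R.
      rewrite /normal_peak r2.
      rewrite -invfM; congr (_^-1)%R.
      rewrite -sqrtrM ?(ltW D0)//; congr Num.sqrt.
      by rewrite -!mulrnAr; field; rewrite gt_eqF.
    rewrite /normal_fun -expRD; congr expR; rewrite r2.
    by field; rewrite gt_eqF//.
  over.
under eq_integral do rewrite EFinM.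
rewrite ge0_integralZl_EFin//.
- by rewrite integral_normal_pdf mule1.
- by move=> x _; rewrite lee_fin normal_pdf_ge0.
- by apply/measurable_EFinP; exact: measurable_normal_pdf.
Qed.

End GaussianMgf.

(** * Real-valued probabilities, union bounds and Markov's inequality *)

Section RealProbability.
Context {R : realType} {disp : measure_display} {T : measurableType disp}.
Variable P : probability T R.
Implicit Types A B : set T.

(** Probabilities are taken in [R] so that error bounds can be combined by linear arithmetic. *)
Definition prob A : R := fine (P A).

Lemma probE A : measurable A -> P A = (prob A)%:E.
Proof. by move=> mA; rewrite /prob fineK// fin_num_measure. Qed.

Lemma prob_ge0 A : 0 <= prob A.
Proof. exact: fine_ge0. Qed.

Lemma prob_le1 A : measurable A -> prob A <= 1.
Proof. by move=> mA; rewrite -lee_fin -probE// probability_le1. Qed.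

Lemma probT : prob setT = 1.
Proof. by rewrite /prob probability_setT. Qed.

Lemma integral_cst1 : (\int[P]_w 1 = 1)%E.
Proof. by rewrite integral_cst// mul1e; exact: probability_setT. Qed.

Lemma le_prob A B : measurable A -> measurable B -> A `<=` B ->
  prob A <= prob B.
Proof.
by move=> mA mB AB; rewrite -lee_fin -!probE// le_measure ?inE.
Qed.

Lemma probU A B : measurable A -> measurable B ->
  prob (A `|` B) <= prob A + prob B.
Proof.
move=> mA mB; rewrite -lee_fin EFinD -!probE//; last exact: measurableU.
exact: measureU2.
Qed.

Lemma probDI A B : measurable A -> measurable B ->
  prob A = prob (A `\` B) + prob (A `&` B).
Proof.
move=> mA mB; apply: EFin_inj; rewrite EFinD -!probE//; last 2 first.
- exact: measurableI.
- exact: measurableD.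
by rewrite -measureDI.
Qed.

Lemma measurable_exists (I : finType) (A : I -> set T) :
  (forall i, measurable (A i)) -> measurable [set w | exists i, A i w].
Proof.
move=> mA; rewrite (_ : [set w | _] = \bigcup_(i in [set: I]) A i).
  exact: fin_bigcup_measurable.
by apply/seteqP; split => w /= [i]; [exists i|exists i].
Qed.

Lemma prob_exists_le (I : finType) (A : I -> set T) :
  (forall i, measurable (A i)) ->
  prob [set w | exists i, A i w] <= \sum_i prob (A i).
Proof.
move=> mA.
suff H (s : seq I) : measurable (\big[setU/set0]_(i <- s) A i) /\
    prob (\big[setU/set0]_(i <- s) A i) <= \sum_(i <- s) prob (A i).
  apply: le_trans (H (index_enum I)).2; apply: le_prob.
  - exact: measurable_exists.
  - exact: (H _).1.
  - move=> w [i Aiw]; rewrite (bigD1_seq i) ?mem_index_enum ?index_enum_uniq//=.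
    by left.
elim: s => [|i s [IH1 IH2]].
  by rewrite !big_nil /prob measure0.
rewrite !big_cons; split; first exact: measurableU.
by apply: le_trans (probU _ _) _ => //; rewrite lerD2l.
Qed.

Lemma measurable_ler_fun (f g : T -> R) :
  measurable_fun setT f -> measurable_fun setT g ->
  measurable [set w | f w <= g w].
Proof.
move=> mf mg; rewrite (_ : [set w | _] = (fun w => g w - f w) @^-1` `[0, +oo[).
  by rewrite -[X in measurable X]setTI; exact: measurable_funB.
by apply/seteqP; split => w /=; rewrite in_itv/= andbT subr_ge0.
Qed.

Lemma measurable_ltr_fun (f g : T -> R) :
  measurable_fun setT f -> measurable_fun setT g ->
  measurable [set w | f w < g w].
Proof.
move=> mf mg; rewrite (_ : [set w | _] = ~` [set w | g w <= f w]).
  by apply: measurableC; exact: measurable_ler_fun.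
by apply/seteqP; split => w /=; rewrite ltNge => /negP.
Qed.

(** Markov's inequality, with [W] already normalized to be at least one on the event; it closes each
    Chernoff bound below. *)
Lemma prob_le_integral A (W : T -> R) (e : R) : measurable A ->
  measurable_fun setT W -> (forall w, 0 <= W w) -> (forall w, A w -> 1 <= W w) ->
  (\int[P]_w (W w)%:E = e%:E)%E -> prob A <= e.
Proof.
move=> mA mW W0 AW We; rewrite -lee_fin -probE// -We.
rewrite -(setIT A) -integral_indic//.
apply: ge0_le_integral => //.
- exact/measurable_EFinP/measurable_indic.
- exact/measurable_EFinP.
- move=> w _; rewrite lee_fin indicE; case: (boolP (_ \in _)) => //= wA.
  by apply: AW; rewrite -inE.
Qed.

Lemma expectation_card (m : nat) (S : T -> {set 'I_m}) :
  (forall i, measurable [set w | i \in S w]) ->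
  ('E_P[fun w => #|S w|%:R : R] = (\sum_i prob [set w | i \in S w])%:E)%E.
Proof.
move=> mS.
rewrite unlock.
have -> : (fun w => (#|S w|%:R : R)%:E) =
   (fun w => (\sum_i (\1_[set w | i \in S w] w)%:E)%E) :> (T -> \bar R).
  apply/funext => w; rewrite sumEFin -sum1_card natr_sum big_mkcond/=.
  congr (_%:E); apply: eq_bigr => i _; rewrite indicE.
  have -> : (w \in [set w0 | i \in S w0]) = (i \in S w) by apply/idP/idP; rewrite inE.
  by case: ifPn.
rewrite ge0_integral_sum//=.
- rewrite -sumEFin; apply: eq_bigr => i _.
  by rewrite integral_indic// setIT; exact: probE.
- by move=> i; apply/measurable_EFinP; exact: measurable_indic.
Qed.

Lemma measurable_mem_setD (m : nat) (A B : T -> {set 'I_m}) i :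
  measurable [set w | i \in A w] -> measurable [set w | i \in B w] ->
  measurable [set w | i \in A w :\: B w].
Proof.
move=> mA mB; rewrite (_ : [set w | _] = [set w | i \in A w] `\` [set w | i \in B w]).
  exact: measurableD.
apply/seteqP; split => w /=; rewrite finset.in_setD.
  by move=> /andP[/negP].
by move=> [-> /negP ->].
Qed.

End RealProbability.

(** * Tails of the noise and of the number of signals *)

Section Scores.
Context {R : realType} {m n : nat} {T : Type}.
Variables (sigma : R) (X : 'M[R]_(n, m.+1)).
Variables (beta : 'I_m -> T -> R) (eps : 'I_n -> T -> R).

(** The normalized projection of the noise on column [j]. Columns have squared norm [n], so under
    the model this is a standard normal variable. *)
Definition zscore j w : R :=
  (\sum_k X k j * eps k w) / (sigma * Num.sqrt n%:R).

Definition signal_score i w : R := Num.sqrt n%:R / sigma * beta i w.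

Definition noise_energy w : R := (\sum_k eps k w ^+ 2) / sigma ^+ 2.

End Scores.

Section NoiseTails.
Context {R : realType} {disp : measure_display} {T : measurableType disp}.
Variables (P : probability T R) (m n : nat) (p sigma : R) (nu : probability R R).
Variables (beta : 'I_m -> {RV P >-> R}) (eps : 'I_n -> {RV P >-> R}).
Hypothesis sigma_gt0 : 0 < sigma.
Hypothesis model : random_regression p sigma nu beta eps.

Let sN0 : sigma != 0. Proof. by rewrite gt_eqF. Qed.

Let eps_law j A : measurable A -> distribution P (eps j) A = normal_prob 0 sigma A.
Proof. by have [_ H _] := model; exact: H. Qed.

Lemma integral_model_prod (h : 'I_m -> R -> R) (g : 'I_n -> R -> R)
    (b : 'I_m -> R) (e : 'I_n -> R) :
  (forall i, measurable_fun [set: R] (h i)) -> (forall i x, 0 <= h i x) ->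
  (forall i, (\int[P]_w (h i (beta i w))%:E = (b i)%:E)%E) ->
  (forall j, measurable_fun [set: R] (g j)) -> (forall j x, 0 <= g j x) ->
  (forall j, (\int[distribution P (eps j)]_x (g j x)%:E = (e j)%:E)%E) ->
  (\int[P]_w (\prod_i h i (beta i w) * \prod_j g j (eps j w))%:E =
   (\prod_i b i * \prod_j e j)%:E)%E.
Proof.
move=> mh h0 E1 mg g0 ge; have [_ _ indep] := model.
pose f (k : 'I_m + 'I_n) := match k with inl i => h i | inr j => g j end.
have E2 j : (\int[P]_w (g j (eps j w))%:E = (e j)%:E)%E.
  rewrite -ge -(ge0_integral_distribution (eps j) (f := EFin \o g j))//.
    exact/measurable_EFinP.
  by move=> x; rewrite lee_fin.
have := integral_prod_independent (g := f) indep.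
have -> : (fun w => (\prod_k f k ((match k with inl i => beta i | inr j => eps j end) w))%:E) =
  (fun w => (\prod_i h i (beta i w) * \prod_j g j (eps j w))%:E) :> (T -> \bar R).
  by apply/funext => w; rewrite big_sumType.
rewrite big_sumType/=.
under eq_bigr do rewrite E1.
under [X in (_ * X)%E]eq_bigr do rewrite E2.
rewrite !prodEFin -EFinM; apply.
- by case=> k /=; [exact: mh|exact: mg].
- by case=> k x /=; [exact: h0|exact: g0].
- by case=> k /=; rewrite ?E1 ?E2.
Qed.

Lemma integral_noise_prod (A : 'I_m -> set R) (g : 'I_n -> R -> R) (e : 'I_n -> R) :
  (forall i, measurable (A i)) ->
  (forall j, measurable_fun [set: R] (g j)) -> (forall j x, 0 <= g j x) ->
  (forall j, (\int[distribution P (eps j)]_x (g j x)%:E = (e j)%:E)%E) ->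
  (\int[P]_w (\1_[set w | forall i, A i (beta i w)] w * \prod_j g j (eps j w))%:E =
   (\prod_i prob P (beta i @^-1` A i) * \prod_j e j)%:E)%E.
Proof.
move=> mA mg g0 ge.
have mbA i : measurable (beta i @^-1` A i) by exact: measurable_funPTI.
rewrite -(integral_model_prod (h := fun i => \1_(A i)) (g := g))//.
- apply: eq_integral => w _; congr (_ * _)%:E.
  rewrite indicE; have [|] := boolP (_ \in _).
    by rewrite inE => Aw; rewrite big1// => i _; rewrite indicE mem_set//; exact: Aw.
  move/negP => nA; apply/esym/eqP/prodf_eq0.
  have [i iw] : exists i, ~ A i (beta i w).
    apply: contrapT => H; apply: nA; rewrite inE => i.
    by apply: contrapT => ?; apply: H; exists i.
  by exists i => //; rewrite indicE memNset.
- by move=> i; rewrite integral_indic_comp// probE.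
Qed.

Variable X : 'M[R]_(n, m.+1).
Hypothesis X_design : orthogonal_design X.
Hypothesis n_gt0 : (0 < n)%N.

Local Notation zscore := (zscore sigma X (fun k => eps k)).

Lemma measurable_zscore j : measurable_fun setT (zscore j).
Proof.
apply: measurable_funM => //; apply: measurable_sum => k.
exact: measurable_funM.
Qed.

Lemma design_sqr j : \sum_k X k j ^+ 2 = n%:R.
Proof.
have [_ /matrixP/(_ j j)] := X_design.
rewrite !mxE eqxx mulr1n => <-; apply: eq_bigr => k _.
by rewrite !mxE expr2.
Qed.

(** Chernoff bound with parameter [c], using that the moment generating function of a score is
    [expR (t ^+ 2 / 2)]. The event on the coefficients is carried along inside the product formula,
    so that independence of signal and noise appears as a factor. Taking all [A i] trivial gives a
    plain tail; taking one nontrivial gives the joint bound for a small signal and a large noise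
    score. *)
Lemma zscore_tail (A : 'I_m -> set R) j (c : R) : (forall i, measurable (A i)) -> 0 <= c ->
  prob P [set w | (forall i, A i (beta i w)) /\ c <= `|zscore j w|] <=
  2 * expR (- c ^+ 2 / 2) * \prod_i prob P (beta i @^-1` A i).
Proof.
move=> mA c0.
have n0 : 0 < n%:R :> R by rewrite ltr0n.
have sn0 : Num.sqrt n%:R != 0 :> R by rewrite gt_eqF// sqrtr_gt0.
have mAll : measurable [set w | forall i, A i (beta i w)].
  rewrite (_ : [set w | _] = \bigcap_(i in [set: 'I_m]) (beta i @^-1` A i)).
    by apply: fin_bigcap_measurable => // i _; exact: measurable_funPTI.
  by apply/seteqP; split => w /= H i; [move=> _|]; exact: H.
have mz : measurable [set w | c <= `|zscore j w|].
  apply: measurable_ler_fun => //.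
  by apply: measurableT_comp => //; exact: measurable_zscore.
pose g t k x : R := expR (t * (X k j / (sigma * Num.sqrt n%:R)) * x).
pose e t k : R := expR (sigma ^+ 2 * (t * (X k j / (sigma * Num.sqrt n%:R))) ^+ 2 / 2).
have mg t k : measurable_fun [set: R] (g t k).
  by apply: measurableT_comp => //; exact: measurable_funM.
have g0 t k x : 0 <= g t k x by exact: expR_ge0.
have ge t k : (\int[distribution P (eps k)]_x (g t k x)%:E = (e t k)%:E)%E.
  by apply: normal_mgf => // A0 mA0; exact: eps_law.
have gE t w : \prod_k g t k (eps k w) = expR (t * zscore j w).
  rewrite -expR_sum; congr expR; rewrite /zscore mulr_suml mulr_sumr.
  by apply: eq_bigr => k _; rewrite -!mulrA; congr (_ * (_ * _)); rewrite mulrC.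
have eE t : \prod_k e t k = expR (t ^+ 2 / 2).
  rewrite -expR_sum; congr expR.
  transitivity ((t ^+ 2 / 2) / n%:R * \sum_k X k j ^+ 2).
    rewrite mulr_sumr; apply: eq_bigr => k _.
    have n2 : n%:R = Num.sqrt n%:R ^+ 2 :> R by rewrite sqr_sqrtr// ltW.
    by rewrite {2}n2; field; rewrite sn0 sN0.
  by rewrite design_sqr divfK// gt_eqF.
pose pA := \prod_i prob P (beta i @^-1` A i).
have pA0 : 0 <= pA by apply: prodr_ge0 => i _; exact: prob_ge0.
(* The sign [s] treats the two tails at once; [W] is the exponential tilt with parameter [c * s]. *)
have half s : s ^+ 2 = 1 ->
   prob P ([set w | forall i, A i (beta i w)] `&` [set w | c <= s * zscore j w]) <=
   expR (- c ^+ 2 / 2) * pA.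
  move=> s2.
  have mzs : measurable_fun setT (fun w => s * zscore j w).
    by apply: measurable_funM => //; exact: measurable_zscore.
  pose W w := expR (- c ^+ 2) * (\1_[set w | forall i, A i (beta i w)] w *
     \prod_k g (c * s) k (eps k w)).
  apply: (@prob_le_integral _ _ _ _ _ W).
  - by apply: measurableI => //; exact: measurable_ler_fun.
  - apply: measurable_funM => //; apply: measurable_funM => //.
    under eq_fun do rewrite gE.
    by apply: measurableT_comp => //; apply: measurable_funM => //; exact: measurable_zscore.
  - by move=> w; rewrite !mulr_ge0// prodr_ge0// => k _; exact: expR_ge0.
  - move=> w [Aw cz]; rewrite /W gE indicE mem_set// mul1r -expRD.
    rewrite -expR0 ler_expR -mulrA expr2 -mulNr.
    have : c * c <= c * (s * zscore j w) by exact: ler_wpM2l.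
    lra.
  - rewrite /W; under eq_integral do rewrite EFinM.
    rewrite ge0_integralZl_EFin//.
    + rewrite (integral_noise_prod (e := e (c * s)))//.
      rewrite -EFinM eE; congr (_%:E); rewrite mulrCA -/pA mulrC; congr (_ * _).
      by rewrite -expRD exprMn s2; congr expR; field.
    + by move=> w _; rewrite lee_fin mulr_ge0// prodr_ge0// => k _; exact: expR_ge0.
    + apply/measurable_EFinP; apply: measurable_funM => //.
      under eq_fun do rewrite gE.
      by apply: measurableT_comp => //; apply: measurable_funM => //; exact: measurable_zscore.
have mS s : measurable [set w | c <= s * zscore j w].
  apply: measurable_ler_fun => //; apply: measurable_funM => //.
  exact: measurable_zscore.
apply: (@le_trans _ _ (prob P
    (([set w | forall i, A i (beta i w)] `&` [set w | c <= 1 * zscore j w]) `|`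
     ([set w | forall i, A i (beta i w)] `&` [set w | c <= -1 * zscore j w])))).
  apply: le_prob.
  - exact: measurableI.
  - by apply: measurableU; exact: measurableI.
  - move=> w [Aw]; rewrite ler_normr => /orP[cz|cz]; [left|right]; split => //=.
      by rewrite mul1r.
    by rewrite mulN1r.
apply: le_trans (probU _ _ _) _; [exact: measurableI|exact: measurableI|].
rewrite -mulrA mulr2n mulrDl mul1r lerD//; apply: half; last by rewrite sqrrN expr1n.
by rewrite expr1n.
Qed.

Lemma prob_zscore_ge j (c : R) : 0 <= c ->
  prob P [set w | c <= `|zscore j w|] <= 2 * expR (- c ^+ 2 / 2).
Proof.
move=> c0; have := @zscore_tail (fun=> setT) j c (fun=> measurableT) c0.
rewrite big1; last by move=> i _; rewrite preimage_setT probT.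
rewrite mulr1; apply: le_trans; rewrite le_eqVlt; apply/orP; left; apply/eqP.
by congr prob; apply/seteqP; split => w //= [].
Qed.

Lemma prob_beta_zscore_ge (A : set R) i j (c : R) : measurable A -> 0 <= c ->
  prob P [set w | A (beta i w) /\ c <= `|zscore j w|] <=
  2 * expR (- c ^+ 2 / 2) * prob P (beta i @^-1` A).
Proof.
move=> mA c0; pose B i' := if i' == i then A else setT.
have mB i' : measurable (B i') by rewrite /B; case: ifP.
have := @zscore_tail B j c mB c0.
rewrite (bigD1 i)//= big1 ?mulr1; last first.
  by move=> i' /negbTE i'i; rewrite /B i'i preimage_setT probT.
rewrite /B eqxx; apply: le_trans; rewrite le_eqVlt; apply/orP; left; apply/eqP.
congr prob; apply/seteqP; split => w /= [H ?]; split=> //.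
  by move=> i'; case: ifPn => // /eqP ->.
by have := H i; rewrite eqxx.
Qed.

(** With [y = 2 x + 8 x^2] one has [(1 + y)(1 - 2 x) - 1 = 4 x^2 (1 - 4 x)], nonnegative for [x] up
    to [1/4]; then [expR y] is at least [1 + y], and square roots are taken. *)
Lemma inv_sqrt_le_expR (x : R) : `|x| <= 4^-1 ->
  (Num.sqrt (1 - 2 * x))^-1 <= expR (x + 4 * x ^+ 2).
Proof.
rewrite ler_norml => /andP[x1 x2].
have D0 : 0 < 1 - 2 * x by lra.
rewrite -[leRHS]invrK lef_pV2 ?posrE ?sqrtr_gt0// ?invr_gt0 ?expR_gt0//.
have -> : (expR (x + 4 * x ^+ 2))^-1 = Num.sqrt (expR (- (2 * x + 8 * x ^+ 2))).
  rewrite -expRN (_ : - (2 * x + 8 * x ^+ 2) =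
    - (x + 4 * x ^+ 2) + - (x + 4 * x ^+ 2)); last by ring.
  by rewrite expRD -expr2 sqrtr_sqr ger0_norm// expR_ge0.
apply: ler_wsqrtr; rewrite expRN -[leRHS]invrK lef_pV2 ?posrE ?expR_gt0 ?invr_gt0//.
apply: le_trans (expR_ge1Dx _); rewrite -[leLHS]mul1r ler_pdivrMr//.
nra.
Qed.

Local Notation noise_energy := (noise_energy sigma (fun k => eps k)).

Lemma measurable_noise_energy : measurable_fun setT noise_energy.
Proof.
apply: measurable_funM => //; apply: measurable_sum => k.
exact: measurable_funX.
Qed.

(** The noise energy is chi-square with [n] degrees of freedom. A positive [x] controls its upper
    tail and a negative [x] its lower one. *)
Lemma noise_energy_chernoff (x c : R) (A : set T) : `|x| <= 4^-1 ->
  measurable A -> (forall w, A w -> c <= x * noise_energy w) ->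
  prob P A <= expR (n%:R * (x + 4 * x ^+ 2) - c).
Proof.
move=> x4 mA Ac.
have x2 : 2 * (x / sigma ^+ 2) * sigma ^+ 2 = 2 * x by field.
pose g (k : 'I_n) y : R := expR (x / sigma ^+ 2 * y ^+ 2).
have mg k : measurable_fun [set: R] (g k).
  by apply: measurableT_comp => //; exact: measurable_funM.
have g0 k y : 0 <= g k y by exact: expR_ge0.
have ge k : (\int[distribution P (eps k)]_x (g k x)%:E = ((Num.sqrt (1 - 2 * x))^-1)%:E)%E.
  rewrite (normal_sqr_mgf sigma_gt0) ?x2//.
  - by move=> A0 mA0; exact: eps_law.
  - by move: x4; rewrite ler_norml => /andP[]; lra.
have gE w : \prod_k g k (eps k w) = expR (x * noise_energy w).
  rewrite -expR_sum; congr expR; rewrite /noise_energy mulrCA mulr_suml.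
  by apply: eq_bigr => k _; rewrite mulrC.
have := integral_noise_prod (A := fun=> setT) (fun=> measurableT) mg g0 ge.
rewrite big1; last by move=> i _; rewrite preimage_setT probT.
rewrite mul1r prodr_const card_ord => E.
have le1 : (Num.sqrt (1 - 2 * x))^-1 ^+ n <= expR (n%:R * (x + 4 * x ^+ 2)).
  by rewrite expRM_natl lerXn2r ?nnegrE ?expR_ge0 ?invr_ge0 ?sqrtr_ge0 ?inv_sqrt_le_expR.
have mW : measurable_fun setT (fun w => expR (x * noise_energy w)).
  by apply: measurableT_comp => //; apply: measurable_funM => //; exact: measurable_noise_energy.
rewrite expRD mulrC; apply: le_trans (ler_wpM2l (expR_ge0 _) le1).
apply: (@prob_le_integral _ _ _ _ _ (fun w => expR (- c) * expR (x * noise_energy w))) => //.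
- exact: measurable_funM.
- by move=> w Aw; rewrite -expRD -expR0 ler_expR addrC subr_ge0; exact: Ac.
- under eq_integral do rewrite EFinM.
  rewrite ge0_integralZl_EFin//; last exact/measurable_EFinP.
  rewrite [in RHS]EFinM -E; congr (_ * _)%E; apply: eq_integral => w _.
  by rewrite gE indicE mem_set// mul1r.
Qed.

Lemma prob_noise_energy (tau : R) : 0 <= tau <= 1 ->
  prob P [set w | n%:R * tau <= `|noise_energy w - n%:R|] <=
  2 * expR (- (n%:R * tau ^+ 2 / 16)).
Proof.
move=> /andP[t0 t1].
have mS s : measurable [set w | n%:R * tau <= s * (noise_energy w - n%:R)].
  apply: measurable_ler_fun => //; apply: measurable_funM => //.
  by apply: measurable_funB => //; exact: measurable_noise_energy.
have half s : s ^+ 2 = 1 -> `|s| = 1 ->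
    prob P [set w | n%:R * tau <= s * (noise_energy w - n%:R)] <=
    expR (- (n%:R * tau ^+ 2 / 16)).
  (* The exponent to minimize is [n (4 x^2 - tau |x|)], which is least at [|x| = tau / 8]. *)
  move=> s2 s1; pose x := s * (tau / 8).
  have xx : x ^+ 2 = tau ^+ 2 / 64 by rewrite /x exprMn s2; field.
  have := @noise_energy_chernoff x (n%:R * tau * (tau / 8) + x * n%:R) _ _ (mS s).
  have -> : n%:R * (x + 4 * x ^+ 2) - (n%:R * tau * (tau / 8) + x * n%:R) =
     - (n%:R * tau ^+ 2 / 16) by rewrite xx; field.
  apply.
    by rewrite normrM s1 mul1r ger0_norm; lra.
  move=> w /= H; have := ler_wpM2l (_ : 0 <= tau / 8) H; rewrite /x; lra.
have mN : measurable [set w | n%:R * tau <= `|noise_energy w - n%:R|].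
  apply: measurable_ler_fun => //; apply: measurableT_comp => //.
  by apply: measurable_funB => //; exact: measurable_noise_energy.
rewrite mulr2n mulrDl mul1r.
apply: (@le_trans _ _ (prob P ([set w | n%:R * tau <= 1 * (noise_energy w - n%:R)] `|`
   [set w | n%:R * tau <= -1 * (noise_energy w - n%:R)]))).
  apply: le_prob => //; first exact: measurableU.
  move=> w /=; rewrite ler_normr => /orP[cz|cz]; [left|right] => /=.
    by rewrite mul1r.
  by rewrite mulN1r.
apply: le_trans (probU _ _ _) _ => //.
by rewrite lerD//; apply: half; rewrite ?sqrrN ?expr1n ?normrN ?normr1.
Qed.

Hypothesis p01 : 0 <= p <= 1.
Hypothesis nu0 : nu [set 0] = 0%E.

Lemma prob_beta (A : set R) i : measurable A -> ~ A 0 ->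
  prob P (beta i @^-1` A) = p * prob nu A.
Proof.
move=> mA A0; have [H _ _] := model.
apply: EFin_inj; rewrite EFinM -!probE//; last exact: measurable_funPTI.
rewrite -[LHS]/(distribution P (beta i) A) H// /spike_slab_law diracE memNset//.
by rewrite mule0 add0e.
Qed.

Lemma prob_signal i : prob P [set w | beta i w != 0] = p.
Proof.
have -> : [set w | beta i w != 0] = beta i @^-1` (~` [set 0]).
  by apply/seteqP; split => w /=; [move/eqP|move=> /eqP].
rewrite prob_beta//; last by move=> H; exact: H.
  rewrite (_ : prob nu _ = 1) ?mulr1//.
  apply: EFin_inj; rewrite -probE; last exact: measurableC.
  by rewrite probability_setC// nu0 sube0.
exact: measurableC.
Qed.

Definition signal_count (w : T) : nat := #|true_model beta w|.

Lemma signal_countE w :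
  (signal_count w)%:R = \sum_i \1_[set w | beta i w != 0] w :> R.
Proof.
rewrite /signal_count -sum1_card natr_sum big_mkcond/=.
apply: eq_bigr => i _; rewrite inE indicE.
have -> : (w \in [set w | beta i w != 0]) = (beta i w != 0).
  by apply/idP/idP; rewrite inE.
by case: ifP.
Qed.

Lemma measurable_signal i : measurable [set w | beta i w != 0].
Proof.
rewrite (_ : [set w | _] = beta i @^-1` (~` [set 0])).
  by apply: measurable_funPTI; exact: measurableC.
by apply/seteqP; split => w /=; [move/eqP|move=> /eqP].
Qed.

Lemma measurable_signal_count : measurable_fun setT (fun w => (signal_count w)%:R : R).
Proof.
under eq_fun do rewrite signal_countE.
apply: measurable_sum => i; apply: measurable_indic.
exact: measurable_signal.
Qed.

(** The count is binomial with exponential moment [(1 + (e - 1) p)^m] at parameter one, and [e - 1]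
    is at most 3. *)
Lemma prob_signal_count_gt (L : nat) :
  prob P [set w | (L < signal_count w)%N] <= expR (3 * (m%:R * p) - L%:R).
Proof.
have mN0 : measurable (~` [set (0 : R)]) by exact: measurableC.
(* The exponential of an indicator, written as an affine function of it so that its integral follows
   from [prob_signal]. *)
pose h (x : R) : R := 1 + (expR 1 - 1) * \1_(~` [set 0]) x.
have e1 : 0 <= expR 1 - 1 :> R by rewrite subr_ge0 -expR0 ler_expR.
have e4 : expR 1 <= 4 :> R.
  have : expR (2^-1) <= 2 :> R.
    rewrite -[leLHS]invrK -expRN -[leRHS]invrK lef_pV2 ?posrE ?expR_gt0//.
    by apply: le_trans (expR_ge1Dx _); lra.
  have -> : expR 1 = expR 2^-1 * expR 2^-1 :> R by rewrite -expRD; congr expR; field.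
  by have := expR_ge0 (2^-1 : R); nra.
have h0 x : 0 <= h x by rewrite addr_ge0// mulr_ge0// indicE.
have mh : measurable_fun [set: R] h.
  by apply: measurable_funD => //; apply: measurable_funM => //; exact: measurable_indic.
have bE i : (\int[P]_w (h (beta i w))%:E = (1 + (expR 1 - 1) * p)%:E)%E.
  have mi : measurable_fun setT (fun w => \1_(~` [set 0]) (beta i w) : R).
    exact: (measurableT_comp (measurable_indic mN0)).
  under eq_integral do rewrite EFinD.
  rewrite ge0_integralD//; last by apply/measurable_EFinP; exact: measurable_funM.
  rewrite integral_cst1 EFinD; congr (_ + _)%E.
  under eq_integral do rewrite EFinM.
  rewrite ge0_integralZl_EFin//; last exact/measurable_EFinP.
  rewrite integral_indic_comp// probE; last exact: measurable_funPTI.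
  rewrite EFinM; congr (_ * _%:E)%E; rewrite -(prob_signal i); congr prob.
  by apply/seteqP; split => w /=; [move=> /eqP|move/eqP].
have mK : measurable [set w | (L < signal_count w)%N].
  rewrite (_ : [set w | _] = [set w | L%:R < (signal_count w)%:R :> R]).
    by apply: measurable_ltr_fun => //; exact: measurable_signal_count.
  by apply/seteqP; split => w /=; rewrite ltr_nat.
have hE w : \prod_i h (beta i w) = expR (signal_count w)%:R.
  rewrite signal_countE expR_sum; apply: eq_bigr => i _.
  rewrite /h !indicE.
  have -> : (w \in [set w | beta i w != 0]) = (beta i w != 0).
    by apply/idP/idP; rewrite inE.
  have -> : (beta i w \in ~` [set (0 : R)]) = (beta i w != 0).
    by apply/idP/idP; rewrite inE => /eqP.
  by case: (beta i w != 0); rewrite ?mulr0 ?addr0 ?expR0// mulr1 addrC subrK.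
have := integral_model_prod (h := fun=> h) (g := fun=> cst 1) (e := fun=> 1)
  (fun=> mh) (fun=> h0) bE (fun=> measurable_cst _) (fun _ _ => ler01).
rewrite prodr_const card_ord big1// mulr1 => E.
have {}E : (\int[P]_w (expR (signal_count w)%:R)%:E = ((1 + (expR 1 - 1) * p) ^+ m)%:E)%E.
  rewrite -E; last by move=> j; rewrite integral_cst1.
  by apply: eq_integral => w _; rewrite hE mulr1.
have mE : measurable_fun setT (fun w => expR (signal_count w)%:R : R).
  by apply: measurableT_comp => //; exact: measurable_signal_count.
have le1 : (1 + (expR 1 - 1) * p) ^+ m <= expR (3 * (m%:R * p)).
  rewrite mulrCA expRM_natl; apply: lerXn2r.
  - by rewrite nnegrE addr_ge0// mulr_ge0//; case/andP: p01.
  - by rewrite nnegrE expR_ge0.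
  apply: le_trans (expR_ge1Dx _) _; rewrite ler_expR ler_wpM2r//; last by lra.
  by case/andP: p01.
rewrite expRD mulrC; apply: le_trans (ler_wpM2l (expR_ge0 _) le1).
apply: (@prob_le_integral _ _ _ _ _ (fun w => expR (- L%:R) * expR (signal_count w)%:R)) => //.
- exact: measurable_funM.
- move=> w /= Lw; rewrite -expRD -[leLHS]expR0 ler_expR addrC subr_ge0.
  by rewrite (ler_nat R) ltnW.
- under eq_integral do rewrite EFinM.
  rewrite ge0_integralZl_EFin//; last exact/measurable_EFinP.
  by rewrite [in RHS]EFinM -E.
Qed.

End NoiseTails.

(** * Least squares for an orthogonal design *)

Section OrthogonalLeastSquares.
Context {R : realType} {n m : nat}.
Variable X : 'M[R]_(n, m.+1).
Hypothesis X_design : orthogonal_design X.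
Hypothesis n_gt0 : (0 < n)%N.
Implicit Types (y : 'cV[R]_n) (b : 'cV[R]_m.+1) (M : {set 'I_m}).

(** The usual least squares formula, the Gram matrix being [n] times the identity. *)
Definition full_fit y : 'cV[R]_m.+1 := n%:R^-1 *: (X^T *m y).

Let nR : n%:R != 0 :> R. Proof. by rewrite pnatr_eq0 -lt0n. Qed.

Lemma sum_squaresE (v : 'cV[R]_n) : sum_squares v = (v^T *m v) ord0 ord0.
Proof. by rewrite mxE; apply: eq_bigr => j _; rewrite !mxE expr2. Qed.

(** Completing the square in [b]. The criterion becomes a sum over coordinates, so that restricting
    to a submodel just deletes coordinates of the full fit. *)
Lemma sum_squares_residual y b :
  sum_squares (y - X *m b) =
  sum_squares y - n%:R * \sum_j full_fit y j ord0 ^+ 2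
  + n%:R * \sum_j (b j ord0 - full_fit y j ord0) ^+ 2.
Proof.
have [_ XX] := X_design.
have Xy : X^T *m y = n%:R *: full_fit y by rewrite scalerA divff// scale1r.
have yX : y^T *m X = n%:R *: (full_fit y)^T.
  by rewrite -[LHS]trmxK trmx_mul trmxK Xy linearZ.
rewrite !sum_squaresE [(_ - _)^T]raddfB/= mulmxBl !mulmxBr trmx_mul.
rewrite !mulmxA yX -(mulmxA b^T) Xy -(mulmxA b^T) XX -scalemxAl -scalemxAr.
rewrite mul_mx_scalar -scalemxAl.
set g := full_fit y.
have -> : \sum_j (b j ord0 - g j ord0) ^+ 2 =
    \sum_j (b j ord0 * b j ord0 + (- 2) * (g j ord0 * b j ord0) + g j ord0 ^+ 2).
  by apply: eq_bigr => j _; ring.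
rewrite !big_split/= -mulr_sumr !mxE.
have -> : \sum_j g^T ord0 j * b j ord0 = \sum_j g j ord0 * b j ord0.
  by apply: eq_bigr => j _; rewrite mxE.
have -> : \sum_j b^T ord0 j * g j ord0 = \sum_j g j ord0 * b j ord0.
  by apply: eq_bigr => j _; rewrite mxE mulrC.
have -> : \sum_j b^T ord0 j * b j ord0 = \sum_j b j ord0 * b j ord0.
  by apply: eq_bigr => j _; rewrite mxE.
ring.
Qed.

Definition submodel_fit M y : 'cV[R]_m.+1 :=
  \col_j (if unlift ord0 j is Some i then (i \in M)%:R * full_fit y j ord0
          else full_fit y j ord0).

Lemma submodel_fit_coefs M y : coefs_of M (submodel_fit M y).
Proof. by move=> i /negbTE iM; rewrite mxE liftK iM mul0r. Qed.

Lemma sum_squares_submodel_fit M y :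
  \sum_j (submodel_fit M y j ord0 - full_fit y j ord0) ^+ 2 =
  \sum_(i | i \notin M) full_fit y (lift ord0 i) ord0 ^+ 2.
Proof.
rewrite big_ord_recl/= mxE unlift_none subrr expr0n/= add0r [RHS]big_mkcond/=.
apply: eq_bigr => i _; rewrite mxE liftK.
by case: (i \in M); rewrite /= ?mul1r ?subrr ?expr0n// mul0r sub0r sqrrN.
Qed.

Lemma submodel_fit_least_squares M y : least_squares X M y (submodel_fit M y).
Proof.
split; first exact: submodel_fit_coefs.
move=> b' b'M; rewrite !sum_squares_residual lerD2l ler_wpM2l//.
rewrite sum_squares_submodel_fit [leRHS]big_ord_recl/= [leLHS]big_mkcond/=.
rewrite -[leLHS]add0r lerD ?sqr_ge0//; apply: ler_sum => i _.
by case: ifPn => [iM|_]; rewrite ?sqr_ge0// b'M// sub0r sqrrN.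
Qed.

Lemma lse_least_squares M y : least_squares X M y (lse X M y).
Proof. by apply: getPex; exists (submodel_fit M y); exact: submodel_fit_least_squares. Qed.

Lemma RSS_full_fit M y :
  RSS X M y = sum_squares y - n%:R * \sum_j full_fit y j ord0 ^+ 2
  + n%:R * \sum_(i | i \notin M) full_fit y (lift ord0 i) ord0 ^+ 2.
Proof.
rewrite -sum_squares_submodel_fit -sum_squares_residual.
apply/eqP; rewrite eq_le; apply/andP; split.
  by apply: (lse_least_squares M y).2; exact: submodel_fit_coefs.
by apply: (submodel_fit_least_squares M y).2; exact: (lse_least_squares M y).1.
Qed.

(** Uniqueness of the minimizer: the vector picked by [lse] attains the residual sum of squares of
    [full_fit], so its squared distance to [full_fit] is zero. *)
Lemma beta_hat_full_fit y i : beta_hat X y i = full_fit y (lift ord0 i) ord0.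
Proof.
have := RSS_full_fit [set: 'I_m] y.
rewrite /RSS sum_squares_residual => /addrI /(mulfI nR).
rewrite [RHS]big1 => [|k]; last by rewrite inE.
move/eqP; rewrite psumr_eq0 => [|k _]; last exact: sqr_ge0.
move=> /allP/(_ (lift ord0 i)); rewrite mem_index_enum => /(_ isT).
by rewrite sqrf_eq0 subr_eq0 => /eqP.
Qed.

End OrthogonalLeastSquares.

(** * Estimates and residual sums of squares in terms of the scores *)

Section RegressionScores.
Context {R : realType} {T : Type}.
Variables (m n : nat) (sigma b0 : R).
Variables (beta : 'I_m -> T -> R) (eps : 'I_n -> T -> R).
Variable X : 'M[R]_(n, m.+1).
Hypothesis X_design : orthogonal_design X.
Hypothesis n_gt0 : (0 < n)%N.
Hypothesis sigma_gt0 : 0 < sigma.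

Local Notation Y := (response X b0 beta eps).
Local Notation u := (signal_score (n := n) sigma beta).
Local Notation z := (zscore sigma X eps).

Let sn_gt0 : 0 < Num.sqrt n%:R :> R.
Proof. by rewrite sqrtr_gt0 ltr0n. Qed.
Let sn2 : Num.sqrt n%:R ^+ 2 = n%:R :> R.
Proof. by rewrite sqr_sqrtr// ler0n. Qed.

Lemma full_fit_response w j : full_fit X (Y w) j ord0 =
  with_intercept b0 (beta ^~ w) j ord0 + sigma / Num.sqrt n%:R * z j w.
Proof.
have [_ XX] := X_design.
rewrite /full_fit /response mulmxDr mulmxA XX mul_scalar_mx scalerDr scalerA.
rewrite mulVf ?gt_eqF ?ltr0n// scale1r [LHS]mxE; congr (_ + _).
rewrite !mxE /zscore.
have -> : \sum_k X^T j k * (\col_k eps k w) k ord0 = \sum_k X k j * eps k w.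
  by apply: eq_bigr => k _; rewrite !mxE.
by rewrite -{1}sn2; field; rewrite gt_eqF//= gt_eqF.
Qed.

Lemma beta_hat_response w i :
  beta_hat X (Y w) i =
  sigma / Num.sqrt n%:R * (u i w + z (lift ord0 i) w).
Proof.
rewrite beta_hat_full_fit// full_fit_response mxE liftK mulrDr; congr (_ + _).
by rewrite /signal_score; field; rewrite gt_eqF//= gt_eqF.
Qed.

(** The residual at the true coefficients is the noise itself; evaluating the quadratic
    decomposition there identifies its constant term. *)
Lemma RSS_response w (M : {set 'I_m}) :
  RSS X M (Y w) = sigma ^+ 2 * (noise_energy sigma eps w - \sum_j z j w ^+ 2 +
    \sum_(i | i \notin M) (u i w + z (lift ord0 i) w) ^+ 2).
Proof.
pose b := with_intercept b0 (beta ^~ w).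
have := sum_squares_residual X_design n_gt0 (Y w) b.
have -> : Y w - X *m b = \col_j eps j w by rewrite /response addrC addKr.
have -> : n%:R * \sum_j (b j ord0 - full_fit X (Y w) j ord0) ^+ 2 = sigma ^+ 2 * \sum_j z j w ^+ 2.
  rewrite !mulr_sumr; apply: eq_bigr => j _; rewrite full_fit_response.
  by rewrite -{1}sn2 /b; field; rewrite gt_eqF.
rewrite RSS_full_fit// => E.
have -> : sum_squares (Y w) - n%:R * \sum_j full_fit X (Y w) j ord0 ^+ 2 =
   sum_squares (\col_j eps j w) - sigma ^+ 2 * \sum_j z j w ^+ 2.
  by rewrite E addrK.
rewrite !mulrDr; congr (_ + _ + _).
- rewrite /noise_energy mulrC divfK ?gt_eqF ?exprn_gt0//.
  by apply: eq_bigr => k _; rewrite mxE.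
- by rewrite mulrN.
- rewrite !mulr_sumr; apply: eq_bigr => i _.
  rewrite -beta_hat_full_fit// beta_hat_response -{1}sn2.
  by field; rewrite gt_eqF.
Qed.

End RegressionScores.

(** * Local optimality of the mBIC minimizer *)

Section LocalOptimality.
Context {R : realType} {m : nat}.
Variables (E : R) (z : 'I_m.+1 -> R) (u : 'I_m -> R) (n L : nat) (pen B tau : R).

Local Notation x i := (u i + z (lift ord0 i)).
Local Notation signals := ([set i | u i != 0]%SET).

(* RSS_M / sigma^2, when [E] is the noise energy and [z], [u] the noise and
   signal scores. *)
Definition scaled_rss (M : {set 'I_m}) : R :=
  E - \sum_j z j ^+ 2 + \sum_(i | i \notin M) x i ^+ 2.

Hypothesis z_le : forall j, z j ^+ 2 <= B.
Hypothesis E_lo : n%:R * (1 - tau) <= E.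
Hypothesis E_hi : E <= n%:R * (1 + tau).
Hypothesis signals_le : (#|signals| <= L)%N.
Hypothesis n_gt0 : (0 < n)%N.
Hypothesis pen_ge0 : 0 <= pen.

(** A lower bound for [scaled_rss M / n]. The indices of [M] and of the signals, at most [2 * L] in
    number, and the intercept remove at most [B] each. *)
Definition rss_lower : R := 1 - tau - (2 * L%:R + 1) * B / n%:R.
Hypothesis rss_lower_gt0 : 0 < rss_lower.

Let nR : @Order.lt _ R 0 n%:R. Proof. by rewrite ltr0n. Qed.
Let B_ge0 : 0 <= B. Proof. exact: le_trans (sqr_ge0 _) (z_le ord0). Qed.

(** A null regressor outside [M] has its squared noise score both subtracted and added. After
    cancellation the subtracted sum has only few terms, however close [m] is to [n]. *)
Lemma scaled_rssE (M : {set 'I_m}) :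
  scaled_rss M = E - z ord0 ^+ 2 - \sum_(i in M :|: signals) z (lift ord0 i) ^+ 2
  + \sum_(i in signals :\: M) x i ^+ 2.
Proof.
rewrite /scaled_rss big_ord_recl/= opprD addrA -!addrA; congr (_ + (_ + _)).
rewrite (bigID (mem (M :|: signals)))/= opprD -addrA; congr (_ + _).
rewrite (bigID (mem signals) (fun i => i \notin M))/= [X in - X + _](eq_bigl
   (fun i => (i \notin M) && (i \notin signals))); last first.
  by move=> i; rewrite inE negb_or.
rewrite addrCA (eq_bigl (fun i => i \in signals :\: M)); last first.
  by move=> i; rewrite /= finset.in_setD.
rewrite -[RHS]addr0; congr (_ + _).
apply/eqP; rewrite addrC subr_eq0; apply/eqP; apply: eq_bigr => i.
by rewrite inE negbK => /andP[_ /eqP ->]; rewrite add0r.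
Qed.

Lemma scaled_rss_ge (M : {set 'I_m}) : (#|M| <= L)%N -> n%:R * rss_lower <= scaled_rss M.
Proof.
move=> ML; rewrite scaled_rssE.
have H1 : \sum_(i in M :|: signals) z (lift ord0 i) ^+ 2 <= 2 * L%:R * B.
  apply: (@le_trans _ _ (\sum_(i in M :|: signals) B)); first exact: ler_sum.
  rewrite sumr_const -[leLHS]mulr_natl ler_wpM2r// -natrM ler_nat mul2n -addnn.
  by apply: (leq_trans (leq_addr #|M :&: signals| _)); rewrite cardsUI leq_add.
have H2 : 0 <= \sum_(i in signals :\: M) x i ^+ 2 by apply: sumr_ge0 => i _; exact: sqr_ge0.
have z0 := z_le ord0.
have -> : n%:R * rss_lower = n%:R * (1 - tau) - (2 * L%:R + 1) * B.
  by rewrite /rss_lower; field; rewrite gt_eqF.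
have -> : n%:R * (1 - tau) - (2 * L%:R + 1) * B = n%:R * (1 - tau) - 2 * L%:R * B - B by ring.
move: E_lo z0 H1 H2; set s1 := \sum_(i in M :|: _) _; set s2 := \sum_(i in _ :\: M) _.
move: (_ * (1 - tau)) (_ ^+ 2) (_ * B) s1 s2 => a b c s1 s2 h1 h2 h3 h4; lra.
Qed.

Lemma scaled_rss_gt0 (M : {set 'I_m}) : (#|M| <= L)%N -> 0 < scaled_rss M.
Proof. by move=> ML; apply: lt_le_trans (scaled_rss_ge ML); rewrite mulr_gt0. Qed.

Lemma scaled_rss_le (M : {set 'I_m}) :
  scaled_rss M <= E + \sum_(i in signals :\: M) x i ^+ 2.
Proof.
rewrite scaled_rssE.
have H1 : 0 <= \sum_(i in M :|: signals) z (lift ord0 i) ^+ 2.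
  by apply: sumr_ge0 => i _; exact: sqr_ge0.
have := sqr_ge0 (z ord0); lra.
Qed.

Lemma scaled_rssD1 (M : {set 'I_m}) i : i \in M ->
  scaled_rss (M :\ i) = scaled_rss M + x i ^+ 2.
Proof.
move=> iM; rewrite /scaled_rss -[RHS]addrA; congr (_ + _).
rewrite (bigD1 i)/=; last by rewrite !inE eqxx.
rewrite addrC; congr (_ + _); apply: eq_bigl => j.
rewrite !inE negb_and negbK; have [->|ji] /= := eqVneq j i; last by rewrite andbT.
by rewrite iM.
Qed.

Variable S : {set 'I_m}.
Hypothesis S_le : (#|S| <= L)%N.
Hypothesis S_min : forall M : {set 'I_m}, (#|M| <= L)%N ->
  n%:R * ln (scaled_rss S) + #|S|%:R * pen <=
  n%:R * ln (scaled_rss M) + #|M|%:R * pen.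

(** The relative decrease of the residual sum of squares that pays exactly for one penalty:
    [- n * ln (1 - gain) = pen]. *)
Definition gain : R := 1 - expR (- (pen / n%:R)).

Lemma gain_ge0 : 0 <= gain.
Proof. by rewrite subr_ge0 -expR0 ler_expR oppr_le0 divr_ge0. Qed.

Lemma gain_le : gain <= pen / n%:R.
Proof. by rewrite /gain; have := expR_ge1Dx (- (pen / n%:R)); lra. Qed.

Lemma ln_le_shift (a b c : R) : 0 < a -> 0 < b ->
  n%:R * ln a + c <= n%:R * ln b -> a <= b * expR (- (c / n%:R)).
Proof.
move=> a0 b0 H; rewrite -{1}(lnK a0) -{1}(lnK b0) -expRD ler_expR.
rewrite -(ler_pM2l nR) mulrDr mulrN mulrCA divff ?gt_eqF// mulr1; lra.
Qed.

Lemma selected_ge i : i \in S -> n%:R * rss_lower * gain <= x i ^+ 2.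
Proof.
move=> iS; have SiL : (#|S :\ i| <= L)%N.
  by apply: leq_trans S_le; rewrite subset_leq_card// finset.subsetDl.
have := S_min SiL; rewrite (cardsD1 i S) iS natrD mulrDl mul1r => H.
have := @ln_le_shift (scaled_rss S) (scaled_rss (S :\ i)) pen (scaled_rss_gt0 S_le) (scaled_rss_gt0 SiL).
move=> /(_ ltac:(lra)); rewrite {1}(scaled_rssD1 iS) => H2.
have := scaled_rss_ge SiL.
move=> /(ler_wpM2r gain_ge0) /le_trans; apply.
rewrite /gain; move: H2; rewrite (scaled_rssD1 iS).
lra.
Qed.

Lemma unselected_le i : i \notin S -> (#|S| < L)%N ->
  x i ^+ 2 <= scaled_rss S * (pen / n%:R).
Proof.
move=> iS SL; have SiL : (#|i |: S| <= L)%N by rewrite cardsU1 iS.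
have SE : scaled_rss S = scaled_rss (i |: S) + x i ^+ 2.
  by rewrite -scaled_rssD1 ?finset.setU11// finset.setU1K.
have := S_min SiL; rewrite cardsU1 iS natrD mulrDl mul1r => H.
have := @ln_le_shift (scaled_rss S) (scaled_rss (i |: S)) (- pen) (scaled_rss_gt0 S_le) (scaled_rss_gt0 SiL).
move=> /(_ ltac:(lra)); rewrite mulNr opprK => H2.
apply: le_trans (ler_wpM2l (ltW (scaled_rss_gt0 S_le)) gain_le).
have : scaled_rss S * expR (- (pen / n%:R)) <= scaled_rss (i |: S).
  by rewrite expRN ler_pdivrMr ?expR_gt0.
by rewrite /gain SE; lra.
Qed.

Hypothesis L_pen : L%:R * pen / n%:R < 1.

(* The second alternative arises when [S] is full: exchanging [i] for a null
   regressor [j] of [S] must not decrease the residual sum of squares. *)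
Lemma missed_le i : i \in signals :\: S ->
  x i ^+ 2 <= pen * (1 + tau) / (1 - L%:R * pen / n%:R) \/
  exists2 j, j \in S :\: signals & x i ^+ 2 <= z (lift ord0 j) ^+ 2.
Proof.
rewrite inE => /andP[iS isig].
have [SL|LS] := ltnP #|S| L.
  left; have H := unselected_le iS SL; apply: le_trans H _.
  (* The bound of [unselected_le] involves [scaled_rss S], which itself contains the missed signals.
     Summing it over at most [L] missed signals gives an inequality for [scaled_rss S] in terms of
     itself, solvable because [L * pen / n < 1]. *)
  have H1 : \sum_(k in signals :\: S) x k ^+ 2 <= L%:R * (scaled_rss S * (pen / n%:R)).
    apply: (@le_trans _ _ (\sum_(k in signals :\: S) scaled_rss S * (pen / n%:R))).
      by apply: ler_sum => k; rewrite inE => /andP[kS _]; exact: unselected_le.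
    rewrite sumr_const -[leLHS]mulr_natl ler_wpM2r//.
      by rewrite mulr_ge0 ?divr_ge0// ltW// scaled_rss_gt0.
    rewrite ler_nat; apply: leq_trans signals_le.
    by rewrite subset_leq_card// finset.subsetDl.
  have H2 : scaled_rss S * (1 - L%:R * pen / n%:R) <= n%:R * (1 + tau).
    have := scaled_rss_le S; have := E_hi.
    have -> : scaled_rss S * (1 - L%:R * pen / n%:R) = scaled_rss S - L%:R * (scaled_rss S * (pen / n%:R)).
      by ring.
    lra.
  have P1 : 0 < 1 - L%:R * pen / n%:R by rewrite subr_gt0.
  rewrite -ler_pdivlMr// in H2.
  apply: le_trans (ler_wpM2r _ H2) _; first by rewrite divr_ge0.
  rewrite le_eqVlt; apply/orP; left; apply/eqP; field.
  rewrite (gt_eqF nR)/=.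
  have -> : n%:R - L%:R * pen = n%:R * (1 - L%:R * pen / n%:R).
    by field; rewrite gt_eqF.
  by rewrite mulf_neq0// gt_eqF.
right.
have SLe : #|S| = L by apply/eqP; rewrite eqn_leq S_le.
(* Were all of [S] made of signals, the signal [i] outside [S] would make the signals more than [L]
   in number. *)
have [j jS] : exists j, j \in S :\: signals.
  apply/finset.set0Pn; apply/negP; rewrite finset.setD_eq0 => Ss.
  have : (#|S| < #|signals|)%N.
    by apply: proper_card; apply/properP; split => //; exists i.
  by rewrite ltnNge SLe signals_le.
exists j => //; move: jS; rewrite inE => /andP[jsig jS].
have uj : u j = 0 by move: jsig; rewrite inE negbK => /eqP.
pose S' := i |: (S :\ j).
have iSj : i \notin S :\ j by rewrite inE negb_and iS orbT.
have S'c : #|S'| = #|S| by rewrite cardsU1 iSj (cardsD1 j S) jS.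
have S'L : (#|S'| <= L)%N by rewrite S'c.
have := S_min S'L; rewrite S'c lerD2r ler_pM2l//.
rewrite ler_ln ?posrE ?scaled_rss_gt0//.
have : scaled_rss (S :\ j) = scaled_rss S + z (lift ord0 j) ^+ 2.
  by rewrite scaled_rssD1// uj add0r.
have : scaled_rss (S :\ j) = scaled_rss S' + x i ^+ 2.
  by rewrite -scaled_rssD1 ?finset.setU11// finset.setU1K.
lra.
Qed.

End LocalOptimality.

(** * Error probabilities for fixed m *)

Section ErrorProbabilities.
Context {R : realType} {disp : measure_display} {T : measurableType disp}.
Variables (P : probability T R) (m n : nat) (p sigma : R) (nu : probability R R).
Variables (beta : 'I_m -> {RV P >-> R}) (eps : 'I_n -> {RV P >-> R}).
Variables (X : 'M[R]_(n, m.+1)) (b0 : R).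
Hypothesis sigma_gt0 : 0 < sigma.
Hypothesis model : random_regression p sigma nu beta eps.
Hypothesis X_design : orthogonal_design X.
Hypothesis n_gt0 : (0 < n)%N.
Hypothesis p01 : 0 <= p <= 1.
Hypothesis nu0 : nu [set 0] = 0%E.

Local Notation z := (zscore sigma X (fun k => eps k)).
Local Notation u := (signal_score (n := n) sigma (fun i => beta i)).
Local Notation Y := (response X b0 (fun i => beta i) (fun k => eps k)).

Let rn_gt0 : @Order.lt _ R 0 (Num.sqrt n%:R).
Proof. by rewrite sqrtr_gt0 ltr0n. Qed.

Let p_ge0 : 0 <= p. Proof. by case/andP: p01. Qed.

(** The probability that a signal score has modulus at most [r], given that the coefficient is drawn
    from the slab. *)
Definition slab_ball (r : R) : R :=
  prob nu `[- (sigma * r / Num.sqrt n%:R), sigma * r / Num.sqrt n%:R]%classic.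

Let slab_itv (r : R) : set R :=
  `[- (sigma * r / Num.sqrt n%:R), sigma * r / Num.sqrt n%:R]%classic `\ 0.

Let measurable_slab_itv r : measurable (slab_itv r).
Proof. exact: measurableD. Qed.

Lemma signal_score_le i (r : R) w : (`|u i w| <= r) =
  (beta i w \in `[- (sigma * r / Num.sqrt n%:R), sigma * r / Num.sqrt n%:R]).
Proof.
rewrite in_itv/= -ler_norml /signal_score normrM [`|_ / sigma|]gtr0_norm ?divr_gt0//.
by rewrite mulrAC ler_pdivrMr// [RHS]ler_pdivlMr// [in RHS]mulrC [sigma * r]mulrC.
Qed.

Let slab_itvE i r w : slab_itv r (beta i w) <-> beta i w != 0 /\ `|u i w| <= r.
Proof.
rewrite signal_score_le; split => [[b1 /eqP b2]|[/eqP b1 b2]]; first by split.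
by split.
Qed.

Lemma prob_small_signal i (r : R) :
  prob P [set w | beta i w != 0 /\ `|u i w| <= r] = p * slab_ball r.
Proof.
have -> : [set w | beta i w != 0 /\ `|u i w| <= r] = beta i @^-1` slab_itv r.
  by apply/seteqP; split => w /slab_itvE.
rewrite (prob_beta model)//; last by move=> [_]; apply.
congr (_ * _); rewrite /slab_ball.
rewrite [RHS](@probDI _ _ _ nu _ [set 0])// [prob nu (_ `&` _)](_ : _ = 0) ?addr0//.
apply/eqP; rewrite eq_le prob_ge0 andbT.
apply: (@le_trans _ _ (prob nu [set 0])).
  by apply: le_prob => //; exact: measurableI.
by rewrite /prob nu0.
Qed.

Lemma measurable_score_sum i : measurable_fun setT (fun w => u i w + z (lift ord0 i) w).
Proof.
apply: measurable_funD; last exact: measurable_zscore.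
exact: measurable_funM.
Qed.

Lemma measurable_signal_score i : measurable_fun setT (u i).
Proof. exact: measurable_funM. Qed.

Lemma prob_small_signal_large_noise i j (r c : R) : 0 <= c ->
  prob P [set w | (beta i w != 0 /\ `|u i w| <= r) /\ c <= `|z j w|] <=
  2 * expR (- c ^+ 2 / 2) * (p * slab_ball r).
Proof.
move=> c0; have := prob_beta_zscore_ge sigma_gt0 model X_design n_gt0 i j (measurable_slab_itv r) c0.
have E : [set w | beta i w != 0 /\ `|u i w| <= r] = beta i @^-1` slab_itv r.
  by apply/seteqP; split => w /slab_itvE.
rewrite -E prob_small_signal; apply: le_trans; rewrite le_eqVlt; apply/orP; left.
apply/eqP; congr prob; apply/seteqP.
by split => w [/slab_itvE H1 H2].
Qed.

Let m_sig i := measurable_signal beta i.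

Let m_u i (r : R) : measurable [set w | `|u i w| <= r].
Proof.
apply: measurable_ler_fun => //; apply: measurableT_comp => //.
exact: measurable_signal_score.
Qed.

Let m_z j (r : R) : measurable [set w | r <= `|z j w|].
Proof.
apply: measurable_ler_fun => //; apply: measurableT_comp => //.
exact: measurable_zscore.
Qed.

Let m_z' j (r : R) : measurable [set w | `|z j w| <= r].
Proof.
apply: measurable_ler_fun => //; apply: measurableT_comp => //.
exact: measurable_zscore.
Qed.

Let m_uz i (r : R) : measurable [set w | `|u i w + z (lift ord0 i) w| <= r].
Proof.
apply: measurable_ler_fun => //; apply: measurableT_comp => //.
exact: measurable_score_sum.
Qed.

Let m_uz' i (r : R) : measurable [set w | `|u i w + z (lift ord0 i) w| < r].
Proof.
apply: measurable_ltr_fun => //; apply: measurableT_comp => //.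
exact: measurable_score_sum.
Qed.

(** If the noise score is at most [v], the signal score is at most [c + v]. Otherwise it is still at
    most [c + b], and by independence the Gaussian tail at [v] multiplies a slab probability. In the
    applications [v] is a small fraction of [c] and [b] a multiple of it, so the product is
    negligible although the tail at [v] alone need not be. *)
Lemma prob_missed_le i (c b v : R) : 0 <= v ->
  prob P [set w | beta i w != 0 /\ `|u i w + z (lift ord0 i) w| <= c /\
                  `|z (lift ord0 i) w| <= b] <=
  p * slab_ball (c + v) + 2 * expR (- v ^+ 2 / 2) * (p * slab_ball (c + b)).
Proof.
move=> v0.
have m1 r : measurable [set w | beta i w != 0 /\ `|u i w| <= r].
  exact: (measurableI _ _ (m_sig i) (m_u i r)).
have m2 : measurable [set w | (beta i w != 0 /\ `|u i w| <= c + b) /\ v <= `|z (lift ord0 i) w|].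
  exact: (measurableI _ _ (m1 _) (m_z _ _)).
apply: (@le_trans _ _ (prob P ([set w | beta i w != 0 /\ `|u i w| <= c + v] `|`
   [set w | (beta i w != 0 /\ `|u i w| <= c + b) /\ v <= `|z (lift ord0 i) w|]))).
  apply: le_prob.
  - exact: (measurableI _ _ (m_sig i) (measurableI _ _ (m_uz i c) (m_z' _ b))).
  - exact: measurableU.
  move=> w [b1 [uz zb]]; have tri := ler_normB (u i w + z (lift ord0 i) w) (z (lift ord0 i) w).
  rewrite addrK in tri.
  have [zv|vz] := lerP `|z (lift ord0 i) w| v.
    by left; split => //; apply: le_trans tri _; rewrite lerD.
  by right; split; [split => //; apply: le_trans tri _; rewrite lerD|exact: ltW].
apply: le_trans (probU _ _ _) _ => //.
rewrite lerD//; first by rewrite prob_small_signal.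
exact: prob_small_signal_large_noise.
Qed.

Lemma prob_missed_ge i (c v : R) : 0 <= v ->
  p * slab_ball (c - v) * (1 - 2 * expR (- v ^+ 2 / 2)) <=
  prob P [set w | beta i w != 0 /\ `|u i w + z (lift ord0 i) w| < c].
Proof.
move=> v0; set C := [set w | beta i w != 0 /\ _].
pose A := [set w | beta i w != 0 /\ `|u i w| <= c - v].
pose B := [set w | (beta i w != 0 /\ `|u i w| <= c - v) /\ v <= `|z (lift ord0 i) w|].
have mA : measurable A by exact: (measurableI _ _ (m_sig i) (m_u i _)).
have mB : measurable B by exact: (measurableI _ _ mA (m_z _ _)).
have mC : measurable C by exact: (measurableI _ _ (m_sig i) (m_uz' i _)).
have H : prob P A <= prob P C + prob P B.
  apply: le_trans (probU _ mC mB); apply: le_prob => //; first exact: measurableU.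
  move=> w [b1 uc]; have [vz|zv] := lerP v `|z (lift ord0 i) w|; first by right.
  by left; split => //; apply: le_lt_trans (ler_normD _ _) _; lra.
have H1 : prob P A = p * slab_ball (c - v) by exact: prob_small_signal.
have H2 : prob P B <= 2 * expR (- v ^+ 2 / 2) * (p * slab_ball (c - v)).
  exact: prob_small_signal_large_noise.
rewrite H1 in H; nra.
Qed.

Lemma measurable_true_model i :
  measurable [set w | i \in true_model (fun i => beta i) w].
Proof.
rewrite (_ : [set w | _] = [set w | beta i w != 0]); first exact: m_sig.
by apply/seteqP; split => w /=; rewrite inE.
Qed.

(** * Errors of the Bayes oracle when its scaled thresholds have moduli between [c1] and [c2] *)

Section Oracle.
Variables (delta0 deltaA : R).

Local Notation lo := (oracle_lower n p delta0 deltaA sigma nu).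
Local Notation hi := (oracle_upper n p delta0 deltaA sigma nu).
Local Notation S w := (Bayes_oracle p delta0 deltaA sigma nu X (Y w)).

Lemma mem_Bayes_oracle i w : (i \in S w) =
  ~~ (lo * Num.sqrt n%:R / sigma < u i w + z (lift ord0 i) w < hi * Num.sqrt n%:R / sigma).
Proof.
rewrite /Bayes_oracle inE (beta_hat_response (sigma := sigma))//; congr (~~ (_ && _)).
- by rewrite -[sigma / _]invf_div ltr_pdivlMl ?divr_gt0// [_ * lo]mulrC mulrA.
- by rewrite -[sigma / _]invf_div ltr_pdivrMl ?divr_gt0// [_ * hi]mulrC mulrA.
Qed.

Lemma measurable_Bayes_oracle i : measurable [set w | i \in S w].
Proof.
rewrite (_ : [set w | _] = ~` ([set w | lo * Num.sqrt n%:R / sigma < u i w + z (lift ord0 i) w]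
   `&` [set w | u i w + z (lift ord0 i) w < hi * Num.sqrt n%:R / sigma])).
  apply: measurableC; apply: measurableI; apply: measurable_ltr_fun => //;
  exact: measurable_score_sum.
apply/seteqP; split => w /=; rewrite mem_Bayes_oracle.
  by move=> /negP H [h1 h2]; apply: H; rewrite h1.
by move=> H; apply/negP => /andP[h1 h2]; exact: H.
Qed.

Variables (c1 c2 : R).
Hypothesis c1_ge0 : 0 <= c1.
Hypothesis lo_le : - c2 <= lo * Num.sqrt n%:R / sigma <= - c1.
Hypothesis hi_le : c1 <= hi * Num.sqrt n%:R / sigma <= c2.

Lemma oracle_false_le i :
  prob P [set w | i \in S w :\: true_model (fun i => beta i) w] <= 2 * expR (- c1 ^+ 2 / 2).
Proof.
apply: le_trans (prob_zscore_ge sigma_gt0 model X_design n_gt0 (lift ord0 i) c1_ge0).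
apply: le_prob => //.
  apply: measurable_mem_setD; first exact: measurable_Bayes_oracle.
  exact: measurable_true_model.
move=> w /=; rewrite finset.in_setD mem_Bayes_oracle inE negbK => /andP[/eqP b1].
rewrite /signal_score b1 mulr0 add0r => H.
rewrite leNgt; apply: contra H; rewrite ltr_norml => /andP[h1 h2].
case/andP: lo_le => _ l2; case/andP: hi_le => l3 _.
by rewrite (le_lt_trans l2 h1) (lt_le_trans h2 l3).
Qed.

Lemma measurable_oracle_missed i :
  measurable [set w | i \in true_model (fun i => beta i) w :\: S w].
Proof.
apply: measurable_mem_setD; first exact: measurable_true_model.
exact: measurable_Bayes_oracle.
Qed.

Lemma oracle_missed_le i (b v : R) : 0 <= v -> 0 <= b ->
  prob P [set w | i \in true_model (fun i => beta i) w :\: S w] <=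
  p * slab_ball (c2 + v) + 2 * expR (- v ^+ 2 / 2) * (p * slab_ball (c2 + b)) +
  2 * expR (- b ^+ 2 / 2).
Proof.
move=> v0 b_ge0.
apply: le_trans (lerD (prob_missed_le i c2 b v0)
  (prob_zscore_ge sigma_gt0 model X_design n_gt0 (lift ord0 i) b_ge0)).
have m1 : measurable [set w | beta i w != 0 /\ `|u i w + z (lift ord0 i) w| <= c2 /\ `|z (lift ord0 i) w| <= b].
  exact: (measurableI _ _ (m_sig i) (measurableI _ _ (m_uz i _) (m_z' _ b))).
apply: le_trans (probU _ m1 (m_z (lift ord0 i) b)); apply: le_prob.
- exact: measurable_oracle_missed.
- exact: measurableU.
move=> w /=; rewrite finset.in_setD mem_Bayes_oracle negbK inE => /andP[/andP[h1 h2] bi].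
have [bz|zb] := lerP b `|z (lift ord0 i) w|; first by right.
left; split => //; split; last exact: ltW.
rewrite ler_norml; case/andP: lo_le => l1 _; case/andP: hi_le => _ l3.
by rewrite (le_trans l1 (ltW h1)) (le_trans (ltW h2) l3).
Qed.

Lemma oracle_missed_ge i (v : R) : 0 <= v ->
  p * slab_ball (c1 - v) * (1 - 2 * expR (- v ^+ 2 / 2)) <=
  prob P [set w | i \in true_model (fun i => beta i) w :\: S w].
Proof.
move=> v0; apply: le_trans (prob_missed_ge i c1 v0) _.
apply: le_prob.
- exact: (measurableI _ _ (m_sig i) (m_uz' i _)).
- exact: measurable_oracle_missed.
move=> w /= [bi]; rewrite ltr_norml => /andP[h1 h2].
case/andP: lo_le => _ l2; case/andP: hi_le => l3 _.
by rewrite finset.in_setD mem_Bayes_oracle negbK inE bi (le_lt_trans l2 h1) (lt_le_trans h2 l3).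
Qed.

End Oracle.

(** * Errors of the mBIC rule *)

Section MBIC.
Variables (d : R) (L : nat) (sel : 'cV[R]_n -> {set 'I_m}).
Hypothesis sel_mBIC : mBIC_rule X d L sel.
Hypothesis sel_meas : forall M : {set 'I_m}, measurable [set w | sel (Y w) = M].
Variables (tau b : R).

Definition penalty : R := ln n%:R + 2 * ln m%:R + d.
(** Outside [bad_event], a selected regressor has squared score at least [lower_level], and a signal
    missed by a model that is not full has squared score at most [upper_level]. Both levels are
    asymptotic to the penalty. *)
Definition lower_level : R :=
  n%:R * rss_lower n L (b ^+ 2) tau * gain n penalty.
Definition upper_level : R :=
  penalty * (1 + tau) / (1 - L%:R * penalty / n%:R).
(** The terms are Chernoff bounds for the three parts of [bad_event]: noise energy, the [m + 1]
    noise scores including that of the intercept, and the number of signals. *)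
Definition bad_bound : R :=
  2 * expR (- (n%:R * tau ^+ 2 / 16)) + m.+1%:R * (2 * expR (- b ^+ 2 / 2)) +
  expR (3 * (m%:R * p) - L%:R).

Hypothesis tau01 : 0 <= tau <= 1.
Hypothesis b_ge0 : 0 <= b.
Hypothesis pen_ge0 : 0 <= penalty.
Hypothesis rss_gt0 : 0 < rss_lower n L (b ^+ 2) tau.
Hypothesis L_pen : L%:R * penalty / n%:R < 1.

Local Notation S w := (sel (Y w)).
Local Notation E := (noise_energy sigma (fun k => eps k)).

Definition bad_event : set T :=
  [set w | n%:R * tau <= `|E w - n%:R|] `|`
  [set w | exists j, b <= `|z j w|] `|`
  [set w | (L < signal_count beta w)%N].

Lemma measurable_selected i : measurable [set w | i \in S w].
Proof.
have m1 (M : {set 'I_m}) : measurable [set w | i \in M /\ S w = M].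
  have [iM|iM] := boolP (i \in M).
    rewrite (_ : [set w | _] = [set w | S w = M]); first exact: sel_meas.
    by apply/seteqP; split => w /=; [case|move=> ?; split].
  rewrite (_ : [set w | _] = set0); first exact: measurable0.
  by apply/seteqP; split => w //= [].
rewrite (_ : [set w | _] = [set w | exists M : {set 'I_m}, i \in M /\ S w = M]).
  exact: (measurable_exists m1).
by apply/seteqP; split => w /=; [move=> ?; exists (S w)|move=> [M [iM ->]]].
Qed.

Let m_E : measurable [set w | n%:R * tau <= `|E w - n%:R|].
Proof.
apply: measurable_ler_fun => //; apply: measurableT_comp => //.
by apply: measurable_funB => //; exact: measurable_noise_energy.
Qed.

Let m_K : measurable [set w | (L < signal_count beta w)%N].
Proof.
rewrite (_ : [set w | _] = [set w | L%:R < (signal_count beta w)%:R :> R]).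
  by apply: measurable_ltr_fun => //; exact: measurable_signal_count.
by apply/seteqP; split => w /=; rewrite ltr_nat.
Qed.

Let m_zz : measurable [set w | exists j, b <= `|z j w|].
Proof. by apply: measurable_exists => j; exact: m_z. Qed.

Lemma measurable_bad_event : measurable bad_event.
Proof. by apply: measurableU => //; exact: measurableU. Qed.

Lemma prob_bad_event : prob P bad_event <= bad_bound.
Proof.
apply: le_trans (probU _ _ _) _ => //; first exact: measurableU.
apply: lerD; last by apply: prob_signal_count_gt; eassumption.
apply: le_trans (probU _ _ _) _ => //.
apply: lerD; first by apply: prob_noise_energy; eassumption.
apply: le_trans (prob_exists_le _ _) _ => [j|]; first exact: m_z.
apply: (@le_trans _ _ (\sum_(j < m.+1) 2 * expR (- b ^+ 2 / 2))).
  by apply: ler_sum => j _; exact: (prob_zscore_ge sigma_gt0 model).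
by rewrite sumr_const card_ord -[leLHS]mulr_natl.
Qed.

Section GoodOutcome.
Variable w : T.
Hypothesis w_good : ~ bad_event w.

Let zb j : `|z j w| < b.
Proof. by rewrite ltNge; apply/negP => H; apply: w_good; left; right; exists j. Qed.

Let zb2 j : z j w ^+ 2 <= b ^+ 2.
Proof. by rewrite -real_normK ?num_real// lerXn2r ?nnegrE// ltW. Qed.

Let E_close : `|E w - n%:R| < n%:R * tau.
Proof. by rewrite ltNge; apply/negP => H; apply: w_good; left; left. Qed.

Let E_lo : n%:R * (1 - tau) <= E w.
Proof. by move: E_close; rewrite ltr_norml => /andP[]; lra. Qed.

Let E_hi : E w <= n%:R * (1 + tau).
Proof. by move: E_close; rewrite ltr_norml => /andP[]; lra. Qed.

Let score_neq0 i : (u i w != 0) = (beta i w != 0).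
Proof. by rewrite /signal_score mulf_eq0 gt_eqF// divr_gt0. Qed.

Let signalsE : [set i | u i w != 0]%SET = true_model (fun i => beta i) w.
Proof. by apply/setP => i; rewrite !inE score_neq0. Qed.

Let signals_le : (#|[set i | u i w != 0%R]%SET| <= L)%N.
Proof. by rewrite signalsE leqNgt; apply/negP => H; apply: w_good; right. Qed.

Let rss := scaled_rss (E w) (z^~ w) (u^~ w).

Let S_min (M : {set 'I_m}) : (#|M| <= L)%N ->
  n%:R * ln (rss (S w)) + #|S w|%:R * penalty <=
  n%:R * ln (rss M) + #|M|%:R * penalty.
Proof.
move=> ML; have [SL H] := sel_mBIC (Y w); have := H M ML.
have pos (N : {set 'I_m}) : (#|N| <= L)%N -> 0 < rss N
  by move=> NL; exact: (scaled_rss_gt0 zb2 E_lo signals_le n_gt0 rss_gt0 NL).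
(* The factor [sigma ^+ 2] adds the same constant to all criteria, so the unknown variance drops
   out. Splitting the logarithm needs a positive residual sum of squares, which is available for
   models of size at most [L]. *)
have RE (N : {set 'I_m}) : (#|N| <= L)%N ->
    n%:R * ln (RSS X N (Y w)) = n%:R * ln (sigma ^+ 2) + n%:R * ln (rss N).
  move=> NL; rewrite (RSS_response b0 _ _ X_design n_gt0 sigma_gt0) -/(rss N).
  by rewrite lnM ?posrE ?exprn_gt0 ?pos// mulrDr.
by rewrite /mBIC -/penalty !RE// -!addrA lerD2l.
Qed.

Lemma good_selected i : i \in S w ->
  lower_level <= (u i w + z (lift ord0 i) w) ^+ 2.
Proof.
have [SL _] := sel_mBIC (Y w).
exact: (selected_ge zb2 E_lo signals_le n_gt0 pen_ge0 rss_gt0 SL S_min).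
Qed.

(** In the full case the score of [i] is dominated by the noise score of a selected null [j]. This
    noise score is less than [b], whence the bound [2 * b] on the signal, and at least the selection
    level, since [j] was selected. *)
Lemma good_missed i : i \in true_model (fun i => beta i) w :\: S w ->
  `|u i w + z (lift ord0 i) w| <= Num.sqrt upper_level \/
  `|u i w| <= 2 * b /\ exists j : 'I_m, Num.sqrt lower_level <= `|z (lift ord0 j) w|.
Proof.
move=> iSt; have : i \in [set i | u i w != 0]%SET :\: S w by rewrite signalsE.
have [SL _] := sel_mBIC (Y w).
case/(missed_le zb2 E_lo E_hi signals_le n_gt0 pen_ge0 rss_gt0 SL S_min L_pen) => [H|[j jS H]].
  by left; rewrite -sqrtr_sqr ler_wsqrtr.
right; move: jS; rewrite finset.in_setD inE negbK => /andP[/eqP uj jS].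
split.
  have xz : `|u i w + z (lift ord0 i) w| <= `|z (lift ord0 j) w|.
    by rewrite -!sqrtr_sqr ler_wsqrtr.
  have tri := ler_normB (u i w + z (lift ord0 i) w) (z (lift ord0 i) w).
  rewrite addrK in tri.
  have := zb (lift ord0 i); have := zb (lift ord0 j); lra.
exists j; rewrite -sqrtr_sqr ler_wsqrtr//.
by have := good_selected jS; rewrite uj add0r.
Qed.

End GoodOutcome.

Lemma lower_level_ge0 : 0 <= lower_level.
Proof. by rewrite /lower_level !mulr_ge0// ?gain_ge0// ltW. Qed.

Lemma mBIC_false_le i :
  prob P [set w | i \in S w :\: true_model (fun i => beta i) w] <=
  2 * expR (- lower_level / 2) + bad_bound.
Proof.
have sl2 : Num.sqrt lower_level ^+ 2 = lower_level by rewrite sqr_sqrtr// lower_level_ge0.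
have := prob_zscore_ge sigma_gt0 model X_design n_gt0 (lift ord0 i) (sqrtr_ge0 lower_level).
rewrite sl2 => H1.
apply: le_trans (lerD H1 prob_bad_event).
apply: le_trans (probU _ (m_z _ _) measurable_bad_event).
apply: le_prob.
- apply: measurable_mem_setD; first exact: measurable_selected.
  exact: measurable_true_model.
- by apply: measurableU => //; exact: measurable_bad_event.
move=> w /=; rewrite finset.in_setD inE negbK => /andP[/eqP b1 iS].
have [wb|wg] := pselect (bad_event w); first by right.
left; have := good_selected wg iS; rewrite /signal_score b1 mulr0 add0r => H.
by rewrite -sqrtr_sqr ler_wsqrtr.
Qed.

Lemma measurable_mBIC_missed i :
  measurable [set w | i \in true_model (fun i => beta i) w :\: S w].
Proof.
by apply: measurable_mem_setD; [exact: measurable_true_model|exact: measurable_selected].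
Qed.

(** The third term is the full-model alternative, a union over the null regressors that may have
    taken the place of [i]. The factor [p * slab_ball (2 * b)], due to independence, is essential:
    [m * expR (- lower_level / 2)] tends to zero, but not faster than the main term. *)
Lemma mBIC_missed_le i v : 0 <= v ->
  prob P [set w | i \in true_model (fun i => beta i) w :\: S w] <=
  p * slab_ball (Num.sqrt upper_level + v) +
  2 * expR (- v ^+ 2 / 2) * (p * slab_ball (Num.sqrt upper_level + b)) +
  m%:R * (2 * expR (- lower_level / 2) * (p * slab_ball (2 * b))) + bad_bound.
Proof.
move=> v0; set c := Num.sqrt upper_level.
have sl2 : Num.sqrt lower_level ^+ 2 = lower_level by rewrite sqr_sqrtr// lower_level_ge0.
pose A := [set w | beta i w != 0 /\ `|u i w + z (lift ord0 i) w| <= c /\ `|z (lift ord0 i) w| <= b].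
pose B j := [set w | (beta i w != 0 /\ `|u i w| <= 2 * b) /\
   Num.sqrt lower_level <= `|z (lift ord0 j) w|].
have mA : measurable A.
  exact: (measurableI _ _ (m_sig i) (measurableI _ _ (m_uz i _) (m_z' _ b))).
have mB j : measurable (B j).
  exact: (measurableI _ _ (measurableI _ _ (m_sig i) (m_u i _)) (m_z _ _)).
have mBB : measurable [set w | exists j, B j w] by exact: measurable_exists.
have hB : prob P [set w | exists j, B j w] <=
    m%:R * (2 * expR (- lower_level / 2) * (p * slab_ball (2 * b))).
  apply: le_trans (prob_exists_le _ mB) _.
  apply: (@le_trans _ _ (\sum_(j < m) (2 * expR (- lower_level / 2) * (p * slab_ball (2 * b))))).
    apply: ler_sum => j _; rewrite -[in leRHS]sl2.
    by apply: prob_small_signal_large_noise; exact: sqrtr_ge0.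
  by rewrite sumr_const card_ord -[leLHS]mulr_natl.
apply: le_trans (lerD (lerD (prob_missed_le i c b v0) hB) prob_bad_event).
apply: le_trans (lerD (probU P mA mBB) (lexx _)).
apply: le_trans (probU P (measurableU _ _ mA mBB) measurable_bad_event).
apply: le_prob.
- exact: measurable_mBIC_missed.
- by apply: measurableU; [exact: measurableU|exact: measurable_bad_event].
move=> w /= iw; have [wb|wg] := pselect (bad_event w); first by right.
have bi : beta i w != 0 by move: iw; rewrite finset.in_setD inE => /andP[].
left; have [H|[H1 [j H2]]] := good_missed wg iw.
  left; split => //; split => //; rewrite leNgt; apply/negP => H3.
  by apply: wg; left; right; exists (lift ord0 i); exact: ltW.
by right; exists j.
Qed.

Lemma mBIC_missed_ge i v : 0 <= v ->
  p * slab_ball (Num.sqrt lower_level - v) * (1 - 2 * expR (- v ^+ 2 / 2)) - bad_bound <=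
  prob P [set w | i \in true_model (fun i => beta i) w :\: S w].
Proof.
move=> v0; rewrite lerBlDr.
apply: le_trans (prob_missed_ge i _ v0) _.
apply: le_trans (lerD (lexx _) prob_bad_event).
apply: le_trans (probU P (measurable_mBIC_missed i) measurable_bad_event).
apply: le_prob.
- exact: (measurableI _ _ (m_sig i) (m_uz' i _)).
- by apply: measurableU; [exact: measurable_mBIC_missed|exact: measurable_bad_event].
move=> w /= [bi H]; have [wb|wg] := pselect (bad_event w); first by right.
left; rewrite finset.in_setD inE bi andbT; apply/negP => iS.
have := good_selected wg iS; apply/negP; rewrite -ltNge.
rewrite -[ltLHS]real_normK ?num_real// -[ltRHS]sqr_sqrtr ?lower_level_ge0//.
by rewrite ltrXn2r ?nnegrE.
Qed.

End MBIC.

End ErrorProbabilities.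

(** * The slab near zero and the oracle thresholds *)

Section SlabDensity.
Context {R : realType}.
Variables (nu : probability R R) (e0 K : R) (rho : R -> R) (rhom rhop : R).
Hypothesis e0_gt0 : 0 < e0.
Hypothesis mrho : measurable_fun `[- e0, e0] rho.
Hypothesis rhoK : forall x, x \in `[- e0, e0] -> 0 < rho x <= K.
Hypothesis nuE : forall A, measurable A -> A `<=` `[- e0, e0] ->
  nu A = (\int[lebesgue_measure]_(x in A) (rho x)%:E)%E.
Hypothesis rhom_gt0 : 0 < rhom.
Hypothesis rhop_gt0 : 0 < rhop.
Hypothesis rhomP : rho x @[x --> 0^'-] --> rhom.
Hypothesis rhopP : rho x @[x --> 0^'+] --> rhop.

Let D : set R := `[- e0, e0].

Let rho_ge0 x : D x -> 0 <= rho x.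
Proof. by move=> Dx; have /andP[/ltW] := rhoK Dx. Qed.

Let measurable_rho (i : interval R) : [set` i] `<=` D ->
  measurable_fun [set` i] rho.
Proof. by move=> iD; apply: (measurable_funS _ iD mrho); exact: measurable_itv. Qed.

Let zeroD : 0 \in `[- e0, e0].
Proof. by rewrite in_itv/= oppr_le0 !ltW. Qed.

Lemma prob_itv_ge (i : interval R) (c : R) (l : R) :
  [set` i] `<=` D -> (forall x, x \in i -> c <= rho x) -> 0 <= c ->
  lebesgue_measure [set` i] = l%:E -> c * l <= prob nu [set` i].
Proof.
move=> iD ic c0 il; rewrite -lee_fin -probE// nuE// EFinM -il.
rewrite -integral_cst//; apply: ge0_le_integral => //.
by apply/measurable_EFinP; exact: measurable_rho.
Qed.

Lemma prob_itv_le (i : interval R) (c : R) (l : R) :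
  [set` i] `<=` D -> (forall x, x \in i -> rho x <= c) ->
  lebesgue_measure [set` i] = l%:E -> prob nu [set` i] <= c * l.
Proof.
move=> iD ic il; rewrite -lee_fin -probE// nuE// EFinM -il.
have [->|/set0P[x0 ix0]] := eqVneq [set` i] set0.
  by rewrite integral_set0 measure0 mule0.
have c0 : 0 <= c by apply: le_trans (ic _ ix0); exact/rho_ge0/iD.
rewrite -integral_cst//; apply: ge0_le_integral => //.
- by move=> x ix; rewrite lee_fin rho_ge0//; exact: iD.
- by apply/measurable_EFinP; exact: measurable_rho.
Qed.

Lemma prob_ball_split (t : R) : 0 < t -> t <= e0 ->
  prob nu `[- t, t] = prob nu `[- t, 0[ + prob nu `]0, t].
Proof.
move=> t0 te.
have nu0 : prob nu [set 0] = 0.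
  rewrite /prob nuE//; first by rewrite integral_set1.
  by move=> x ->; rewrite /D/= in_itv/= oppr_le0 ltW.
rewrite (@probDI _ _ _ nu _ `]0, t])//.
have -> : `[- t, t] `&` `]0, t] = `]0, t]%classic :> set R.
  by apply/seteqP; split => x /=; rewrite !in_itv/=; lra.
congr (_ + _).
rewrite (@probDI _ _ _ nu _ [set 0])//; last exact: measurableD.
rewrite [X in _ + X](_ : _ = 0) ?addr0.
  by congr prob; apply/seteqP; split => x /=; rewrite !in_itv/=; lra.
apply/eqP; rewrite eq_le prob_ge0 andbT -[leRHS]nu0; apply: le_prob => //.
by apply: measurableI => //; exact: measurableD.
Qed.

(** The two half-intervals are treated separately because the density may have different one-sided
    limits at zero; each contributes its own limit times [t]. *)
Lemma slab_small_ball (e : R) : 0 < e -> exists2 t0, 0 < t0 &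
  forall t, 0 < t < t0 ->
  (rhom + rhop - e) * t <= prob nu `[- t, t] <= (rhom + rhop + e) * t.
Proof.
move=> e_gt0.
(* Staying below [rhom] and [rhop] keeps the lower bounds on the density nonnegative, as
   [prob_itv_ge] requires. *)
pose e' := Num.min (e / 2) (Num.min rhom rhop).
have e'0 : 0 < e' by rewrite !lt_min divr_gt0// rhom_gt0.
have e'e : e' <= e / 2 by rewrite ge_min lexx.
have e'm : e' <= rhom by rewrite !ge_min lexx orbT.
have e'p : e' <= rhop by rewrite !ge_min lexx !orbT.
have /cvgrPdist_lt/(_ _ e'0) [tm /= tm0 Hm] := rhomP.
have /cvgrPdist_lt/(_ _ e'0) [tp /= tp0 Hp] := rhopP.
exists (Num.min e0 (Num.min tm tp)); first by rewrite !lt_min e0_gt0 tm0.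
move=> t /andP[t0]; rewrite !lt_min => /and3P[te ttm ttp].
rewrite prob_ball_split//; last exact: ltW.
have Lm : lebesgue_measure `[- t, (0:R)[%classic = t%:E.
  by rewrite lebesgue_measure_itv/= lte_fin oppr_lt0 t0 -EFinB sub0r opprK.
have Lp : lebesgue_measure `](0:R), t]%classic = t%:E.
  by rewrite lebesgue_measure_itv/= lte_fin t0 -EFinB subr0.
have Dm : `[- t, 0[ `<=` D by move=> x /=; rewrite /D/= !in_itv/=; lra.
have Dp : `]0, t] `<=` D by move=> x /=; rewrite /D/= !in_itv/=; lra.
have Bm x : x \in `[- t, 0[ -> `|rhom - rho x| < e'.
  rewrite in_itv/= => /andP[x1 x2]; apply: Hm => //=.
  by rewrite sub0r normrN ltr0_norm//; lra.
have Bp x : x \in `]0, t] -> `|rhop - rho x| < e'.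
  rewrite in_itv/= => /andP[x1 x2]; apply: Hp => //=.
  by rewrite sub0r normrN gtr0_norm//; lra.
have m1 : (rhom - e') * t <= prob nu `[- t, 0[.
  apply: prob_itv_ge => //; last by lra.
  by move=> x /Bm; rewrite ltr_norml => /andP[]; lra.
have p1 : (rhop - e') * t <= prob nu `]0, t].
  apply: prob_itv_ge => //; last by lra.
  by move=> x /Bp; rewrite ltr_norml => /andP[]; lra.
have m2 : prob nu `[- t, 0[ <= (rhom + e') * t.
  apply: prob_itv_le => //.
  by move=> x /Bm; rewrite ltr_norml => /andP[]; lra.
have p2 : prob nu `]0, t] <= (rhop + e') * t.
  apply: prob_itv_le => //.
  by move=> x /Bp; rewrite ltr_norml => /andP[]; lra.
have e't : e' * t <= e / 2 * t by rewrite ler_wpM2r// ltW.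
by apply/andP; split; nra.
Qed.

(** Pointwise positivity alone gives no uniform lower bound. Near zero one is provided by half of
    each one-sided limit; the value of the density at zero is unrelated to these limits and enters
    the minimum on its own. *)
Lemma slab_itv_lower : exists e1 c1, [/\ 0 < e1, e1 <= e0, 0 < c1 &
  forall a b, - e1 <= a -> a <= b -> b <= e1 -> c1 * (b - a) <= prob nu `[a, b]].
Proof.
have hm : 0 < rhom / 2 by rewrite divr_gt0.
have hp : 0 < rhop / 2 by rewrite divr_gt0.
have /cvgrPdist_lt/(_ _ hm) [tm /= tm0 Hm] := rhomP.
have /cvgrPdist_lt/(_ _ hp) [tp /= tp0 Hp] := rhopP.
have r0 : 0 < rho 0 by have /andP[] := rhoK zeroD.
exists (Num.min e0 (Num.min tm tp / 2)), (Num.min (rho 0) (Num.min (rhom / 2) (rhop / 2))).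
split.
- by rewrite lt_min e0_gt0 divr_gt0// lt_min tm0.
- by rewrite ge_min lexx.
- by rewrite !lt_min r0 hm.
move=> a b; set e1 := Num.min e0 _; set c1 := Num.min (rho 0) _ => a1 ab b1.
have e1e : e1 <= e0 by rewrite ge_min lexx.
have e1m : e1 < tm.
  apply: (@le_lt_trans _ _ (tm / 2)); last by lra.
  by rewrite /e1 ge_min [X in _ || X](_ : _ = true) ?orbT// ler_pM2r ?invr_gt0// ge_min lexx.
have e1p : e1 < tp.
  apply: (@le_lt_trans _ _ (tp / 2)); last by lra.
  by rewrite /e1 ge_min [X in _ || X](_ : _ = true) ?orbT// ler_pM2r ?invr_gt0// ge_min lexx orbT.
apply: prob_itv_ge.
- by move=> x /=; rewrite /D/= !in_itv/=; lra.
- move=> x; rewrite in_itv/= => /andP[x1 x2].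
  have [xneg|xpos|->] := ltgtP x 0.
  + apply: (@le_trans _ _ (rhom / 2)); first by rewrite !ge_min lexx orbT.
    have : `|rhom - rho x| < rhom / 2.
      by apply: Hm => //=; rewrite sub0r normrN ltr0_norm//; lra.
    by rewrite ltr_norml => /andP[]; lra.
  + apply: (@le_trans _ _ (rhop / 2)); first by rewrite !ge_min lexx !orbT.
    have : `|rhop - rho x| < rhop / 2.
      by apply: Hp => //=; rewrite sub0r normrN gtr0_norm//; lra.
    by rewrite ltr_norml => /andP[]; lra.
  + by rewrite ge_min lexx.
- by rewrite ltW// !lt_min r0 hm.
- rewrite lebesgue_measure_itv/= lte_fin; case: ifPn => [_|]; first by rewrite -EFinB.
  by rewrite -leNgt => ba; rewrite (_ : a = b) ?subrr//; apply/eqP; rewrite eq_le ab.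
Qed.

(** The density of the slab is at most [K] on the interval, and the Gaussian function integrates to
    [s * Num.sqrt (pi *+ 2)] over the line. *)
Lemma slab_gauss_integral (s a : R) : 0 < s ->
  (\int[nu]_(x in D) (normal_fun a s x)%:E <= (K * (s * Num.sqrt (pi *+ 2)))%:E)%E.
Proof.
move=> s0; have sN0 : s != 0 by rewrite gt_eqF.
have mD : measurable D by exact: measurable_itv.
have K0 : 0 <= K by have /andP[/ltW h1 h2] := rhoK zeroD; exact: le_trans h2.
have mg : measurable_fun [set: R] (normal_fun a s) by exact: measurable_normal_fun.
rewrite (eq_measure_integral (mrestr nu mD)); last first.
  by move=> A mA AD; transitivity (nu (A `&` D)) => //; rewrite (setIidl AD).
apply: (@le_trans _ _ (\int[mrestr nu mD]_x (normal_fun a s x)%:E)%E).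
  apply: ge0_subset_integral => //; first exact/measurable_EFinP.
  by move=> x _; rewrite lee_fin normal_fun_ge0.
pose W := rho \_ D.
have mW : measurable_fun [set: R] W.
  by apply/(measurable_restrict _ _ _).1 => //; rewrite setTI.
have W0 x : 0 <= W x.
  by rewrite /W patchE; case: ifPn => //; rewrite inE; exact: rho_ge0.
rewrite -(@ge0_integral_density R _ _ _ R lebesgue_measure _ id W)//; last 2 first.
- by move=> x; exact: normal_fun_ge0.
- move=> A mA; transitivity (nu (A `&` D)) => //.
  rewrite nuE//; last exact: measurableI.
  rewrite [RHS]integral_mkcond; apply: eq_integral => x _.
  rewrite /W !patchE in_setI indicE.
  by case: (x \in A); case: (x \in D); rewrite /= ?mul1r ?mul0r.
apply: (@le_trans _ _ (\int[lebesgue_measure]_x ((K * (normal_peak s)^-1)%:E * (normal_pdf a s x)%:E))%E).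
  apply: ge0_le_integral => //.
  - by move=> x _; rewrite lee_fin mulr_ge0// normal_fun_ge0.
  - by apply/measurable_EFinP; exact: measurable_funM.
  - by apply/measurable_EFinP; apply: measurable_funM => //; exact: measurable_normal_pdf.
  - move=> x _; rewrite -EFinM lee_fin normal_pdfE// -mulrA mulKf ?gt_eqF ?normal_peak_gt0//.
    rewrite mulrC ler_wpM2r ?normal_fun_ge0// /W patchE; case: ifPn => //.
    by rewrite inE => /rhoK /andP[].
rewrite ge0_integralZl_EFin//.
- rewrite integral_normal_pdf mule1 lee_fin ler_wpM2l// /normal_peak invrK.
  by rewrite -mulrnAr sqrtrM ?sqr_ge0// sqrtr_sqr gtr0_norm.
- by move=> x _; rewrite lee_fin normal_pdf_ge0.
- by apply/measurable_EFinP; exact: measurable_normal_pdf.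
- by rewrite mulr_ge0// invr_ge0 normal_peak_ge0.
Qed.

End SlabDensity.

(** * Laplace bounds for the likelihood ratio and solutions of the oracle equation *)

Section OracleThreshold.
Context {R : realType}.
Variables (nu : probability R R) (sigma e1 c1 K : R) (n : nat).
Hypothesis sigma_gt0 : 0 < sigma.
Hypothesis n_gt0 : (0 < n)%N.
Hypothesis e1_gt0 : 0 < e1.
Hypothesis c1_gt0 : 0 < c1.
Hypothesis K_ge0 : 0 <= K.
Hypothesis slab_lower : forall a b, - e1 <= a -> a <= b -> b <= e1 ->
  c1 * (b - a) <= prob nu `[a, b].
Hypothesis slab_gauss : forall s a, 0 < s ->
  (\int[nu]_(x in `[(- e1)%R, e1]) (normal_fun a s x)%:E <= (K * s)%:E)%E.

Let s : R := sigma / Num.sqrt n%:R.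

Let nR : @Order.lt _ R 0 n%:R. Proof. by rewrite ltr0n. Qed.
Let s_gt0 : 0 < s. Proof. by rewrite divr_gt0// sqrtr_gt0. Qed.
Let s2E : s ^+ 2 = sigma ^+ 2 / n%:R.
Proof. by rewrite expr_div_n sqr_sqrtr// ltW. Qed.

(** The ratio of the normal densities with means [x] and 0 and standard deviation [s], at the
    estimate [a]. Its slab average [likelihood] is the marginal likelihood ratio of slab to
    spike. *)
Definition llr (a x : R) : R :=
  expR (n%:R * (a * (x / sigma ^+ 2) - x ^+ 2 / (2 * sigma ^+ 2))).
Definition likelihood (a : R) : R := (\int[nu]_x llr a x)%R.

Lemma llr_normal_fun a x : llr a x = expR (a ^+ 2 / (2 * s ^+ 2)) * normal_fun a s x.
Proof.
rewrite /llr /normal_fun -expRD; congr expR; rewrite s2E.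
by field; rewrite !gt_eqF.
Qed.

Lemma llrE a x : llr a x = expR ((a * x - x ^+ 2 / 2) / s ^+ 2).
Proof.
rewrite /llr; congr expR; rewrite s2E.
by field; rewrite !gt_eqF.
Qed.

Lemma normal_fun_le1 (a r x : R) : normal_fun a r x <= 1.
Proof.
rewrite /normal_fun -[leRHS]expR0 ler_expR mulNr oppr_le0 divr_ge0 ?sqr_ge0//.
by rewrite mulrn_wge0// sqr_ge0.
Qed.

Lemma llr_le a x : llr a x <= expR (a ^+ 2 / (2 * s ^+ 2)).
Proof. by rewrite llr_normal_fun ler_piMr ?expR_ge0 ?normal_fun_le1. Qed.

Lemma measurable_llr a : measurable_fun [set: R] (llr a).
Proof.
apply: measurableT_comp => //; apply: measurable_funM => //.
by apply: measurable_funB; apply: measurable_funM => //; exact: measurable_funM.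
Qed.

Lemma integrable_llr a : nu.-integrable [set: R] (EFin \o llr a).
Proof.
apply: (@le_integrable _ _ _ _ _ _ _ (EFin \o cst (expR (a ^+ 2 / (2 * s ^+ 2))))) => //.
- by apply/measurable_EFinP; exact: measurable_llr.
- move=> x _; rewrite /= lee_fin ger0_norm ?expR_ge0// ger0_norm ?expR_ge0//.
  exact: llr_le.
- exact: finite_measure_integrable_cst.
Qed.

Lemma likelihoodE a : (\int[nu]_x (llr a x)%:E)%E = (likelihood a)%:E.
Proof.
rewrite /likelihood /Rintegral fineK//.
by apply: integrable_fin_num => //; exact: integrable_llr.
Qed.

(** Completing the square bounds the integrand uniformly in [x], so that a constant dominates it for
    parameters near [a], whatever the tails of [nu]. *)
Lemma likelihood_continuous : continuous likelihood.
Proof.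
move=> a.
have H := @continuity_under_integral R _ _ nu llr [set: R] measurableT
  (a - 1) (a + 1) _ _ (cst (expR ((`|a| + 1) ^+ 2 / (2 * s ^+ 2)))) _ _.
apply: H.
- by move=> x _; exact: integrable_llr.
- apply: aeW => y _ x _; rewrite /llr.
  apply: (continuous_comp (f := fun x : R => n%:R * (x * (y / sigma ^+ 2) - y ^+ 2 / (2 * sigma ^+ 2)))).
    apply: continuousM; first exact: cst_continuous.
    apply: continuousB; last exact: cst_continuous.
    by apply: continuousM; [exact: cvg_id|exact: cst_continuous].
  exact: continuous_expR.
- exact: finite_measure_integrable_cst.
- move=> x; rewrite /= in_itv/= => /andP[x1 x2]; apply: aeW => y _.
  rewrite ger0_norm ?expR_ge0//; apply: le_trans (llr_le x y) _.
  have i0 : 0 <= (2 * s ^+ 2)^-1 by rewrite invr_ge0 mulr_ge0// sqr_ge0.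
  rewrite ler_expR; apply: ler_wpM2r => //.
  rewrite -real_normK ?num_real// lerXn2r ?nnegrE ?addr_ge0//.
  rewrite ler_norml; have := ler_norm a; have := ler_norm (- a); rewrite normrN; lra.
- by rewrite inE/= in_itv/=; lra.
Qed.

Lemma likelihood_ge (A : set R) (a l : R) : measurable A -> 0 <= l ->
  (forall x, A x -> l <= llr a x) -> l * prob nu A <= likelihood a.
Proof.
move=> mA l0 Al; rewrite -lee_fin -likelihoodE EFinM -probE// -integral_cst//.
apply: (@le_trans _ _ (\int[nu]_(x in A) (llr a x)%:E)%E).
  apply: ge0_le_integral => //.
  by apply/measurable_EFinP; exact: measurable_funTS (measurable_llr a).
apply: ge0_subset_integral => //.
- by apply/measurable_EFinP; exact: measurable_llr.
- by move=> x _; rewrite lee_fin expR_ge0.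
Qed.

(** On [[-e1, e1]] the Gaussian bound for the slab applies. Outside it only the total mass of [nu]
    is available, but there [x] is at distance at least [e1 / 2] from [a], which gives the
    exponentially small second term. *)
Lemma likelihood_le (a : R) : `|a| <= e1 / 2 ->
  likelihood a <= expR (a ^+ 2 / (2 * s ^+ 2)) * (K * s + expR (- (e1 ^+ 2 / (8 * s ^+ 2)))).
Proof.
move=> ae; rewrite -lee_fin -likelihoodE EFinM.
under eq_integral do rewrite llr_normal_fun EFinM.
have mn : measurable_fun [set: R] (normal_fun a s) by exact: measurable_normal_fun.
rewrite ge0_integralZl_EFin//; last 2 first.
- by move=> x _; rewrite lee_fin normal_fun_ge0.
- exact/measurable_EFinP.
rewrite lee_pmul2l ?lte_fin ?expR_gt0//.
pose D : set R := `[- e1, e1]%classic.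
have mD : measurable D by exact: measurable_itv.
rewrite -(setUv D) ge0_integral_setU//; last 4 first.
- exact: measurableC.
- by rewrite setUv; exact/measurable_EFinP.
- by move=> x _; rewrite lee_fin normal_fun_ge0.
- exact/disj_setPCl.
rewrite EFinD leeD//; first exact: slab_gauss.
set l := expR _.
apply: (@le_trans _ _ (\int[nu]_(x in ~` D) l%:E)%E).
  apply: ge0_le_integral => //.
  - exact: measurableC.
  - by move=> x _; rewrite lee_fin normal_fun_ge0.
  - by apply/measurable_EFinP; exact: measurable_funTS mn.
  - move=> x xD; rewrite lee_fin /normal_fun ler_expR mulNr lerN2.
    have sN : s != 0 by rewrite gt_eqF.
    have -> : e1 ^+ 2 / (8 * s ^+ 2) = (e1 / 2) ^+ 2 / (s ^+ 2 *+ 2) by field.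
    rewrite ler_wpM2r ?invr_ge0 ?mulrn_wge0 ?sqr_ge0//.
    have e2 : 0 <= e1 / 2 by rewrite divr_ge0// ltW.
    rewrite -[leRHS]real_normK ?num_real// lerXn2r ?nnegrE//.
    have {}xD : ~ (- e1 <= x <= e1) by move=> H; apply: xD; rewrite /D/= in_itv.
    move: ae; rewrite ler_norml ler_normr => /andP[a1 a2].
    have [x1|x1] := ltP x (- e1); first by apply/orP; right; lra.
    have [x2|x2] := ltP e1 x; first by apply/orP; left; lra.
    by exfalso; apply: xD; rewrite x1.
rewrite integral_cst; last exact: measurableC.
rewrite -[leRHS]mule1 lee_pmul2l ?lte_fin ?expR_gt0//.
by apply: probability_le1; exact: measurableC.
Qed.

(** One standard deviation to the right of [a] suffices: there the Gaussian factor is at least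
    [expR (- 2^-1)] and the slab has mass at least [c1 * s]. *)
Lemma likelihood_ge_near (a : R) : `|a| <= e1 / 2 -> s <= e1 / 2 ->
  expR (a ^+ 2 / (2 * s ^+ 2)) * (expR (- 2^-1) * (c1 * s)) <= likelihood a.
Proof.
move=> ae se; have := e1_gt0; have := s_gt0 => s0' e0'; move: ae; rewrite ler_norml => /andP[a1 a2].
apply: le_trans (likelihood_ge (measurable_itv `[a, a + s])
  (l := expR (a ^+ 2 / (2 * s ^+ 2)) * expR (- 2^-1)) _ _).
- rewrite -mulrA ler_wpM2l ?expR_ge0// ler_wpM2l ?expR_ge0//.
  by apply: le_trans (slab_lower _ _ _); [rewrite addrC addKr|lra|lra|lra].
- by rewrite mulr_ge0 ?expR_ge0.
- move=> x; rewrite /= in_itv/= => /andP[x1 x2].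
  rewrite llr_normal_fun ler_wpM2l ?expR_ge0// /normal_fun ler_expR mulNr lerN2.
  rewrite ler_pdivrMr ?mulrn_wgt0 ?exprn_gt0//.
  have -> : 2^-1 * (s ^+ 2 *+ 2) = s ^+ 2 by field.
  by rewrite lerXn2r ?nnegrE; lra.
Qed.

(** A crude bound from slab points between [e1 / 8] and [e1 / 4] on the side of [a]. It serves
    twice: it drives the likelihood ratio beyond any level, for existence of thresholds, and it
    excludes solutions of the oracle equation far from zero. *)
Lemma likelihood_ge_far (a : R) : e1 / 2 <= `|a| ->
  expR ((`|a| * (e1 / 8) - e1 ^+ 2 / 32) / s ^+ 2) * (c1 * (e1 / 8)) <= likelihood a.
Proof.
have e0' := e1_gt0; move=> ae; have s2 : 0 <= (s ^+ 2)^-1 by rewrite invr_ge0 sqr_ge0.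
have key x : e1 / 8 <= x -> x <= e1 / 4 ->
    `|a| * (e1 / 8) - e1 ^+ 2 / 32 <= `|a| * x - x ^+ 2 / 2.
  move=> x1 x2; have : 0 <= `|a| * (x - e1 / 8) by rewrite mulr_ge0// subr_ge0.
  have : 0 <= (e1 / 4 - x) * (e1 / 4 + x).
    by rewrite mulr_ge0 ?subr_ge0// addr_ge0//; lra.
  nra.
have [a0|a0] := lerP 0 a.
  apply: le_trans (likelihood_ge (measurable_itv `[e1 / 8, e1 / 4])
    (l := expR ((`|a| * (e1 / 8) - e1 ^+ 2 / 32) / s ^+ 2)) _ _).
  - rewrite ler_wpM2l ?expR_ge0//.
    apply: le_trans (slab_lower _ _ _); [|lra|lra|lra].
    by apply: ler_wpM2l; [exact: ltW|lra].
  - exact: expR_ge0.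
  - move=> x; rewrite /= in_itv/= => /andP[x1 x2].
    rewrite llrE ler_expR; apply: ler_wpM2r => //.
    by have := key x x1 x2; rewrite ger0_norm.
apply: le_trans (likelihood_ge (measurable_itv `[- (e1 / 4), - (e1 / 8)])
  (l := expR ((`|a| * (e1 / 8) - e1 ^+ 2 / 32) / s ^+ 2)) _ _).
- rewrite ler_wpM2l ?expR_ge0//.
  apply: le_trans (slab_lower _ _ _); [|lra|lra|lra].
  by apply: ler_wpM2l; [exact: ltW|lra].
- exact: expR_ge0.
- move=> x; rewrite /= in_itv/= => /andP[x1 x2].
  rewrite llrE ler_expR; apply: ler_wpM2r => //.
  have := key (- x); rewrite ltr0_norm// mulrNN sqrrN; apply; lra.
Qed.

Lemma likelihood0 : likelihood 0 <= 1.
Proof.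
rewrite -lee_fin -likelihoodE -[leRHS](integral_cst1 nu).
apply: ge0_le_integral => //.
- by move=> x _; rewrite lee_fin expR_ge0.
- by apply/measurable_EFinP; exact: measurable_llr.
- move=> x _; rewrite lee_fin; apply: le_trans (llr_le _ _) _.
  by rewrite expr0n mul0r expR0.
Qed.

Variables (p delta0 deltaA t : R).
Hypothesis pA_gt0 : 0 < p * deltaA.
Hypothesis tE : (1 - p) * delta0 = p * deltaA * t.
Hypothesis t_gt1 : 1 < t.

Lemma oracle_equationE a :
  oracle_equation n p delta0 deltaA sigma nu a <-> likelihood a = t.
Proof.
rewrite /oracle_equation tE likelihoodE -EFinM; split=> [[]/mulfI H|->//].
by rewrite -H// gt_eqF.
Qed.

(** Intermediate value theorem in the direction of the sign [e]: the likelihood ratio is at most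
    [1 < t] at zero and at least [t] far out. *)
Lemma exists_oracle_threshold (e : R) : e ^+ 2 = 1 ->
  exists2 c, 0 < c & oracle_equation n p delta0 deltaA sigma nu (e * c).
Proof.
have e0' := e1_gt0; have t1' := t_gt1; move=> e2; have e_norm : `|e| = 1.
  by apply/eqP; rewrite -sqrp_eq1// real_normK ?num_real// e2.
have s2 : 0 < s ^+ 2 by rewrite exprn_gt0.
have k0 : 0 < c1 * (e1 / 8) by rewrite mulr_gt0// divr_gt0.
(* [M] makes the exponent in [likelihood_ge_far] exceed [t / (c1 * (e1 / 8))], so that
   [1 + y <= expR y] finishes. *)
pose M := e1 / 2 + (t / (c1 * (e1 / 8))) * s ^+ 2 * (8 / e1).
have te : 0 <= t / (c1 * (e1 / 8)) by rewrite divr_ge0// ltW//; lra.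
have M1 : e1 / 2 <= M.
  by rewrite /M lerDl; apply: mulr_ge0; [apply: mulr_ge0 => //; exact: ltW|exact/ltW/divr_gt0].
have M0 : 0 < M by lra.
have tM : t <= likelihood (e * M).
  have := @likelihood_ge_far (e * M); rewrite normrM e_norm mul1r gtr0_norm//.
  move=> /(_ M1); apply: le_trans; rewrite -ler_pdivrMr//.
  apply: le_trans (expR_ge1Dx _).
  have -> : (M * (e1 / 8) - e1 ^+ 2 / 32) / s ^+ 2 =
      t / (c1 * (e1 / 8)) + (e1 ^+ 2 / 32) / s ^+ 2.
    by rewrite /M; field; rewrite !gt_eqF.
  have : 0 <= (e1 ^+ 2 / 32) / s ^+ 2 by rewrite !divr_ge0 ?sqr_ge0.
  lra.
have cont : continuous (fun x => likelihood (e * x)).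
  move=> x; apply: (continuous_comp (f := fun x : R => e * x) (g := likelihood)).
    by apply: continuousM; [exact: cst_continuous|exact: cvg_id].
  exact: likelihood_continuous.
have [c] : exists2 c, c \in `[0, M] & likelihood (e * c) = t.
  apply: IVT; first exact: ltW.
    exact: continuous_subspaceT.
  by rewrite mulr0 ge_min le_max tM (le_trans likelihood0 (ltW t_gt1)) orbT.
rewrite in_itv/= => /andP[c_ge0 _] ct; exists c; last exact/oracle_equationE.
rewrite lt_neqAle c_ge0 andbT; apply/eqP => c0.
have := likelihood0; move: ct; rewrite -c0 mulr0 => ->.
by rewrite leNgt t_gt1.
Qed.

Hypothesis s_small : s <= e1 / 2.
Hypothesis s_tail : expR (- (e1 ^+ 2 / (8 * s ^+ 2))) <= s.
Hypothesis t_small : t < expR (e1 ^+ 2 / 32 / s ^+ 2) * (c1 * (e1 / 8)).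

(** Solutions with modulus beyond [e1 / 2] are excluded by size. For the others the two Laplace
    bounds apply, and [s_tail] absorbs the mass far from zero into the [1] of [K + 1]. Thus
    [(a / s) ^+ 2] is [2 * ln (t / s)] up to an additive constant. *)
Lemma oracle_solution_bounds a : oracle_equation n p delta0 deltaA sigma nu a ->
  t / ((K + 1) * s) <= expR ((a / s) ^+ 2 / 2) <= expR 2^-1 * t / (c1 * s).
Proof.
have e0' := e1_gt0; have K0' := K_ge0; move=> /oracle_equationE at_.
have s2 : 0 < s ^+ 2 by rewrite exprn_gt0.
have ae : `|a| <= e1 / 2.
  (* For [|a|] at least [e1 / 2] the exponent of the far bound is at least [e1 ^+ 2 / 32] over
     [s ^+ 2], the one in [t_small]. *)
  rewrite leNgt; apply/negP => /ltW ae.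
  have := likelihood_ge_far ae; rewrite at_ leNgt => /negP; apply.
  apply: (lt_le_trans t_small); apply: ler_wpM2r.
    by rewrite mulr_ge0// ltW// divr_gt0.
  rewrite ler_expR; apply: ler_wpM2r; first by rewrite invr_ge0 ltW.
  nra.
have -> : (a / s) ^+ 2 / 2 = a ^+ 2 / (2 * s ^+ 2) by field; rewrite gt_eqF.
have H1 := likelihood_le ae; have H2 := likelihood_ge_near ae s_small.
rewrite at_ in H1 H2; set A := expR _ in H1 H2 *.
have A0 : 0 < A by exact: expR_gt0.
apply/andP; split.
- have K1 : 0 < K + 1 by lra.
  rewrite ler_pdivrMr; last exact: mulr_gt0 K1 s_gt0.
  apply: le_trans H1 _; have -> : (K + 1) * s = K * s + s by ring.
  by apply: ler_wpM2l; [exact: ltW|exact: lerD].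
- rewrite ler_pdivlMr; last exact: mulr_gt0 c1_gt0 s_gt0.
  have -> : A * (c1 * s) = expR (2^-1) * (A * (expR (- 2^-1) * (c1 * s))).
    have ee : expR 2^-1 * expR (- 2^-1) = 1 :> R by rewrite -expRD subrr expR0.
    transitivity (expR 2^-1 * expR (- 2^-1) * (A * (c1 * s))); last by ring.
    by rewrite ee mul1r.
  by rewrite ler_pM2l ?expR_gt0.
Qed.

End OracleThreshold.

(** * Asymptotics *)

Section ExponentialRates.
Context {R : realType}.
Implicit Types (x a K e : R).

Lemma expR_ge_cube x : 0 <= x -> (x / 3) ^+ 3 <= expR x.
Proof.
move=> x0; have -> : expR x = expR (x / 3) ^+ 3.
  by rewrite -expRM_natl; congr expR; field.
rewrite lerXn2r ?nnegrE ?divr_ge0 ?expR_ge0//.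
by apply: le_trans (expR_ge1Dx _); rewrite lerDr.
Qed.

Lemma near_sqr_expR a K e : 0 < a -> 0 < e ->
  \forall x \near +oo, K * (x ^+ 2 * expR (- (a * x))) <= e.
Proof.
move=> a0 e0; near=> x.
have x0 : 0 < x by near: x; apply: nbhs_pinfty_gt; exact: num_real.
have xK : 27 * `|K| / (a ^+ 3 * e) <= x by near: x; apply: nbhs_pinfty_ge; exact: num_real.
apply: (@le_trans _ _ (`|K| * (x ^+ 2 * expR (- (a * x))))).
  by rewrite ler_wpM2r ?ler_norm// mulr_ge0 ?sqr_ge0 ?expR_ge0.
rewrite expRN mulrA ler_pdivrMr ?expR_gt0//.
apply: (@le_trans _ _ (e * (a * x / 3) ^+ 3)); last first.
  by rewrite ler_wpM2l ?(ltW e0)// expR_ge_cube// mulr_ge0// ltW.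
move: xK; rewrite ler_pdivrMr ?mulr_gt0 ?exprn_gt0// => xK.
have : 27 * `|K| * x ^+ 2 <= x * (a ^+ 3 * e) * x ^+ 2 by rewrite ler_wpM2r ?sqr_ge0.
have -> : e * (a * x / 3) ^+ 3 = x * (a ^+ 3 * e) * x ^+ 2 / 27 by field.
lra.
Unshelve. all: by end_near. Qed.

Lemma near_expR a K e : 0 < a -> 0 < e ->
  \forall x \near +oo, K * expR (- (a * x)) <= e.
Proof.
move=> a0 e0; near=> x.
have x1 : 1 <= x by near: x; apply: nbhs_pinfty_ge; exact: num_real.
apply: (@le_trans _ _ (`|K| * (x ^+ 2 * expR (- (a * x))))); last first.
  by near: x; exact: near_sqr_expR.
rewrite mulrA ler_wpM2r ?expR_ge0//.
apply: le_trans (ler_norm _) _; by rewrite ler_peMr// expr_ge1.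
Unshelve. all: by end_near. Qed.

Lemma near_lin_expR a K e : 0 < a -> 0 < e ->
  \forall x \near +oo, K * (x * expR (- (a * x))) <= e.
Proof.
move=> a0 e0; near=> x.
have x1 : 1 <= x by near: x; apply: nbhs_pinfty_ge; exact: num_real.
apply: (@le_trans _ _ (`|K| * (x ^+ 2 * expR (- (a * x))))); last first.
  by near: x; exact: near_sqr_expR.
have xe : 0 <= x * expR (- (a * x)) by rewrite mulr_ge0 ?expR_ge0// (le_trans _ x1).
apply: (@le_trans _ _ (`|K| * (x * expR (- (a * x))))).
  by rewrite ler_wpM2r// ler_norm.
rewrite ler_wpM2l// ler_wpM2r ?expR_ge0//.
by rewrite expr2 ler_peMl// (le_trans _ x1).
Unshelve. all: by end_near. Qed.

(** Applied at [log n], this makes [L] exceed any fixed multiple of [m p log n]; the exponent [eta]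
    absorbs the constant. *)
Lemma near_powR eta K : 0 < eta -> \forall x \near +oo, K * x <= x `^ (1 + eta) :> R.
Proof.
move=> eta0; near=> x.
have x0 : 0 < x by near: x; apply: nbhs_pinfty_gt; exact: num_real.
have xK : expR (`|K| / eta) <= x by near: x; apply: nbhs_pinfty_ge; exact: num_real.
rewrite powRD; last by rewrite (gt_eqF x0) implybT.
rewrite powRr1 ?(ltW x0)// [leRHS]mulrC ler_wpM2r ?(ltW x0)//.
apply: le_trans (ler_norm _) _; rewrite /powR gt_eqF//.
have lnx : `|K| / eta <= ln x.
  by rewrite -[leLHS]expRK ler_ln ?posrE ?expR_gt0.
move: lnx; rewrite ler_pdivrMr// => lnx.
apply: le_trans lnx _; rewrite mulrC.
by apply: le_trans (expR_ge1Dx _); rewrite lerDr.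
Unshelve. all: by end_near. Qed.

End ExponentialRates.

(** * Rates of the penalty, of the size bound [L] and of the two levels *)

Section SampleSize.
Context {R : realType}.
Variables (n : nat -> nat) (d : R).
Hypothesis n_cvg : n @ \oo --> \oo.
Hypothesis m_lt_n : forall m, (m < n m)%N.

(** All rates are expressed in this variable, powers of [n] being exponentials of it, so that limits
    in a real variable at infinity transfer to sequences. *)
Definition log_size m : R := ln (n m)%:R.
Local Notation x := log_size.
Local Notation pen m := (penalty m (n m) d).

Lemma size_gt0 m : (0 < n m)%N.
Proof. exact: leq_ltn_trans (m_lt_n m). Qed.

Lemma sizeE m : (n m)%:R = expR (x m) :> R.
Proof. by rewrite /x lnK// posrE ltr0n size_gt0. Qed.

Lemma sqrt_sizeE m : Num.sqrt (n m)%:R = expR (x m / 2) :> R.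
Proof.
rewrite sizeE (_ : x m = x m / 2 + x m / 2); last by field.
rewrite expRD -expr2 sqrtr_sqr ger0_norm ?expR_ge0//.
by congr expR; field.
Qed.

Lemma cvg_ln_nat : (fun m => ln m%:R : R) @ \oo --> +oo.
Proof.
apply/cvgryPge => A; near=> m.
have m0 : 0 < m%:R :> R by rewrite ltr0n; near: m; exact: nbhs_infty_gt.
rewrite -[leLHS]expRK ler_ln ?posrE ?expR_gt0//.
by near: m; exact: nbhs_infty_ger.
Unshelve. all: by end_near. Qed.

Lemma log_size_cvg : x @ \oo --> +oo.
Proof. exact: (cvg_comp n (fun k => ln k%:R : R) n_cvg cvg_ln_nat). Qed.

Lemma near_log_size (A : R -> Prop) :
  (\forall y \near +oo, A y) -> \forall m \near \oo, A (x m).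
Proof. by move=> H; exact: log_size_cvg H. Qed.

Lemma log_size_ge (k : R) : \forall m \near \oo, k <= x m.
Proof. by apply: (near_log_size (nbhs_pinfty_ge _)); exact: num_real. Qed.

Lemma ln_index_ge (k : R) : \forall m \near \oo, k <= ln m%:R.
Proof. by apply: (cvg_ln_nat (nbhs_pinfty_ge _)); exact: num_real. Qed.

Lemma ln_index_le m : ln m%:R <= x m.
Proof.
case: m => [|m]; first by rewrite ln0// ln_ge0// ler1n size_gt0.
by rewrite ler_ln ?posrE ?ltr0n ?size_gt0// ler_nat ltnW.
Qed.

Lemma penalty_ge : \forall m \near \oo, x m / 2 <= pen m.
Proof.
near=> m.
have h1 : 0 <= ln m%:R :> R by near: m; exact: ln_index_ge.
have h2 : 2 * `|d| <= x m by near: m; exact: log_size_ge.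
have := ler_norm (- d); rewrite normrN /penalty -/(x m); lra.
Unshelve. all: by end_near. Qed.

Lemma penalty_le : \forall m \near \oo, pen m <= 4 * x m.
Proof.
near=> m.
have h2 : `|d| <= x m by near: m; exact: log_size_ge.
have := ln_index_le m; have := ler_norm d; rewrite /penalty -/(x m); lra.
Unshelve. all: by end_near. Qed.

Lemma penalty_cvg (k : R) : \forall m \near \oo, k <= pen m.
Proof.
near=> m; apply: (@le_trans _ _ (x m / 2)); last by near: m; exact: penalty_ge.
have : 2 * k <= x m by near: m; exact: log_size_ge.
lra.
Unshelve. all: by end_near. Qed.

(** The summand [2 * ln m] of the penalty compensates for the number of candidates, and the summand
    [ln n] leaves a factor [n^(-1/2)]. *)
Lemma expR_penalty m : (0 < m)%N ->
  m%:R * expR (- pen m / 2) = expR (- (x m / 2)) * expR (- d / 2).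
Proof.
move=> m0; have m0' : 0 < m%:R :> R by rewrite ltr0n.
rewrite -{1}(lnK (_ : m%:R \is Num.pos))// -!expRD; congr expR.
by rewrite /penalty -/(x m); field.
Qed.

Variable L : nat -> nat.
Hypothesis L_small : (fun m => (L m)%:R : R) =o_\oo
  (fun m => (n m)%:R / ((ln (n m)%:R + 2 * ln m%:R) ^+ 2 * ln m%:R)).

Lemma L_negligible (e : R) : 0 < e -> \forall m \near \oo,
  (L m)%:R * (x m + 2 * ln m%:R) ^+ 2 <= e * (n m)%:R.
Proof.
move=> e0; move/eqoP : L_small => /(_ _ e0) H; near=> m.
have lm : 1 <= ln m%:R :> R by near: m; exact: ln_index_ge.
have x1 : 1 <= x m by near: m; exact: log_size_ge.
have n0 : 0 < (n m)%:R :> R by rewrite ltr0n size_gt0.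
have y0 : 0 < x m + 2 * ln m%:R by lra.
have y2 : 0 < (x m + 2 * ln m%:R) ^+ 2 by rewrite exprn_gt0.
have : `|(L m)%:R| <= e * `|(n m)%:R / ((x m + 2 * ln m%:R) ^+ 2 * ln m%:R)|.
  by near: m.
have -> : `|(L m)%:R : R| = (L m)%:R by rewrite ger0_norm.
rewrite ger0_norm; last by rewrite divr_ge0// mulr_ge0; lra.
rewrite mulrA ler_pdivlMr ?mulr_gt0//; last by lra.
move=> H1; apply: le_trans H1; rewrite [leRHS]mulrA.
by apply: ler_peMr => //; apply: mulr_ge0 => //; exact: ltW.
Unshelve. all: by end_near. Qed.

Lemma L_penalty_negligible (e : R) : 0 < e ->
  \forall m \near \oo, (L m)%:R * x m * pen m <= e * (n m)%:R.
Proof.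
move=> e0; near=> m.
have lm : `|d| + 1 <= ln m%:R by near: m; exact: ln_index_ge.
have x1 : 1 <= x m by near: m; exact: log_size_ge.
have H : (L m)%:R * (x m + 2 * ln m%:R) ^+ 2 <= e * (n m)%:R.
  by near: m; exact: L_negligible.
apply: le_trans H; rewrite -mulrA ler_wpM2l// expr2.
have dd := ler_norm d; have d0 := normr_ge0 d.
rewrite /penalty -/(x m); move: lm x1 dd d0; move: (ln _) (x m) `|d| => l y D lm x1 dd d0.
have : 0 <= (l - d) * y by apply: mulr_ge0; lra.
have : 0 <= l * y by apply: mulr_ge0; lra.
have := sqr_ge0 l; nra.
Unshelve. all: by end_near. Qed.

Local Notation tau m := (expR (- (4^-1 * x m))).
Local Notation b m := (Num.sqrt (8 * x m)).

Lemma b_sqr : \forall m \near \oo, b m ^+ 2 = 8 * x m.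
Proof.
near=> m; rewrite sqr_sqrtr// mulr_ge0//.
by near: m; exact: log_size_ge.
Unshelve. all: by end_near. Qed.

Lemma tau_le1 : \forall m \near \oo, 0 <= tau m <= 1.
Proof.
near=> m; rewrite expR_ge0/= -[leRHS]expR0 ler_expR oppr_le0 mulr_ge0//.
by near: m; exact: log_size_ge.
Unshelve. all: by end_near. Qed.

(** Measures the effect on the selection level of the noise energy that [2 * L + 1] scores can
    absorb: relative to [n] it must be small even after multiplication by the penalty. *)
Lemma overfit_negligible (e : R) : 0 < e -> \forall m \near \oo,
  (2 * (L m)%:R + 1) * b m ^+ 2 / (n m)%:R * pen m <= e.
Proof.
move=> e0; near=> m.
have n0 : 0 < (n m)%:R :> R by rewrite ltr0n size_gt0.
have -> : b m ^+ 2 = 8 * x m by near: m; exact: b_sqr.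
have h1 : (L m)%:R * x m * pen m <= e / 32 * (n m)%:R.
  by near: m; apply: L_penalty_negligible; rewrite divr_gt0.
have x1 : 1 <= x m by near: m; exact: log_size_ge.
have h2 : pen m <= 4 * x m by near: m; exact: penalty_le.
have h3 : 32 * (x m ^+ 2 * expR (- (1 * x m))) <= e / 2.
  by near: m; apply: (near_log_size (near_sqr_expR _ _ _)) => //; rewrite divr_gt0.
rewrite mul1r expRN -sizeE mulrA ler_pdivrMr// in h3.
have -> : (2 * (L m)%:R + 1) * (8 * x m) / (n m)%:R * pen m =
   (16 * ((L m)%:R * x m * pen m) + 8 * (x m * pen m)) / (n m)%:R.
  by field; rewrite gt_eqF.
rewrite ler_pdivrMr//.
have : x m * pen m <= x m * (4 * x m) by rewrite ler_wpM2l//; lra.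
lra.
Unshelve. all: by end_near. Qed.

Lemma rss_lower_near : \forall m \near \oo,
  0 < rss_lower (n m) (L m) (b m ^+ 2) (tau m).
Proof.
near=> m.
have h1 : (2 * (L m)%:R + 1) * b m ^+ 2 / (n m)%:R * pen m <= 4^-1.
  by near: m; apply: overfit_negligible.
have p1 : 1 <= pen m by near: m; exact: penalty_cvg.
have h2 : 1 * tau m <= 4^-1.
  by near: m; apply: (near_log_size (near_expR _ _ _)).
rewrite /rss_lower; set A := (2 * _ + 1) * _ / _ in h1 *.
have A0 : 0 <= A by rewrite /A divr_ge0// mulr_ge0 ?sqr_ge0// addr_ge0.
have : A * 1 <= A * pen m by rewrite ler_wpM2l.
lra.
Unshelve. all: by end_near. Qed.

(** From [expR (- y) <= 1 / (1 + y) <= 1 - y + y^2] with [y = v / N]. *)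
Lemma gain_lower N (v : R) : (0 < N)%N -> 0 <= v ->
  v - v ^+ 2 / N%:R <= N%:R * gain N v.
Proof.
move=> N0 v0; have n0 : 0 < N%:R :> R by rewrite ltr0n.
rewrite /gain; set y := v / N%:R.
have y0 : 0 <= y by rewrite divr_ge0// ltW.
have E : expR (- y) <= (1 + y)^-1.
  by rewrite expRN lef_pV2 ?posrE ?expR_gt0 ?expR_ge1Dx// ltr_pwDl.
have -> : v - v ^+ 2 / N%:R = N%:R * (y - y ^+ 2).
  by rewrite /y; field; rewrite gt_eqF.
apply: ler_wpM2l; first exact: ltW.
have : (1 + y)^-1 <= 1 - y + y ^+ 2.
  rewrite -[leLHS]mul1r ler_pdivrMr ?ltr_pwDl//.
  have : 0 <= y ^+ 3 by rewrite exprn_ge0.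
  by rewrite !exprS expr0 mulr1; nra.
lra.
Qed.

(** Three losses of at most a quarter each: noise energy deviation [tau * pen], overfitting, and the
    second order term [pen ^+ 2 / n] of the gain. The first is small because [tau] is a negative
    power of [n]. An additive bound is required, as a relative one would cost a power of [n] in
    [expR (- lower_level / 2)]. *)
Lemma lower_level_near : \forall m \near \oo,
  pen m - 1 <= lower_level m (n m) d (L m) (tau m) (b m).
Proof.
near=> m.
have n0 : 0 < (n m)%:R :> R by rewrite ltr0n size_gt0.
have h1 : (2 * (L m)%:R + 1) * b m ^+ 2 / (n m)%:R * pen m <= 4^-1.
  by near: m; apply: overfit_negligible.
have p1 : 1 <= pen m by near: m; exact: penalty_cvg.
have p4 : pen m <= 4 * x m by near: m; exact: penalty_le.
have h2 : 4 * (x m * tau m) <= 4^-1.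
  by near: m; apply: (near_log_size (near_lin_expR _ _ _)).
have h3 : 16 * (x m ^+ 2 * expR (- (1 * x m))) <= 4^-1.
  by near: m; apply: (near_log_size (near_sqr_expR _ _ _)).
rewrite mul1r expRN -sizeE in h3.
have rl : 0 < rss_lower (n m) (L m) (b m ^+ 2) (tau m).
  by near: m; exact: rss_lower_near.
have g1 : pen m - pen m ^+ 2 / (n m)%:R <= (n m)%:R * gain (n m) (pen m).
  by apply: gain_lower; [exact: size_gt0|lra].
have h4 : pen m ^+ 2 / (n m)%:R <= 4^-1.
  apply: le_trans h3; rewrite mulrA; apply: ler_wpM2r; first by rewrite invr_ge0 ltW.
  have -> : 16 * x m ^+ 2 = (4 * x m) ^+ 2 by ring.
  by rewrite lerXn2r ?nnegrE; lra.
have t0 : tau m * pen m <= 4^-1.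
  apply: le_trans h2; rewrite [leRHS]mulrA [leLHS]mulrC.
  by apply: ler_wpM2r; first exact: expR_ge0.
rewrite /lower_level mulrAC.
apply: le_trans (_ : (pen m - pen m ^+ 2 / (n m)%:R) * rss_lower (n m) (L m) (b m ^+ 2) (tau m) <= _); last first.
  by rewrite ler_wpM2r// ltW.
move: h1 h4; rewrite /rss_lower; set A := (2 * _ + 1) * _ / _; set B := pen m ^+ 2 / _ => h1 h4.
have A0 : 0 <= A by rewrite /A divr_ge0// mulr_ge0 ?sqr_ge0// addr_ge0.
have B0 : 0 <= B by rewrite /B divr_ge0 ?sqr_ge0.
have := expR_ge0 (- (4^-1 * x m)).
move: t0 h1; set t := expR _ => t0 h1 tt0.
have : 0 <= B * (t + A) by rewrite mulr_ge0// addr_ge0.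
have -> : (pen m - B) * (1 - t - A) = pen m - B - t * pen m - A * pen m + B * (t + A) by ring.
lra.
Unshelve. all: by end_near. Qed.

Lemma L_pen_near : \forall m \near \oo, (L m)%:R * pen m / (n m)%:R < 1.
Proof.
near=> m.
have n0 : 0 < (n m)%:R :> R by rewrite ltr0n size_gt0.
have x1 : 1 <= x m by near: m; exact: log_size_ge.
have p1 : 1 <= pen m by near: m; exact: penalty_cvg.
have h1 : (L m)%:R * x m * pen m <= 2^-1 * (n m)%:R.
  by near: m; apply: L_penalty_negligible.
rewrite ltr_pdivrMr//.
have : (L m)%:R * pen m * 1 <= (L m)%:R * pen m * x m.
  by rewrite ler_wpM2l// mulr_ge0//; lra.
lra.
Unshelve. all: by end_near. Qed.

(** A relative error is enough, since this level only enters through the radius of a slab interval.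
    One factor [1 + e] comes from [tau], the other from the denominator. *)
Lemma upper_level_near (e : R) : 0 < e -> \forall m \near \oo,
  upper_level m (n m) d (L m) (tau m) <= (1 + e) ^+ 2 * pen m.
Proof.
move=> e0; have e1 : 0 < 1 + e by lra.
have em : 0 < e / (1 + e) by rewrite divr_gt0.
near=> m.
have n0 : 0 < (n m)%:R :> R by rewrite ltr0n size_gt0.
have x1 : 1 <= x m by near: m; exact: log_size_ge.
have p1 : 1 <= pen m by near: m; exact: penalty_cvg.
have h1 : (L m)%:R * x m * pen m <= e / (1 + e) * (n m)%:R.
  by near: m; exact: L_penalty_negligible.
have h2 : 1 * tau m <= e.
  by near: m; apply: (near_log_size (near_expR _ _ _)).
have h3 : (L m)%:R * pen m / (n m)%:R <= e / (1 + e).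
  rewrite ler_pdivrMr//.
  have : (L m)%:R * pen m * 1 <= (L m)%:R * pen m * x m.
    by rewrite ler_wpM2l// mulr_ge0//; lra.
  lra.
have h4 : (1 + e)^-1 <= 1 - (L m)%:R * pen m / (n m)%:R.
  have : (1 + e)^-1 = 1 - e / (1 + e) by field; rewrite gt_eqF.
  lra.
have i0 : 0 < (1 + e)^-1 by rewrite invr_gt0.
rewrite /upper_level ler_pdivrMr; last by lra.
apply: (@le_trans _ _ (pen m * (1 + e))).
  by rewrite ler_wpM2l//; lra.
apply: (@le_trans _ _ ((1 + e) ^+ 2 * pen m * (1 + e)^-1)).
  by rewrite le_eqVlt; apply/orP; left; apply/eqP; field; rewrite gt_eqF.
by rewrite ler_wpM2l// mulr_ge0 ?sqr_ge0//; lra.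
Unshelve. all: by end_near. Qed.

Variables (p : nat -> R) (eta c0 : R).
Hypothesis eta_gt0 : 0 < eta.
Hypothesis c0_gt0 : 0 < c0.
Hypothesis mp_ge : \forall m \near \oo, c0 <= m%:R * p m.
Hypothesis L_large : \forall m \near \oo,
  m%:R * p m * (ln (n m)%:R) `^ (1 + eta) <= (L m)%:R.

(** The cut [8 * x] turns each Gaussian tail into [n^(-4)], and there are at most [n] scores,
    intercept included. The width [tau = n^(-1/4)] leaves the exponent [n^(1/2) / 16] for the noise
    energy. *)
Lemma bad_bound_near : \forall m \near \oo,
  bad_bound m (n m) (p m) (L m) (tau m) (b m) <= 5 * expR (- (3 * x m)).
Proof.
near=> m.
have x1 : 1 <= x m by near: m; exact: log_size_ge.
(* That is, [48 x <= n^(1/2)], which makes the noise energy exponent at least [3 x]. *)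
have h1 : 48 * (x m * expR (- (2^-1 * x m))) <= 1.
  by near: m; apply: (near_log_size (near_lin_expR _ _ _)).
(* With [m p] at least [c0] and [x] at least 1, this constant yields [L >= 3 x + 3 m p], so that the
   signal count exponent is at most [- 3 x]. *)
have h2 : (3 / c0 + 3) * x m <= (ln (n m)%:R) `^ (1 + eta).
  by near: m; apply: (near_log_size (near_powR _ eta_gt0)).
have h3 : c0 <= m%:R * p m by near: m.
have h4 : m%:R * p m * (ln (n m)%:R) `^ (1 + eta) <= (L m)%:R by near: m.
have bb : b m ^+ 2 = 8 * x m by near: m; exact: b_sqr.
rewrite /bad_bound.
have -> : 5 * expR (- (3 * x m)) = 2 * expR (- (3 * x m)) + 2 * expR (- (3 * x m)) + expR (- (3 * x m)) by ring.
apply: lerD; first apply: lerD.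
- rewrite ler_wpM2l// ler_expR lerN2 sizeE -expRM_natl -expRD.
  rewrite expRN mulrA ler_pdivrMr ?expR_gt0// mul1r in h1.
  have -> : x m + 2%:R * - (4^-1 * x m) = 2^-1 * x m by field.
  rewrite ler_pdivlMr//; lra.
- rewrite bb mulrCA ler_wpM2l//.
  have -> : expR (- (3 * x m)) = (n m)%:R * expR (- (8 * x m) / 2).
    by rewrite sizeE -expRD; congr expR; field.
  by rewrite ler_wpM2r ?expR_ge0// ler_nat.
- rewrite ler_expR; have c0' := c0_gt0.
  have mp0 : 0 <= m%:R * p m by lra.
  have : m%:R * p m * ((3 / c0 + 3) * x m) <= m%:R * p m * (ln (n m)%:R) `^ (1 + eta).
    by rewrite ler_wpM2l.
  have : c0 * (3 / c0 * x m) <= m%:R * p m * (3 / c0 * x m).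
    by rewrite ler_wpM2r// mulr_ge0 ?divr_ge0//; lra.
  have -> : c0 * (3 / c0 * x m) = 3 * x m by field; rewrite gt_eqF.
  have : m%:R * p m * 1 <= m%:R * p m * x m by rewrite ler_wpM2l.
  rewrite [(3 / c0 + 3) * _]mulrDl [_ * (3 / c0 * x m + _)]mulrDr.
  lra.
Unshelve. all: by end_near. Qed.

End SampleSize.

Section RateAlgebra.
Context {R : realType}.
Variables (n : nat) (sigma kappa e t0 c : R) (nu : probability R R).
Hypothesis n_gt0 : (0 < n)%N.
Hypothesis sigma_gt0 : 0 < sigma.
Hypothesis c_gt0 : 0 < c.
Hypothesis ball : forall t, 0 < t < t0 ->
  (kappa - e) * t <= prob nu `[- t, t] <= (kappa + e) * t.

Let q : R := sigma * c / Num.sqrt n%:R.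
Hypothesis q_lt : 8 * q < t0.

Let rn_gt0 : @Order.lt _ R 0 (Num.sqrt n%:R).
Proof. by rewrite sqrtr_gt0 ltr0n. Qed.

Lemma le_slab_ball (r1 r2 : R) : r1 <= r2 ->
  slab_ball n sigma nu r1 <= slab_ball n sigma nu r2.
Proof.
move=> r12; apply: le_prob => // x /=; rewrite !in_itv/= => /andP[x1 x2].
have H : sigma * r1 / Num.sqrt n%:R <= sigma * r2 / Num.sqrt n%:R.
  by rewrite ler_wpM2r ?invr_ge0 ?sqrtr_ge0// ler_wpM2l// ltW.
by rewrite (le_trans _ x1) ?lerN2// (le_trans x2).
Qed.

Let q_gt0 : 0 < q. Proof. by rewrite divr_gt0// mulr_gt0. Qed.

(** The factor 8 covers all radii that occur: with [b <= 4 c] they are at most [2 b] or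
    [(1 + e) c + b]. *)
Let ball_k (k : R) : 0 < k -> k <= 8 ->
  (kappa - e) * (k * q) <= slab_ball n sigma nu (k * c) <= (kappa + e) * (k * q).
Proof.
move=> k0 k8; have := @ball (k * q).
have -> : slab_ball n sigma nu (k * c) = prob nu `[- (k * q), (k * q)].
  rewrite /slab_ball; congr (prob nu _).
  by rewrite [sigma * _]mulrCA -mulrA.
apply; rewrite mulr_gt0//=; apply: le_lt_trans q_lt.
by apply: ler_wpM2r => //; exact: ltW.
Qed.

Lemma slab_ball_le (k r : R) : 0 < k -> k <= 8 -> r <= k * c ->
  slab_ball n sigma nu r <= (kappa + e) * (k * q).
Proof.
by move=> k0 k8 rk; apply: le_trans (le_slab_ball rk) _; case/andP: (ball_k k0 k8).
Qed.

Lemma slab_ball_ge (k r : R) : 0 < k -> k <= 8 -> k * c <= r ->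
  (kappa - e) * (k * q) <= slab_ball n sigma nu r.
Proof.
by move=> k0 k8 rk; apply: le_trans (le_slab_ball rk); case/andP: (ball_k k0 k8).
Qed.

End RateAlgebra.

Section TypeTwoAlgebra.
Context {R : realType}.
Implicit Types (p q kappa e eps B E : R).

(** The three slab terms add up to the factor [(1 + 2 e) + 16 e + 16 e = 1 + 34 e]. Expanding
    [(kappa + e)(1 + 34 e) + e] and bounding [e^2] by [e] gives at most [kappa + e (34 kappa + 36)],
    the origin of the denominator. *)
Lemma missed_upper_algebra p q kappa e eps B1 B2 B3 E2 M E3 bad :
  0 <= p -> 0 <= q -> 0 < kappa -> 0 < e -> e <= 4^-1 -> 0 < eps ->
  e <= eps * kappa / (34 * kappa + 36) ->
  B1 <= (kappa + e) * ((1 + 2 * e) * q) -> B2 <= (kappa + e) * (8 * q) ->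
  B3 <= (kappa + e) * (8 * q) -> 0 <= E2 -> 0 <= M * E3 ->
  E2 <= e -> M * E3 <= e -> bad <= e * (p * q) ->
  p * B1 + 2 * E2 * (p * B2) + M * (2 * E3 * (p * B3)) + bad <=
  (1 + eps) * (p * (kappa * q)).
Proof.
move=> p0 q0 k0 e0 e4 eps0 ee H1 H2 H3 E20 E30 HE2 HE3 Hb.
have pq : 0 <= p * q by rewrite mulr_ge0.
have ke : 0 <= kappa + e by lra.
have h1 : p * B1 <= p * ((kappa + e) * ((1 + 2 * e) * q)) by rewrite ler_wpM2l.
have h2 : 2 * E2 * (p * B2) <= 2 * e * (p * ((kappa + e) * (8 * q))).
  apply: (@le_trans _ _ (2 * E2 * (p * ((kappa + e) * (8 * q))))).
    by rewrite ler_wpM2l ?mulr_ge0// ler_wpM2l.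
  by rewrite ler_wpM2r ?mulr_ge0// ler_wpM2l.
have h3 : M * (2 * E3 * (p * B3)) <= 2 * e * (p * ((kappa + e) * (8 * q))).
  have -> : M * (2 * E3 * (p * B3)) = 2 * (M * E3) * (p * B3) by ring.
  apply: (@le_trans _ _ (2 * (M * E3) * (p * ((kappa + e) * (8 * q))))).
    by apply: ler_wpM2l; [rewrite mulr_ge0|rewrite ler_wpM2l].
  by rewrite ler_wpM2r ?mulr_ge0// ler_wpM2l.
apply: (@le_trans _ _ (((kappa + e) * (1 + 34 * e) + e) * (p * q))).
  have -> : ((kappa + e) * (1 + 34 * e) + e) * (p * q) =
    p * ((kappa + e) * ((1 + 2 * e) * q)) + 2 * e * (p * ((kappa + e) * (8 * q)))
    + 2 * e * (p * ((kappa + e) * (8 * q))) + e * (p * q) by ring.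
  lra.
have -> : (1 + eps) * (p * (kappa * q)) = ((1 + eps) * kappa) * (p * q) by ring.
rewrite ler_wpM2r//.
move: ee; rewrite ler_pdivlMr; last by lra.
by nra.
Qed.

Lemma missed_lower_algebra p q kappa e eps B0 E2 bad :
  0 <= p -> 0 <= q -> 0 < kappa -> 0 < e -> e <= 4^-1 -> e <= kappa -> 0 < eps ->
  e <= eps * kappa / (34 * kappa + 36) ->
  (kappa - e) * ((1 - 2 * e) * q) <= B0 -> E2 <= e -> bad <= e * (p * q) ->
  (1 - eps) * (p * (kappa * q)) <= p * B0 * (1 - 2 * E2) - bad.
Proof.
move=> p0 q0 k0 e0 e4 ek eps0 ee H0 HE Hb.
have pq : 0 <= p * q by rewrite mulr_ge0.
have B00 : 0 <= (kappa - e) * ((1 - 2 * e) * q) by rewrite !mulr_ge0 ?subr_ge0//; lra.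
have h1 : p * ((kappa - e) * ((1 - 2 * e) * q)) * (1 - 2 * e) <= p * B0 * (1 - 2 * E2).
  apply: ler_pM; [by rewrite mulr_ge0|lra|by rewrite ler_wpM2l|lra].
have h2 : (1 - eps) * kappa <= (kappa - e) * ((1 - 2 * e) * (1 - 2 * e)) - e.
  move: ee; rewrite ler_pdivlMr; last by lra.
  move=> ee.
  have : 0 <= (kappa - e) * (e * e) by rewrite !mulr_ge0 ?subr_ge0// ltW.
  have : 0 <= e * kappa by rewrite mulr_ge0// ltW.
  have : 0 <= e * e by rewrite mulr_ge0// ltW.
  nra.
have : (1 - eps) * kappa * (p * q) <= ((kappa - e) * ((1 - 2 * e) * (1 - 2 * e)) - e) * (p * q).
  by rewrite ler_wpM2r.
lra.
Qed.

End TypeTwoAlgebra.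

Section Rates.
Context {R : realType}.
Variables (n : nat -> nat) (sigma c0 : R) (p : nat -> R).
Hypothesis n_cvg : n @ \oo --> \oo.
Hypothesis m_lt_n : forall m, (m < n m)%N.
Hypothesis sigma_gt0 : 0 < sigma.
Hypothesis p01 : forall m, 0 < p m < 1.
Hypothesis c0_gt0 : 0 < c0.
Hypothesis mp_ge : \forall m \near \oo, c0 <= m%:R * p m.

Local Notation x := (@log_size R n).

(** [A] is a level for squared scores, either the penalty or the oracle level; the radius is the
    corresponding cut on the scale of the coefficients. *)
Definition slab_radius (A : nat -> R) m : R :=
  sigma * Num.sqrt (A m) / Num.sqrt (n m)%:R.

Lemma p_ge : \forall m \near \oo, c0 * expR (- x m) <= p m.
Proof.
near=> m.
have h1 : c0 <= m%:R * p m by near: m.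
have n0 : 0 < (n m)%:R :> R by rewrite ltr0n size_gt0.
have /andP[p0 _] := p01 m.
rewrite expRN -sizeE// ler_pdivrMr// mulrC; apply: le_trans h1 _.
by rewrite ler_wpM2r ?(ltW p0)// ler_nat ltnW.
Unshelve. all: by end_near. Qed.

Variable A : nat -> R.
Hypothesis A_le : \forall m \near \oo, A m <= 4 * x m.
Hypothesis A_ge : \forall m \near \oo, x m / 2 <= A m.

Lemma level_cvg (k : R) : \forall m \near \oo, k <= A m.
Proof.
near=> m; apply: (@le_trans _ _ (x m / 2)); last by near: m.
have : 2 * k <= x m by near: m; exact: log_size_ge.
lra.
Unshelve. all: by end_near. Qed.

Lemma slab_radius_small (t0 : R) : 0 < t0 -> \forall m \near \oo, 8 * slab_radius A m < t0.
Proof.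
move=> t0_gt0; near=> m.
have x1 : 1 <= x m by near: m; exact: log_size_ge.
have h1 : 16 * sigma * (x m * expR (- (2^-1 * x m))) <= t0 / 2.
  by near: m; apply: (near_log_size n_cvg (near_lin_expR _ _ _)) => //; rewrite divr_gt0.
have A4 : A m <= 4 * x m by near: m.
apply: (@le_lt_trans _ _ (t0 / 2)); last by lra.
apply: le_trans h1; rewrite /slab_radius sqrt_sizeE// expRN -/(x m).
have -> : x m / 2 = 2^-1 * x m by rewrite mulrC.
have -> : 8 * (sigma * Num.sqrt (A m) / expR (2^-1 * x m)) =
  sigma / expR (2^-1 * x m) * 8 * Num.sqrt (A m) by ring.
have -> : 16 * sigma * (x m / expR (2^-1 * x m)) =
  sigma / expR (2^-1 * x m) * 8 * (2 * x m) by ring.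
have s0 := sigma_gt0.
rewrite ler_wpM2l//; first by rewrite mulr_ge0// divr_ge0 ?expR_ge0// ltW.
have -> : 2 * x m = Num.sqrt ((2 * x m) ^+ 2).
  by rewrite sqrtr_sqr ger0_norm//; lra.
apply: ler_wsqrtr; apply: le_trans A4 _; nra.
Unshelve. all: by end_near. Qed.

Lemma slab_radius_ge : \forall m \near \oo, sigma * expR (- (x m / 2)) <= slab_radius A m.
Proof.
near=> m; have A1 : 1 <= A m by near: m; exact: level_cvg.
have s0 := sigma_gt0.
rewrite /slab_radius sqrt_sizeE// expRN -/(x m).
rewrite ler_wpM2r ?invr_ge0 ?expR_ge0// ler_peMr//; first exact: ltW.
by rewrite -[leLHS]sqrtr1 ler_wsqrtr.
Unshelve. all: by end_near. Qed.

(** Since [p] is at least of order [1 / n] and the radius at least of order [n^(-1/2)], the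
    right-hand side is at least of order [n^(-3/2)], with room to spare over [n^(-3)]. *)
Lemma cubic_negligible (e : R) : 0 < e ->
  \forall m \near \oo, 5 * expR (- (3 * x m)) <= e * (p m * slab_radius A m).
Proof.
move=> e0; have s0 := sigma_gt0; have c0' := c0_gt0.
have k0 : 0 < e * (c0 * sigma) by rewrite !mulr_gt0.
near=> m.
have h1 : 5 * expR (- ((3 / 2) * x m)) <= e * (c0 * sigma).
  by near: m; apply: (near_log_size n_cvg (near_expR _ _ _)).
have h2 : c0 * expR (- x m) <= p m by near: m; exact: p_ge.
have h3 : sigma * expR (- (x m / 2)) <= slab_radius A m by near: m; exact: slab_radius_ge.
apply: (@le_trans _ _ (e * ((c0 * expR (- x m)) * (sigma * expR (- (x m / 2)))))); last first.
  apply: ler_wpM2l; first exact: ltW.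
  by apply: ler_pM; rewrite ?mulr_ge0 ?expR_ge0// ltW.
have -> : e * (c0 * expR (- x m) * (sigma * expR (- (x m / 2)))) =
  e * (c0 * sigma) * expR (- (3 / 2 * x m)).
  have -> : - (3 / 2 * x m) = - x m + - (x m / 2) by field.
  by rewrite expRD; ring.
have -> : 5 * expR (- (3 * x m)) = 5 * expR (- (3 / 2 * x m)) * expR (- (3 / 2 * x m)).
  by rewrite -mulrA -expRD; congr (_ * expR _); field.
by apply: ler_wpM2r => //; exact: expR_ge0.
Unshelve. all: by end_near. Qed.

Lemma gauss_tail_small (e : R) : 0 < e -> \forall m \near \oo,
  expR (- (e * Num.sqrt (A m)) ^+ 2 / 2) <= e.
Proof.
move=> e0; near=> m.
have A1 : 0 <= A m by near: m; exact: level_cvg.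
have h : - 2 * ln e / e ^+ 2 <= A m by near: m; exact: level_cvg.
rewrite -[leRHS]lnK ?posrE// ler_expR exprMn sqr_sqrtr//.
move: h; rewrite ler_pdivrMr ?exprn_gt0//; lra.
Unshelve. all: by end_near. Qed.

Lemma noise_cut_le : \forall m \near \oo,
  Num.sqrt (8 * x m) <= 4 * Num.sqrt (A m).
Proof.
near=> m; have h : x m / 2 <= A m by near: m.
have -> : 4 * Num.sqrt (A m) = Num.sqrt (16 * A m).
  rewrite sqrtrM//; congr (_ * _).
  have -> : 16 = 4 ^+ 2 :> R by ring.
  by rewrite sqrtr_sqr ger0_norm.
apply: ler_wsqrtr; lra.
Unshelve. all: by end_near. Qed.

End Rates.

(** * Error rates of the mBIC rule *)

Section MBICRates.
Context {R : realType}.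
Variables (sigma : R) (nu : probability R R).
Hypothesis sigma_gt0 : 0 < sigma.
Hypothesis nu0 : nu [set 0] = 0%E.
Variables (n : nat -> nat) (p beta0 : nat -> R).
Hypothesis p01 : forall m, 0 < p m < 1.
Variable X : forall m, 'M[R]_(n m, m.+1).
Hypothesis m_lt_n : forall m, (m < n m)%N.
Hypothesis X_design : forall m, orthogonal_design (X m).
Variables (disp : nat -> measure_display) (T : forall m, measurableType (disp m)).
Variable P : forall m, probability (T m) R.
Variable beta : forall m, 'I_m -> {RV (P m) >-> R}.
Variable eps : forall m, 'I_(n m) -> {RV (P m) >-> R}.
Arguments beta : clear implicits.
Arguments eps : clear implicits.
Hypothesis model : forall m, random_regression (p m) sigma nu (beta m) (eps m).
Hypothesis n_cvg : n @ \oo --> \oo.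
Variables (c0 kappa : R).
Hypothesis c0_gt0 : 0 < c0.
Hypothesis mp_ge : \forall m \near \oo, c0 <= m%:R * p m.
Hypothesis kappa_gt0 : 0 < kappa.
Hypothesis small_ball : forall e, 0 < e -> exists2 t0, 0 < t0 &
  forall t, 0 < t < t0 -> (kappa - e) * t <= prob nu `[- t, t] <= (kappa + e) * t.
Variables (d : R) (L : nat -> nat).
Hypothesis L_small : (fun m => (L m)%:R : R) =o_\oo
  (fun m => (n m)%:R / ((ln (n m)%:R + 2 * ln m%:R) ^+ 2 * ln m%:R)).
Variable eta : R.
Hypothesis eta_gt0 : 0 < eta.
Hypothesis L_large : \forall m \near \oo,
  m%:R * p m * (ln (n m)%:R) `^ (1 + eta) <= (L m)%:R.
Variable sel : forall m, 'cV[R]_(n m) -> {set 'I_m}.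
Arguments sel : clear implicits.
Hypothesis sel_mBIC : forall m, mBIC_rule (X m) d (L m) (sel m).
Local Notation Y m := (response (X m) (beta0 m) (fun i => beta m i) (fun k => eps m k)).
Hypothesis sel_measurable : forall m (M : {set 'I_m}),
  measurable [set w | sel m (Y m w) = M].

Local Notation x := (@log_size R n).
Local Notation pen m := (penalty m (n m) d).
Local Notation q := (slab_radius n sigma (fun m => pen m)).
Local Notation tau m := (expR (- (4^-1 * x m))).
Local Notation b m := (Num.sqrt (8 * x m)).

Lemma penalty_sizes : (\forall m \near \oo, pen m <= 4 * x m) /\
  (\forall m \near \oo, x m / 2 <= pen m).
Proof. by split; [exact: penalty_le|exact: penalty_ge]. Qed.

Lemma overselection_tail (e : R) : 0 < e -> \forall m \near \oo,
  m%:R * expR (- lower_level m (n m) d (L m) (tau m) (b m) / 2) <= e.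
Proof.
move=> e0; near=> m.
have m0 : (0 < m)%N by near: m; exact: nbhs_infty_gt.
have ll : pen m - 1 <= lower_level m (n m) d (L m) (tau m) (b m).
  by near: m; exact: lower_level_near.
have h : expR (- d / 2 + 2^-1) * expR (- (2^-1 * x m)) <= e.
  by near: m; apply: (near_log_size n_cvg (near_expR _ _ _)).
apply: le_trans h.
apply: (@le_trans _ _ (m%:R * expR (- pen m / 2) * expR 2^-1)).
  rewrite -mulrA -expRD ler_wpM2l// ler_expR; lra.
rewrite expR_penalty// -mulrA -!expRD addrC [in X in X <= _]addrC.
rewrite le_eqVlt; apply/orP; left; apply/eqP; congr expR; field.
Unshelve. all: by end_near. Qed.

(** After multiplication by [m] the left-hand side is of order [n^(-1/2)], and the right-hand side
    at least of order [sqrt(pen / n)] because [m p] is bounded below. Only the divergence of the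
    penalty separates them. *)
Lemma false_tail (e : R) : 0 < e -> \forall m \near \oo,
  2 * expR (- lower_level m (n m) d (L m) (tau m) (b m) / 2) <= e * (p m * q m).
Proof.
move=> e0; have s0 := sigma_gt0; have c0' := c0_gt0; near=> m.
have m0 : (0 < m)%N by near: m; exact: nbhs_infty_gt.
have mR : 0 < m%:R :> R by rewrite ltr0n.
have ll : pen m - 1 <= lower_level m (n m) d (L m) (tau m) (b m).
  by near: m; exact: lower_level_near.
(* Chosen so that the comparison reduces to [C <= Num.sqrt (pen m)]. *)
pose C := 2 * expR (2^-1 - d / 2) / (e * c0 * sigma).
have C0 : 0 <= C by rewrite !mulr_ge0 ?invr_ge0 ?mulr_ge0 ?expR_ge0// ltW.
have h : C ^+ 2 <= pen m by near: m; exact: penalty_cvg.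
have h3 : c0 <= m%:R * p m by near: m.
have cC : C <= Num.sqrt (pen m) by rewrite -(ger0_norm C0) -sqrtr_sqr ler_wsqrtr.
rewrite -(ler_pM2l mR).
apply: (@le_trans _ _ (2 * (m%:R * expR (- pen m / 2) * expR 2^-1))).
  rewrite mulrCA -mulrA -expRD ler_wpM2l// ler_wpM2l// ler_expR; lra.
rewrite expR_penalty//.
apply: (@le_trans _ _ (e * c0 * (sigma * C * expR (- (x m / 2))))).
  rewrite le_eqVlt; apply/orP; left; apply/eqP.
  rewrite /C expRD; have -> : - d / 2 = - (d / 2) by rewrite mulNr.
  by field; rewrite !gt_eqF.
have -> : m%:R * (e * (p m * q m)) = e * (m%:R * p m) * q m by ring.
apply: ler_pM.
- by rewrite mulr_ge0// ltW.
- by rewrite mulr_ge0 ?expR_ge0// mulr_ge0 ?C0// ltW.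
- by rewrite ler_wpM2l// ltW.
rewrite /slab_radius sqrt_sizeE// expRN; apply: ler_wpM2r; first by rewrite invr_ge0 expR_ge0.
by rewrite ler_wpM2l// ltW.
Unshelve. all: by end_near. Qed.

Lemma lower_level_sqrt (e : R) : 0 < e -> e <= 4^-1 -> \forall m \near \oo,
  (1 - e) * Num.sqrt (pen m) <=
  Num.sqrt (lower_level m (n m) d (L m) (tau m) (b m)).
Proof.
move=> e0 e4; near=> m.
have ll : pen m - 1 <= lower_level m (n m) d (L m) (tau m) (b m).
  by near: m; exact: lower_level_near.
have h : e^-1 <= pen m by near: m; exact: penalty_cvg.
have h1 : 1 <= e * pen m by rewrite -ler_pdivrMl ?mulr1.
have -> : (1 - e) * Num.sqrt (pen m) = Num.sqrt ((1 - e) ^+ 2 * pen m).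
  by rewrite sqrtrM ?sqr_ge0// sqrtr_sqr ger0_norm//; lra.
apply: ler_wsqrtr; apply: le_trans ll.
have p0 : 0 <= pen m by apply: le_trans h; rewrite invr_ge0 ltW.
have : 0 <= e * (1 - e) * pen m by rewrite !mulr_ge0//; lra.
have -> : (1 - e) ^+ 2 * pen m = pen m - e * pen m - e * (1 - e) * pen m by ring.
lra.
Unshelve. all: by end_near. Qed.

Lemma upper_level_sqrt (e : R) : 0 < e -> \forall m \near \oo,
  Num.sqrt (upper_level m (n m) d (L m) (tau m)) <= (1 + e) * Num.sqrt (pen m).
Proof.
move=> e0; near=> m.
have h : upper_level m (n m) d (L m) (tau m) <= (1 + e) ^+ 2 * pen m.
  by near: m; exact: upper_level_near.
have -> : (1 + e) * Num.sqrt (pen m) = Num.sqrt ((1 + e) ^+ 2 * pen m).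
  by rewrite sqrtrM ?sqr_ge0// sqrtr_sqr ger0_norm//; lra.
exact: ler_wsqrtr.
Unshelve. all: by end_near. Qed.

Lemma mBIC_rates (e : R) : 0 < e -> \forall m \near \oo, forall i : 'I_m,
  [/\ (1 - e) * (p m * (kappa * q m)) <=
        prob (P m) [set w | i \in true_model (fun i => beta m i) w :\: sel m (Y m w)],
      prob (P m) [set w | i \in true_model (fun i => beta m i) w :\: sel m (Y m w)] <=
        (1 + e) * (p m * (kappa * q m)) &
      prob (P m) [set w | i \in sel m (Y m w) :\: true_model (fun i => beta m i) w] <=
        e * (p m * q m)].
Proof.
move=> e0; have k0 := kappa_gt0; have s0 := sigma_gt0.
pose e1 := Num.min 4^-1 (Num.min kappa (e * kappa / (34 * kappa + 36))).
have kk : 0 < e * kappa / (34 * kappa + 36) by rewrite divr_gt0 ?mulr_gt0//; lra.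
have e1_gt0 : 0 < e1 by rewrite !lt_min k0 kk invr_gt0 ltr0n.
have e14 : e1 <= 4^-1 by rewrite ge_min lexx.
have e1k : e1 <= kappa by rewrite !ge_min lexx orbT.
have e1e : e1 <= e * kappa / (34 * kappa + 36) by rewrite !ge_min lexx !orbT.
have [t0 t0_gt0 ball] := small_ball e1_gt0.
have [penA penB] := penalty_sizes.
have e2 : 0 < e / 2 by rewrite divr_gt0.
have [eL0 eL8] : 0 < 1 - 2 * e1 /\ 1 - 2 * e1 <= 8 by lra.
have [eU0 eU8] : 0 < 1 + 2 * e1 /\ 1 + 2 * e1 <= 8 by lra.
have eU4 : (1 + e1) + 4 <= 8 by lra.
near=> m.
have nm : (0 < n m)%N by exact: size_gt0.
have pm : 0 <= p m <= 1 by have /andP[/ltW -> /ltW ->] := p01 m.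
have pm0 : 0 <= p m by case/andP: pm.
have tau01 : 0 <= tau m <= 1 by near: m; exact: tau_le1.
have p1 : 1 <= pen m by near: m; exact: penalty_cvg.
have pen0 : 0 <= pen m by lra.
have rss : 0 < rss_lower (n m) (L m) (b m ^+ 2) (tau m) by near: m; exact: rss_lower_near.
have Lpen : (L m)%:R * pen m / (n m)%:R < 1 by near: m; exact: L_pen_near.
have b0 : 0 <= b m by exact: sqrtr_ge0.
pose c := Num.sqrt (pen m).
have c0' : 0 < c by rewrite sqrtr_gt0; lra.
have q8 : 8 * q m < t0 by near: m; exact: slab_radius_small.
have up : Num.sqrt (upper_level m (n m) d (L m) (tau m)) <= (1 + e1) * c.
  by rewrite /c; near: m; exact: upper_level_sqrt.
have lowr : (1 - e1) * c <= Num.sqrt (lower_level m (n m) d (L m) (tau m) (b m)).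
  by rewrite /c; near: m; exact: lower_level_sqrt.
have bc : b m <= 4 * c by rewrite /c; near: m; apply: noise_cut_le.
have E2 : expR (- (e1 * c) ^+ 2 / 2) <= e1 by rewrite /c; near: m; exact: (gauss_tail_small n_cvg penB e1_gt0).
have E3 : m%:R * expR (- lower_level m (n m) d (L m) (tau m) (b m) / 2) <= e1.
  by near: m; exact: overselection_tail.
have bad5 : bad_bound m (n m) (p m) (L m) (tau m) (b m) <= 5 * expR (- (3 * x m)).
  by near: m; apply: (bad_bound_near _ _ eta_gt0 c0_gt0).
have bad1 : 5 * expR (- (3 * x m)) <= e1 * (p m * q m).
  by near: m; apply: (cubic_negligible n_cvg m_lt_n sigma_gt0 p01 c0_gt0).
have bad2 : 5 * expR (- (3 * x m)) <= e / 2 * (p m * q m).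
  by near: m; apply: (cubic_negligible n_cvg m_lt_n sigma_gt0 p01 c0_gt0).
have fl : 2 * expR (- lower_level m (n m) d (L m) (tau m) (b m) / 2) <= e / 2 * (p m * q m).
  by near: m; exact: false_tail.
(* The splitting level [v = e1 * c] enlarges the radius by a relative [e1] only, while its Gaussian
   tail still tends to zero since [c] diverges. *)
have v0 : 0 <= e1 * c by rewrite mulr_ge0 ?ltW.
have q0 : 0 <= q m by rewrite /slab_radius divr_ge0 ?mulr_ge0 ?sqrtr_ge0 ?ltW.
rewrite /slab_radius -/c in q8 bad1 bad2 fl q0 *.
have BU := @slab_ball_le _ (n m) sigma kappa e1 t0 c nu nm sigma_gt0 c0' ball q8.
have BL := @slab_ball_ge _ (n m) sigma kappa e1 t0 c nu nm sigma_gt0 c0' ball q8.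
move=> i; split.
- apply: le_trans (mBIC_missed_ge sigma_gt0 (model m) (X_design m) nm pm nu0
    (@sel_mBIC m) (@sel_measurable m) tau01 b0 pen0 rss i v0).
  apply: (missed_lower_algebra _ _ _ e1_gt0) => //; last exact: le_trans bad5 bad1.
  apply: BL => //.
  have -> : (1 - 2 * e1) * c = (1 - e1) * c - e1 * c by ring.
  by rewrite lerB.
- apply: le_trans (mBIC_missed_le sigma_gt0 (model m) (X_design m) nm pm nu0
    (@sel_mBIC m) (@sel_measurable m) tau01 b0 pen0 rss Lpen i v0) _.
  apply: (missed_upper_algebra _ _ _ e1_gt0) => //; last exact: le_trans bad5 bad1.
  + apply: BU => //.
    have -> : (1 + 2 * e1) * c = (1 + e1) * c + e1 * c by ring.
    by rewrite lerD.
  + apply: BU => //; apply: le_trans (lerD up bc) _.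
    by rewrite -mulrDl ler_wpM2r// ltW.
  + apply: BU => //; rewrite (_ : 8 * c = 2 * (4 * c)); last by ring.
    by rewrite ler_wpM2l.
- apply: le_trans (mBIC_false_le sigma_gt0 (model m) (X_design m) nm pm nu0
    (@sel_mBIC m) (@sel_measurable m) tau01 b0 pen0 rss i) _.
  rewrite [e in leRHS]splitr [leRHS]mulrDl.
  exact: lerD fl (le_trans bad5 bad2).
Unshelve. all: by end_near. Qed.

End MBICRates.

(** * Error rates of the Bayes oracle *)

Section OracleScores.
Context {R : realType}.
Variables (nu : probability R R) (sigma e1 c1 K : R) (n : nat).
Hypothesis sigma_gt0 : 0 < sigma.
Hypothesis n_gt0 : (0 < n)%N.
Hypothesis e1_gt0 : 0 < e1.
Hypothesis c1_gt0 : 0 < c1.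
Hypothesis K_ge0 : 0 <= K.
Hypothesis slab_lower : forall a b, - e1 <= a -> a <= b -> b <= e1 ->
  c1 * (b - a) <= prob nu `[a, b].
Hypothesis slab_gauss : forall s a, 0 < s ->
  (\int[nu]_(x in `[(- e1)%R, e1]) (normal_fun a s x)%:E <= (K * s)%:E)%E.
Variables (p delta0 deltaA t : R).
Hypothesis pA_gt0 : 0 < p * deltaA.
Hypothesis tE : (1 - p) * delta0 = p * deltaA * t.
Hypothesis t_gt1 : 1 < t.

Let s : R := sigma / Num.sqrt n%:R.
Hypothesis s_small : s <= e1 / 2.
Hypothesis s_tail : expR (- (e1 ^+ 2 / (8 * s ^+ 2))) <= s.
Hypothesis t_small : t < expR (e1 ^+ 2 / 32 / s ^+ 2) * (c1 * (e1 / 8)).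

Local Notation lo := (oracle_lower n p delta0 deltaA sigma nu).
Local Notation hi := (oracle_upper n p delta0 deltaA sigma nu).

(** Existence on each side of zero makes [get] return genuine solutions. The two scaled thresholds
    may differ in modulus; [r1] and [r2] are the smaller and the larger modulus, so both inherit the
    bounds on solutions. *)
Lemma oracle_scores : exists r1 r2,
  [/\ 0 <= r1 /\ 0 <= r2, - r2 <= lo * Num.sqrt n%:R / sigma <= - r1,
      r1 <= hi * Num.sqrt n%:R / sigma <= r2,
      t / ((K + 1) * s) <= expR (r1 ^+ 2 / 2) &
      expR (r2 ^+ 2 / 2) <= expR 2^-1 * t / (c1 * s)].
Proof.
have ex e : e ^+ 2 = 1 -> exists2 c, 0 < c & oracle_equation n p delta0 deltaA sigma nu (e * c).
  exact: (exists_oracle_threshold sigma_gt0 n_gt0 e1_gt0 c1_gt0 slab_lower pA_gt0 tE t_gt1).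
have bnd a : oracle_equation n p delta0 deltaA sigma nu a ->
    t / ((K + 1) * s) <= expR ((a / s) ^+ 2 / 2) <= expR 2^-1 * t / (c1 * s).
  exact: (oracle_solution_bounds sigma_gt0 n_gt0 e1_gt0 c1_gt0 K_ge0 slab_lower slab_gauss pA_gt0 tE).
have [lo0 loE] : lo < 0 /\ oracle_equation n p delta0 deltaA sigma nu lo.
  apply: (getPex (P := [set a | a < 0 /\ oracle_equation n p delta0 deltaA sigma nu a])).
  have [|c c0 cE] := ex (- 1); first by rewrite sqrrN expr1n.
  by exists (- c); split; [rewrite oppr_lt0|rewrite mulN1r in cE].
have [hi0 hiE] : 0 < hi /\ oracle_equation n p delta0 deltaA sigma nu hi.
  apply: (getPex (P := [set a | 0 < a /\ oracle_equation n p delta0 deltaA sigma nu a])).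
  have [|c c0 cE] := ex 1; first by rewrite expr1n.
  by exists c; split; last by rewrite mul1r in cE.
have sq : 0 < Num.sqrt n%:R :> R by rewrite sqrtr_gt0 ltr0n.
have sE a : a / s = a * Num.sqrt n%:R / sigma by rewrite /s invf_div mulrA.
have /andP[lo1 lo2] := bnd _ loE; have /andP[hi1 hi2] := bnd _ hiE.
rewrite sE -sqrrN in lo1 lo2; rewrite sE in hi1 hi2.
have l0 : 0 <= - (lo * Num.sqrt n%:R / sigma).
  rewrite -mulrA -mulNr mulr_ge0//; first by rewrite oppr_ge0 ltW.
  by rewrite divr_ge0// ltW.
have h0 : 0 <= hi * Num.sqrt n%:R / sigma by rewrite divr_ge0 ?mulr_ge0// ltW.
move: lo1 lo2 hi1 hi2 l0 h0; move: (lo * _ / _) (hi * _ / _) => a b lo1 lo2 hi1 hi2 l0 h0.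
exists (Num.min (- a) b), (Num.max (- a) b); split.
- by rewrite le_min le_max l0 h0.
- by rewrite lerNl lerNr le_max ge_min !lexx.
- by rewrite ge_min le_max !lexx !orbT.
- by case: (leP (- a) b).
- by case: (leP (- a) b).
Qed.

End OracleScores.

Section OracleAsymptotics.
Context {R : realType}.
Variables (n : nat -> nat) (p delta0 deltaA : nat -> R) (c0 K : R).
Hypothesis m_lt_n : forall m, (m < n m)%N.
Hypothesis n_cvg : n @ \oo --> \oo.
Hypothesis p01 : forall m, 0 < p m < 1.
Hypothesis delta0_gt0 : forall m, 0 < delta0 m.
Hypothesis deltaA_gt0 : forall m, 0 < deltaA m.
Hypothesis p_cvg : p @ \oo --> (0 : R).
Hypothesis delta_small :
  (fun m => ln (delta0 m / deltaA m)) =o_\oo (fun m => ln (p m)).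
Hypothesis delta_le : forall m, delta0 m / deltaA m <= K.
Hypothesis c0_gt0 : 0 < c0.
Hypothesis mp_ge : \forall m \near \oo, c0 <= m%:R * p m.

Local Notation x := (@log_size R n).

(** The product of [f] and [delta]: the value that the marginal likelihood ratio takes at the oracle
    thresholds. *)
Definition prior_odds m : R := (1 - p m) * delta0 m / (p m * deltaA m).
Definition oracle_level m : R := x m - 2 * ln (p m).

Let p_gt0 m : 0 < p m. Proof. by case/andP: (p01 m). Qed.
Let q_gt0 m : 0 < 1 - p m. Proof. by rewrite subr_gt0; case/andP: (p01 m). Qed.
Let pA_gt0 m : 0 < p m * deltaA m. Proof. exact: mulr_gt0. Qed.

Lemma prior_oddsE m : (1 - p m) * delta0 m = p m * deltaA m * prior_odds m.
Proof. by rewrite [RHS]mulrC /prior_odds divfK// gt_eqF. Qed.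

Lemma prior_odds_gt0 m : 0 < prior_odds m.
Proof. by rewrite divr_gt0// mulr_gt0. Qed.

Lemma cvg_size : (fun m => (n m)%:R : R) @ \oo --> +oo.
Proof.
apply/cvgryPge => a; near=> m; rewrite sizeE//.
apply: le_trans (expR_ge1Dx _); rewrite ler_wpDl//.
by near: m; exact: log_size_ge.
Unshelve. all: by end_near. Qed.

Lemma near_size (A : R -> Prop) :
  (\forall y \near +oo, A y) -> \forall m \near \oo, A (n m)%:R.
Proof. by move=> H; exact: cvg_size H. Qed.

Lemma p_le (e : R) : 0 < e -> \forall m \near \oo, p m <= e.
Proof.
move=> e0; have /cvgrPdist_le/(_ _ e0) H := p_cvg.
near=> m; have : `|0 - p m| <= e by near: m.
by rewrite sub0r normrN gtr0_norm.
Unshelve. all: by end_near. Qed.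

Lemma ln_p_ge (k : R) : \forall m \near \oo, k <= - ln (p m).
Proof.
near=> m; rewrite lerNr -[leRHS]expRK ler_ln ?posrE ?expR_gt0//.
by near: m; apply: p_le; exact: expR_gt0.
Unshelve. all: by end_near. Qed.

(** The smallness of [log delta] relative to [log p] gives the error [e]; the summand [- 1] bounds
    [ln (1 - p m)] from below once [p m] is at most one half. *)
Lemma ln_prior_odds (e : R) : 0 < e -> \forall m \near \oo,
  (1 - e) * - ln (p m) - 1 <= ln (prior_odds m) <= (1 + e) * - ln (p m).
Proof.
move=> e0; move/eqoP : delta_small => /(_ _ e0) H; near=> m.
have l0 : 0 <= - ln (p m) by near: m; exact: ln_p_ge.
have ld : `|ln (delta0 m / deltaA m)| <= e * `|ln (p m)| by near: m.
have p2 : p m <= 2^-1 by near: m; apply: p_le.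
have E : ln (prior_odds m) = ln (1 - p m) + ln (delta0 m / deltaA m) - ln (p m).
  have -> : prior_odds m = (1 - p m) * (delta0 m / deltaA m) / p m.
    by rewrite /prior_odds; field; rewrite !gt_eqF.
  have dp : 0 < delta0 m / deltaA m by rewrite divr_gt0.
  move: (delta0 m / deltaA m) dp => r r0.
  by rewrite ln_div ?posrE ?mulr_gt0// lnM ?posrE.
have q1 : ln (1 - p m) <= 0 by rewrite ln_le0// lerBlDr lerDl ltW.
have q2 : - 1 <= ln (1 - p m).
  rewrite -[leLHS]expRK ler_ln ?posrE ?expR_gt0//.
  have : expR (- 1) <= 2^-1 :> R.
    by rewrite expRN lef_pV2 ?posrE ?expR_gt0// (le_trans _ (expR_ge1Dx _)).
  lra.
rewrite [`|ln (p m)|]ler0_norm -?oppr_ge0// in ld.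
move: ld; rewrite ler_norml E => /andP[]; lra.
Unshelve. all: by end_near. Qed.

Lemma prior_odds_le : \forall m \near \oo, prior_odds m <= K / c0 * (n m)%:R.
Proof.
have c0' := c0_gt0; near=> m.
have h : c0 <= m%:R * p m by near: m.
have dp : 0 < delta0 m / deltaA m by rewrite divr_gt0.
have -> : prior_odds m = (1 - p m) * (delta0 m / deltaA m) * (p m)^-1.
  by rewrite /prior_odds; field; rewrite !gt_eqF.
have -> : K / c0 * (n m)%:R = K * ((n m)%:R / c0) by ring.
apply: ler_pM.
- by rewrite mulr_ge0// ltW.
- by rewrite invr_ge0 ltW.
- apply: le_trans (delta_le m); rewrite ler_piMl//; first exact: ltW.
  by rewrite lerBlDr lerDl ltW.
- rewrite ler_pdivlMr// ler_pdivrMl// mulrC; apply: le_trans h _.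
  by apply: ler_wpM2r; [exact: ltW|rewrite ler_nat ltnW].
Unshelve. all: by end_near. Qed.

Lemma oracle_level_le : \forall m \near \oo, oracle_level m <= 4 * x m.
Proof.
near=> m.
have h : c0 * expR (- x m) <= p m by near: m; apply: p_ge => //; eassumption.
have h2 : - 2 * ln c0 <= x m by near: m; exact: log_size_ge.
have : ln (c0 * expR (- x m)) <= ln (p m) by rewrite ler_ln ?posrE ?mulr_gt0 ?expR_gt0.
rewrite lnM ?posrE ?expR_gt0// expRK /oracle_level; lra.
Unshelve. all: by end_near. Qed.

Lemma oracle_level_ge : \forall m \near \oo, x m / 2 <= oracle_level m.
Proof.
near=> m.
have l0 : 0 <= - ln (p m) by near: m; exact: ln_p_ge.
have x0 : 0 <= x m by near: m; exact: log_size_ge.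
rewrite /oracle_level; lra.
Unshelve. all: by end_near. Qed.

End OracleAsymptotics.

Section OracleRates.
Context {R : realType}.
Variables (sigma : R) (nu : probability R R).
Hypothesis sigma_gt0 : 0 < sigma.
Hypothesis nu0 : nu [set 0] = 0%E.
Variables (n : nat -> nat) (p delta0 deltaA beta0 : nat -> R).
Hypothesis p01 : forall m, 0 < p m < 1.
Hypothesis delta0_gt0 : forall m, 0 < delta0 m.
Hypothesis deltaA_gt0 : forall m, 0 < deltaA m.
Variable X : forall m, 'M[R]_(n m, m.+1).
Hypothesis m_lt_n : forall m, (m < n m)%N.
Hypothesis X_design : forall m, orthogonal_design (X m).
Variables (disp : nat -> measure_display) (T : forall m, measurableType (disp m)).
Variable P : forall m, probability (T m) R.
Variable beta : forall m, 'I_m -> {RV (P m) >-> R}.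
Variable eps : forall m, 'I_(n m) -> {RV (P m) >-> R}.
Arguments beta : clear implicits.
Arguments eps : clear implicits.
Hypothesis model : forall m, random_regression (p m) sigma nu (beta m) (eps m).
Hypothesis n_cvg : n @ \oo --> \oo.
Hypothesis p_cvg : p @ \oo --> (0 : R).
Hypothesis delta_small :
  (fun m => ln (delta0 m / deltaA m)) =o_\oo (fun m => ln (p m)).
Variables (c0 K kappa r0 c1 K1 : R).
Hypothesis delta_le : forall m, delta0 m / deltaA m <= K.
Hypothesis c0_gt0 : 0 < c0.
Hypothesis mp_ge : \forall m \near \oo, c0 <= m%:R * p m.
Hypothesis kappa_gt0 : 0 < kappa.
Hypothesis small_ball : forall e, 0 < e -> exists2 t0, 0 < t0 &
  forall t, 0 < t < t0 -> (kappa - e) * t <= prob nu `[- t, t] <= (kappa + e) * t.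
Hypothesis r0_gt0 : 0 < r0.
Hypothesis c1_gt0 : 0 < c1.
Hypothesis K1_ge0 : 0 <= K1.
Hypothesis slab_lower : forall a b, - r0 <= a -> a <= b -> b <= r0 ->
  c1 * (b - a) <= prob nu `[a, b].
Hypothesis slab_gauss : forall s a, 0 < s ->
  (\int[nu]_(x in `[(- r0)%R, r0]) (normal_fun a s x)%:E <= (K1 * s)%:E)%E.

Local Notation x := (@log_size R n).
Local Notation Y m := (response (X m) (beta0 m) (fun i => beta m i) (fun k => eps m k)).
Local Notation S m w := (Bayes_oracle (p m) (delta0 m) (deltaA m) sigma nu (X m) (Y m w)).
Local Notation lo m := (oracle_lower (n m) (p m) (delta0 m) (deltaA m) sigma nu).
Local Notation hi m := (oracle_upper (n m) (p m) (delta0 m) (deltaA m) sigma nu).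
Local Notation A := (oracle_level n p).
Local Notation q := (slab_radius n sigma (oracle_level n p)).
Local Notation odds := (prior_odds p delta0 deltaA).
Local Notation s m := (sigma / Num.sqrt (n m)%:R).

Lemma ln_noise_level m : ln (s m) = ln sigma - x m / 2.
Proof. by rewrite ln_div ?posrE ?sqrt_sizeE ?expR_gt0// expRK. Qed.

Lemma noise_level_gt0 m : 0 < s m.
Proof. by rewrite divr_gt0// sqrtr_gt0 ltr0n size_gt0. Qed.

Lemma noise_level_small : \forall m \near \oo, s m <= r0 / 2.
Proof.
have r2 : 0 < r0 / 2 by rewrite divr_gt0.
near=> m.
have h : sigma * expR (- (2^-1 * x m)) <= r0 / 2.
  by near: m; apply: (near_log_size n_cvg (near_expR _ _ _)).
by rewrite sqrt_sizeE// -expRN [x m / 2]mulrC.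
Unshelve. all: by end_near. Qed.

Let rate : R := r0 ^+ 2 / 32 / sigma ^+ 2.
Let rate_gt0 : 0 < rate.
Proof. by rewrite !divr_gt0 ?exprn_gt0. Qed.

Let sqr_noise_level m : (s m) ^+ 2 = sigma ^+ 2 / (n m)%:R.
Proof. by rewrite expr_div_n sqr_sqrtr. Qed.

Lemma noise_level_tail : \forall m \near \oo,
  expR (- (r0 ^+ 2 / (8 * s m ^+ 2))) <= s m.
Proof.
have sg := sigma_gt0; have rg := rate_gt0; near=> m.
have n0 : 0 < (n m)%:R :> R by rewrite ltr0n size_gt0.
have h : 1 * ((n m)%:R * expR (- (rate * (n m)%:R))) <= sigma.
  by near: m; apply: (near_size m_lt_n n_cvg (near_lin_expR _ _ _)).
have n1 : 1 <= (n m)%:R :> R by rewrite ler1n size_gt0.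
have sn : Num.sqrt (n m)%:R <= (n m)%:R :> R.
  rewrite -[leRHS]ger0_norm// -sqrtr_sqr ler_wsqrtr// expr2.
  by rewrite ler_peMr// ler0n.
rewrite ler_pdivlMr ?sqrtr_gt0//; apply: le_trans h.
rewrite mul1r mulrC; apply: ler_pM; rewrite ?sqrtr_ge0 ?expR_ge0//.
rewrite ler_expR lerN2 sqr_noise_level.
have -> : r0 ^+ 2 / (8 * (sigma ^+ 2 / (n m)%:R)) = 4 * (rate * (n m)%:R).
  by rewrite /rate; field; rewrite !gt_eqF.
by rewrite ler_peMl ?ler1n// mulr_ge0// ltW.
Unshelve. all: by end_near. Qed.

(** The odds grow at most linearly in [n], as [delta] is bounded and [p] at least of order [1 / n];
    the right-hand side is exponential in [n]. *)
Lemma prior_odds_small : \forall m \near \oo,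
  odds m < expR (r0 ^+ 2 / 32 / s m ^+ 2) * (c1 * (r0 / 8)).
Proof.
have sg := sigma_gt0; have rg := rate_gt0; have cg := c1_gt0; have r0' := r0_gt0.
have k0 : 0 < c1 * (r0 / 8) by rewrite mulr_gt0// divr_gt0.
have k2 : 0 < c1 * (r0 / 8) / 2 by rewrite divr_gt0.
near=> m.
have n0 : 0 < (n m)%:R :> R by rewrite ltr0n size_gt0.
have h : K / c0 * ((n m)%:R * expR (- (rate * (n m)%:R))) <= c1 * (r0 / 8) / 2.
  by near: m; apply: (near_size m_lt_n n_cvg (near_lin_expR _ _ _)).
have oT : odds m <= K / c0 * (n m)%:R by near: m; apply: prior_odds_le => //; eassumption.
rewrite sqr_noise_level.
have -> : r0 ^+ 2 / 32 / (sigma ^+ 2 / (n m)%:R) = rate * (n m)%:R.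
  by rewrite /rate; field; rewrite !gt_eqF.
apply: (le_lt_trans oT).
rewrite [ltRHS]mulrC -ltr_pdivrMr ?expR_gt0// -expRN -[ltLHS]mulrA.
by apply: (le_lt_trans h); rewrite ltr_pdivrMr// ltr_pMr// ltr1n.
Unshelve. all: by end_near. Qed.

(** Taking logarithms in [oracle_scores], the squared scaled thresholds equal
    [2 * ln (odds m) - 2 * ln (s m)] up to a constant. The first term is [- 2 * ln (p m)] up to a
    relative error and the second is [x m] up to a constant, which together give [A m]. *)
Lemma oracle_scores_near (e : R) : 0 < e -> e <= 4^-1 -> \forall m \near \oo,
  exists r1 r2, [/\ 0 <= r1,
    - r2 <= lo m * Num.sqrt (n m)%:R / sigma <= - r1 /\
    r1 <= hi m * Num.sqrt (n m)%:R / sigma <= r2,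
    (1 - e) * Num.sqrt (A m) <= r1, r2 <= (1 + e) * Num.sqrt (A m) &
    odds m / ((K1 + 1) * s m) <= expR (r1 ^+ 2 / 2)].
Proof.
move=> e0 e4; have e2 : 0 < e / 2 by rewrite divr_gt0.
have cg := c1_gt0; have K10 : 0 < K1 + 1 by have := K1_ge0; lra.
near=> m.
have n0 : (0 < n m)%N by exact: size_gt0.
have pA : 0 < p m * deltaA m by rewrite mulr_gt0//; case/andP: (p01 m).
have s0 := noise_level_gt0 m.
have o0 : 0 < odds m by apply: prior_odds_gt0.
have lnp : 3 <= - ln (p m) by near: m; exact: ln_p_ge.
have x0 : 0 <= x m by near: m; exact: log_size_ge.
have /andP[lnT1 lnT2] : (1 - e / 2) * - ln (p m) - 1 <= ln (odds m) <= (1 + e / 2) * - ln (p m).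
  by near: m; exact: ln_prior_odds.
(* Half of the allowed error [e], taken on [x m], absorbs all constants; the other half is spent on
   the deviation of [ln (odds m)] from [- ln (p m)]. *)
have big : 2 + 2 * `|ln (K1 + 1)| + 2 * `|ln c1| + 2 * `|ln sigma| <= e / 2 * x m.
  by rewrite [leRHS]mulrC -ler_pdivrMr//; near: m; exact: log_size_ge.
have T1 : 1 < odds m.
  rewrite -[ltRHS]lnK ?posrE// -[ltLHS]expR0 ltr_expR; nra.
have [r1 [r2 [[r10 r20] loP hiP H1 H2]]] : exists r1 r2,
  [/\ 0 <= r1 /\ 0 <= r2, - r2 <= lo m * Num.sqrt (n m)%:R / sigma <= - r1,
      r1 <= hi m * Num.sqrt (n m)%:R / sigma <= r2,
      odds m / ((K1 + 1) * s m) <= expR (r1 ^+ 2 / 2) &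
      expR (r2 ^+ 2 / 2) <= expR 2^-1 * odds m / (c1 * s m)].
  apply: (@oracle_scores _ nu sigma r0 c1 K1 (n m)) => //.
  - exact: prior_oddsE.
  - by near: m; exact: noise_level_small.
  - by near: m; exact: noise_level_tail.
  - by near: m; exact: prior_odds_small.
have ks0 : 0 < (K1 + 1) * s m by exact: mulr_gt0.
have cs0 : 0 < c1 * s m by exact: mulr_gt0.
have eo0 : 0 < expR 2^-1 * odds m by rewrite mulr_gt0 ?expR_gt0.
have dT1 : ln (odds m / ((K1 + 1) * s m)) <= r1 ^+ 2 / 2.
  by rewrite -[leRHS]expRK ler_ln ?posrE ?expR_gt0//; exact: divr_gt0.
have dT2 : r2 ^+ 2 / 2 <= ln (expR 2^-1 * odds m / (c1 * s m)).
  by rewrite -[leLHS]expRK ler_ln ?posrE ?expR_gt0//; exact: divr_gt0.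
rewrite (ln_div (o0 : odds m \is Num.pos) ks0) (lnM (K10 : _ \is Num.pos) s0) ln_noise_level in dT1.
rewrite (ln_div (eo0 : _ \is Num.pos) cs0) (lnM (cg : _ \is Num.pos) s0) in dT2.
rewrite (lnM (expR_gt0 2^-1 : _ \is Num.pos) o0) expRK ln_noise_level in dT2.
have A0 : 0 <= A m by rewrite /oracle_level; lra.
have sE (a : R) : 0 <= a -> a * Num.sqrt (A m) = Num.sqrt (a ^+ 2 * A m).
  by move=> a0; rewrite sqrtrM ?sqr_ge0// sqrtr_sqr ger0_norm.
have [e10 e11] : 0 <= 1 - e /\ 0 <= 1 + e by lra.
have [nK nc ns] := And3 (ler_norm (ln (K1 + 1))) (ler_norm (- ln c1)) (ler_norm (ln sigma)).
have ns' := ler_norm (- ln sigma); rewrite !normrN in nc ns'.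
have ee : 0 <= e * A m * (1 - e) by rewrite !mulr_ge0// ltW.
have ee' : 0 <= e * A m * (1 + e) by rewrite !mulr_ge0// ltW.
have aK := normr_ge0 (ln (K1 + 1)); have ac := normr_ge0 (ln c1).
have ex : 0 <= e * x m by rewrite mulr_ge0// ltW.
have el : 0 <= e * - ln (p m) by rewrite mulr_ge0 ?(le_trans _ lnp)// ltW.
exists r1, r2; split => //.
- rewrite sE// -[leRHS]ger0_norm// -sqrtr_sqr; apply: ler_wsqrtr.
  have -> : (1 - e) ^+ 2 * A m = A m - e * A m - e * A m * (1 - e) by ring.
  move: dT1 lnT1 big ee; rewrite /oracle_level;
  lra.
- rewrite sE// -[leLHS]ger0_norm// -sqrtr_sqr; apply: ler_wsqrtr.
  have -> : (1 + e) ^+ 2 * A m = A m + e * A m + e * A m * (1 + e) by ring.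
  move: dT2 lnT2 big ee'; rewrite /oracle_level;
  lra.
Unshelve. all: by end_near. Qed.

(** For false inclusions the weight [delta0 m / deltaA m] cancels against the odds in the Gaussian
    tail at the threshold. What remains is of order [p m * s m], smaller than [p m * q m] by the
    diverging factor [Num.sqrt (A m)]. *)
Lemma oracle_rates (e : R) : 0 < e -> \forall m \near \oo, forall i : 'I_m,
  [/\ (1 - e) * (p m * (kappa * q m)) <=
        prob (P m) [set w | i \in true_model (fun i => beta m i) w :\: S m w],
      prob (P m) [set w | i \in true_model (fun i => beta m i) w :\: S m w] <=
        (1 + e) * (p m * (kappa * q m)) &
      delta0 m / deltaA m *
        prob (P m) [set w | i \in S m w :\: true_model (fun i => beta m i) w] <=
        e * (p m * q m)].
Proof.
move=> e0; have k0 := kappa_gt0; have sg := sigma_gt0.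
pose e1 := Num.min 4^-1 (Num.min kappa (e * kappa / (34 * kappa + 36))).
have kk : 0 < e * kappa / (34 * kappa + 36) by rewrite divr_gt0 ?mulr_gt0//; lra.
have e1_gt0 : 0 < e1 by rewrite !lt_min k0 kk invr_gt0 ltr0n.
have e14 : e1 <= 4^-1 by rewrite ge_min lexx.
have e1k : e1 <= kappa by rewrite !ge_min lexx orbT.
have e1e : e1 <= e * kappa / (34 * kappa + 36) by rewrite !ge_min lexx !orbT.
have [t0 t0_gt0 ball] := small_ball e1_gt0.
have penA : \forall m \near \oo, A m <= 4 * x m.
  exact: (oracle_level_le m_lt_n n_cvg p01 c0_gt0 mp_ge).
have penB : \forall m \near \oo, x m / 2 <= A m by exact: oracle_level_ge.
have [eL0 eL8] : 0 < 1 - 2 * e1 /\ 1 - 2 * e1 <= 8 by lra.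
have [eU0 eU8] : 0 < 1 + 2 * e1 /\ 1 + 2 * e1 <= 8 by lra.
have eU4 : (1 + e1) + 4 <= 8 by lra.
have K10 : 0 < K1 + 1 by have := K1_ge0; lra.
near=> m.
have nm : (0 < n m)%N by exact: size_gt0.
have pm : 0 <= p m <= 1 by have /andP[/ltW -> /ltW ->] := p01 m.
have pm0 : 0 <= p m by case/andP: pm.
have p1 : 1 <= A m by near: m; exact: (level_cvg n_cvg penB).
have b0 : 0 <= Num.sqrt (8 * x m) by exact: sqrtr_ge0.
have x0 : 0 <= 8 * x m by rewrite mulr_ge0//; near: m; exact: log_size_ge.
pose c := Num.sqrt (A m).
have c_gt0 : 0 < c by rewrite sqrtr_gt0 (lt_le_trans ltr01).
have q8 : 8 * q m < t0 by near: m; exact: slab_radius_small.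
have bc : Num.sqrt (8 * x m) <= 4 * c by rewrite /c; near: m; apply: noise_cut_le.
have E2 : expR (- (e1 * c) ^+ 2 / 2) <= e1.
  by rewrite /c; near: m; exact: (gauss_tail_small n_cvg penB e1_gt0).
have bad1 : 5 * expR (- (3 * x m)) <= e1 * (p m * q m).
  by near: m; apply: (cubic_negligible n_cvg m_lt_n sigma_gt0 p01 c0_gt0).
have p2 : p m <= 2^-1 by near: m; exact: p_le.
have ec : 4 * (K1 + 1) <= e * c.
  rewrite -ler_pdivrMl//; set C := e^-1 * _.
  have C0 : 0 <= C by rewrite mulr_ge0 ?invr_ge0 ?mulr_ge0// ltW.
  rewrite -(ger0_norm C0) -sqrtr_sqr ler_wsqrtr// /C.
  by near: m; exact: (level_cvg n_cvg penB).
have [r1 [r2 [r10 [loP hiP] Lr Ur Tr]]] : exists r1 r2, [/\ 0 <= r1,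
    - r2 <= lo m * Num.sqrt (n m)%:R / sigma <= - r1 /\
    r1 <= hi m * Num.sqrt (n m)%:R / sigma <= r2,
    (1 - e1) * Num.sqrt (A m) <= r1, r2 <= (1 + e1) * Num.sqrt (A m) &
    odds m / ((K1 + 1) * s m) <= expR (r1 ^+ 2 / 2)].
  by near: m; exact: oracle_scores_near.
have v0 : 0 <= e1 * c by rewrite mulr_ge0 ?ltW.
have q0 : 0 <= q m by rewrite /slab_radius divr_ge0 ?mulr_ge0 ?sqrtr_ge0 ?ltW.
have s0 := noise_level_gt0 m.
have qE : q m = s m * c by rewrite /slab_radius mulrAC.
rewrite /slab_radius -/c in q8 bad1 q0 qE *.
have BU := @slab_ball_le _ (n m) sigma kappa e1 t0 c nu nm sigma_gt0 c_gt0 ball q8.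
have BL := @slab_ball_ge _ (n m) sigma kappa e1 t0 c nu nm sigma_gt0 c_gt0 ball q8.
move=> i; split.
- apply: le_trans (oracle_missed_ge (beta0 m) sigma_gt0 (model m) (X_design m) nm nu0
    loP hiP i v0).
  have -> : p m * slab_ball (n m) sigma nu (r1 - e1 * c) * (1 - 2 * expR (- (e1 * c) ^+ 2 / 2)) =
    p m * slab_ball (n m) sigma nu (r1 - e1 * c) * (1 - 2 * expR (- (e1 * c) ^+ 2 / 2)) - 0.
    by rewrite subr0.
  apply: (missed_lower_algebra _ _ _ e1_gt0) => //; last by rewrite mulr_ge0 ?mulr_ge0// ltW.
  apply: BL => //.
  have -> : (1 - 2 * e1) * c = (1 - e1) * c - e1 * c by ring.
  by rewrite lerB.
- apply: le_trans (oracle_missed_le (beta0 m) sigma_gt0 (model m) (X_design m) nm nu0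
    loP hiP i v0 b0) _.
  (* The oracle has no full-model alternative: a vanishing third term brings the bound into the form
     of [missed_upper_algebra]. *)
  rewrite -[X in X + 2 * expR (- Num.sqrt _ ^+ 2 / 2)]addr0 -[X in _ + X + 2 * _](mul0r (2 * 0 * (p m * 0))).
  apply: (missed_upper_algebra _ _ _ e1_gt0) => //.
  + apply: BU => //.
    have -> : (1 + 2 * e1) * c = (1 + e1) * c + e1 * c by ring.
    by rewrite lerD.
  + apply: BU => //; apply: le_trans (lerD Ur bc) _.
    by rewrite -mulrDl ler_wpM2r// ltW.
  + by apply: mulr_ge0; [rewrite addr_ge0// ltW|exact: mulr_ge0].
  + by rewrite mul0r ltW.
  + apply: le_trans bad1.
    rewrite sqr_sqrtr// ler_pM ?expR_ge0// ?ler_nat// ler_expR.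
    have := x0; lra.
- have oF := oracle_false_le (beta0 m) sigma_gt0 (model m) (X_design m) nm r10 loP hiP i.
  have dp : 0 < delta0 m / deltaA m by rewrite divr_gt0.
  apply: le_trans (ler_wpM2l (ltW dp) oF) _.
  have pm1 : 0 < p m by case/andP: (p01 m).
  have ks0 : 0 < (K1 + 1) * s m by exact: mulr_gt0.
  have o0 : 0 < odds m by apply: prior_odds_gt0.
  have Er : expR (- r1 ^+ 2 / 2) <= (K1 + 1) * s m / odds m.
    rewrite mulNr expRN -[leRHS]invf_div lef_pV2 ?posrE ?expR_gt0//.
    exact: divr_gt0.
  apply: (@le_trans _ _ (delta0 m / deltaA m * (2 * ((K1 + 1) * s m / odds m)))).
    by apply: ler_wpM2l; [exact: ltW|rewrite ler_wpM2l].
  have q1 : 2^-1 <= 1 - p m by rewrite lerBrDl -lerBrDr; lra.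
  have -> : delta0 m / deltaA m * (2 * ((K1 + 1) * s m / odds m)) =
      p m * s m * (2 * (K1 + 1) / (1 - p m)).
    rewrite /prior_odds; field.
    by rewrite !gt_eqF ?(lt_le_trans _ q1)// sqrtr_gt0 ltr0n.
  have -> : e * (p m * (sigma * c / Num.sqrt (n m)%:R)) = p m * s m * (e * c) by ring.
  apply: ler_wpM2l; first by rewrite mulr_ge0// ltW.
  apply: le_trans ec; rewrite ler_pdivrMr ?(lt_le_trans _ q1)//.
  rewrite (_ : 2 * _ = 4 * (K1 + 1) * 2^-1); last by field.
  by rewrite ler_wpM2l// mulr_ge0// ltW.
Unshelve. all: by end_near. Qed.

End OracleRates.

(** * From error rates to ratios of risks *)

Section RiskComparison.
Context {R : realType}.

Lemma fine_risk (disp : measure_display) (T : measurableType disp)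
    (P : probability T R) (m : nat) (delta0 deltaA : R) (beta : 'I_m -> T -> R)
    (S : T -> {set 'I_m}) :
  (forall i, measurable [set w | i \in true_model beta w]) ->
  (forall i, measurable [set w | i \in S w]) ->
  fine (risk P delta0 deltaA beta S) =
  delta0 * (\sum_i prob P [set w | i \in S w :\: true_model beta w]) +
  deltaA * (\sum_i prob P [set w | i \in true_model beta w :\: S w]).
Proof.
move=> mt mS; rewrite /risk !expectation_card; first by [].
- by move=> i; exact: measurable_mem_setD.
- by move=> i; exact: measurable_mem_setD.
Qed.

(** Dividing the risk by [deltaA] gives missed signals weight one and false inclusions weight
    [delta0 / deltaA]. With the latter negligible, the risk is equivalent to its missed part. *)
Lemma risk_equivalent (F M : forall m, 'I_m -> R) (p q delta0 deltaA : nat -> R)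
    (kappa : R) :
  0 < kappa -> (forall m, 0 < deltaA m) -> (forall m i, 0 <= F m i) ->
  (forall m, 0 < delta0 m) -> (forall m, 0 < p m) ->
  (\forall m \near \oo, 0 < q m) ->
  (forall e, 0 < e -> \forall m \near \oo, forall i : 'I_m,
    [/\ (1 - e) * (p m * (kappa * q m)) <= M m i,
        M m i <= (1 + e) * (p m * (kappa * q m)) &
        delta0 m / deltaA m * F m i <= e * (p m * q m)]) ->
  (fun m => (delta0 m * (\sum_i F m i) + deltaA m * (\sum_i M m i)) /
            (deltaA m * (m%:R * (p m * (kappa * q m))))) @ \oo --> (1 : R).
Proof.
move=> k0 dA F0 d0 p0 q0 H; apply/cvgrPdist_le => e e0.
pose e1 := Num.min (e / 2) (e * kappa / 2).
have e1_gt0 : 0 < e1 by rewrite lt_min !divr_gt0// mulr_gt0.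
have e1e : e1 <= e / 2 by rewrite ge_min lexx.
have e1k : e1 / kappa <= e / 2.
  by rewrite ler_pdivrMr// mulrAC ge_min lexx orbT.
near=> m.
have qm : 0 < q m by near: m.
have m0 : 0 < m%:R :> R by rewrite ltr0n; near: m; exact: nbhs_infty_gt.
have Hm : forall i : 'I_m, [/\ (1 - e1) * (p m * (kappa * q m)) <= M m i,
        M m i <= (1 + e1) * (p m * (kappa * q m)) &
        delta0 m / deltaA m * F m i <= e1 * (p m * q m)] by near: m; exact: H.
have v0 : 0 < p m * (kappa * q m) by rewrite !mulr_gt0.
pose v := m%:R * (p m * (kappa * q m)).
have v_gt0 : 0 < v by rewrite mulr_gt0.
have sumc (c : R) : \sum_(i < m) c = m%:R * c by rewrite sumr_const card_ord mulr_natl.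
have M1 : (1 - e1) * v <= \sum_i M m i.
  by rewrite /v mulrCA -sumc; apply: ler_sum => i _; case: (Hm i).
have M2 : \sum_i M m i <= (1 + e1) * v.
  by rewrite /v mulrCA -sumc; apply: ler_sum => i _; case: (Hm i).
have F1 : delta0 m / deltaA m * \sum_i F m i <= e1 / kappa * v.
  have -> : e1 / kappa * v = m%:R * (e1 * (p m * q m)).
    by rewrite /v; field; rewrite gt_eqF.
  by rewrite mulr_sumr -sumc; apply: ler_sum => i _; case: (Hm i).
have F2 : 0 <= delta0 m / deltaA m * \sum_i F m i.
  by rewrite mulr_ge0 ?sumr_ge0// divr_ge0// ltW.
have -> : (delta0 m * (\sum_i F m i) + deltaA m * (\sum_i M m i)) / (deltaA m * v) =
   (delta0 m / deltaA m * (\sum_i F m i) + \sum_i M m i) / v.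
  by field; rewrite !gt_eqF.
move: M1 M2 F1 F2; move: (delta0 m / _ * _) (\sum_i M m i) => a b M1 M2 F1 F2.
have -> : 1 - (a + b) / v = (v - a - b) / v by field; rewrite gt_eqF.
rewrite normrM [`|v^-1|]gtr0_norm ?invr_gt0// ler_pdivrMr// ler_norml.
have h1 : e1 * v <= e / 2 * v by rewrite ler_wpM2r// ltW.
have h2 : e1 / kappa * v <= e / 2 * v by rewrite ler_wpM2r// ltW.
have h3 : 0 <= e * v by rewrite mulr_ge0 ?ltW.
apply/andP; split; lra.
Unshelve. all: by end_near. Qed.

Lemma ratio_cvg1 (r1 r2 w1 w2 : nat -> R) :
  (\forall m \near \oo, 0 < w1 m) -> (\forall m \near \oo, 0 < w2 m) ->
  (fun m => r1 m / w1 m) @ \oo --> (1 : R) ->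
  (fun m => r2 m / w2 m) @ \oo --> (1 : R) ->
  (fun m => w1 m / w2 m) @ \oo --> (1 : R) ->
  (fun m => r1 m / r2 m) @ \oo --> (1 : R).
Proof.
move=> w10 w20 h1 h2 h3.
have one : (1 : R) = 1 * 1 * 1^-1 by rewrite invr1 !mulr1.
have H : (fun m => r1 m / w1 m * (w1 m / w2 m) * (r2 m / w2 m)^-1) @ \oo --> (1 : R).
  rewrite [X in _ --> X]one; apply: cvgM; first exact: cvgM.
  by apply: cvgV => //; exact: oner_neq0.
apply: cvg_trans H; apply: near_eq_cvg; near=> m.
have a1 : 0 < w1 m by near: m.
have a2 : 0 < w2 m by near: m.
rewrite invf_div; move: (r1 m) (r2 m) => a b.
(* If [b] is zero, both sides vanish because the inverse of zero is zero. *)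
have [->|b0] := eqVneq b 0; first by rewrite invr0 !mulr0.
by field; rewrite b0 !gt_eqF.
Unshelve. all: by end_near. Qed.

(** For [u >= 0] one has [|u - 1| <= |u - 1| (u + 1) = |u^2 - 1|], applied to the ratio of square
    roots. *)
Lemma sqrt_ratio_cvg1 (a b : nat -> R) :
  (\forall m \near \oo, 0 < a m) -> (\forall m \near \oo, 0 < b m) ->
  (fun m => (a m - b m) / b m) @ \oo --> (0 : R) ->
  (fun m => Num.sqrt (a m) / Num.sqrt (b m)) @ \oo --> (1 : R).
Proof.
move=> a0 b0 H; apply/cvgrPdist_le => e e0; near=> m.
have am : 0 < a m by near: m.
have bm : 0 < b m by near: m.
have : `|0 - (a m - b m) / b m| <= e.
  by near: m; move/cvgrPdist_le: H; apply.
apply: le_trans; rewrite sub0r normrN.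
have sb : 0 < Num.sqrt (b m) by rewrite sqrtr_gt0.
have -> : (a m - b m) / b m = (Num.sqrt (a m) / Num.sqrt (b m)) ^+ 2 - 1.
  rewrite expr_div_n !sqr_sqrtr ?ltW//; field; rewrite gt_eqF//.
have : 0 <= Num.sqrt (a m) / Num.sqrt (b m) by rewrite divr_ge0.
move: (_ / _) => u u0; have -> : u ^+ 2 - 1 = (u - 1) * (u + 1) by ring.
rewrite distrC normrM [`|u + 1|]ger0_norm; last by rewrite addr_ge0.
by rewrite ler_peMr// lerDr.
Unshelve. all: by end_near. Qed.

End RiskComparison.

Section SlabAssumption.
Context {R : realType} (nu : probability R R).

Lemma assumption_C_bounds : assumption_C nu -> exists kappa r0 c1 K1 : R,
  [/\ 0 < kappa,
      forall e, 0 < e -> exists2 t0, 0 < t0 & forall t, 0 < t < t0 ->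
        (kappa - e) * t <= prob nu `[- t, t] <= (kappa + e) * t,
      [/\ 0 < r0, 0 < c1 & 0 <= K1],
      forall a b, - r0 <= a -> a <= b -> b <= r0 -> c1 * (b - a) <= prob nu `[a, b] &
      forall s a, 0 < s ->
        (\int[nu]_(x in `[(- r0)%R, r0]) (normal_fun a s x)%:E <= (K1 * s)%:E)%E].
Proof.
move=> [e0 [rho [e0_gt0 mrho [K rhoK] nuE [rhom [rhop [rhom0 rhop0 cm cp]]]]]].
have [r0 [c1 [r00 r0e c10 low]]] := slab_itv_lower e0_gt0 mrho rhoK nuE rhom0 rhop0 cm cp.
exists (rhom + rhop), r0, c1, (K * Num.sqrt (pi *+ 2)); split.
- exact: addr_gt0.
- exact: (slab_small_ball e0_gt0 mrho rhoK nuE rhom0 rhop0 cm cp).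
- split => //; rewrite mulr_ge0//.
  have z0 : 0 \in `[- e0, e0] by rewrite in_itv/= oppr_le0 !ltW.
  by have /andP[/ltW h1] := rhoK _ z0; exact: le_trans.
- exact: low.
move=> s a s0; apply: le_trans (_ : (\int[nu]_(x in `[(- e0)%R, e0]) (normal_fun a s x)%:E <= _)%E).
  apply: ge0_subset_integral => //.
  - apply/measurable_EFinP; apply: measurable_funTS; exact: measurable_normal_fun.
  - by move=> x _; rewrite lee_fin normal_fun_ge0.
  - by move=> x /=; rewrite !in_itv/= => /andP[x1 x2]; rewrite (le_trans _ x1) ?lerN2//= (le_trans x2).
apply: le_trans (slab_gauss_integral e0_gt0 mrho rhoK nuE a s0) _.
by rewrite mulrAC mulrA.
Qed.

End SlabAssumption.

(** Finite and infinite limits of [m p] are treated alike from here on, through a positive lower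
    bound. *)
Lemma cvg_pos_bounded_below {R : realType} (u : nat -> R) (s : \bar R) :
  (0 < s)%E -> (fun m => (u m)%:E) @ \oo --> s ->
  exists2 c, 0 < c & \forall m \near \oo, c <= u m.
Proof.
case: s => [r| |]//.
- rewrite lte_fin => r0 /fine_cvgP[_] /cvgrPdist_le H.
  exists (r / 2); first by rewrite divr_gt0.
  have r2 : 0 < r / 2 by rewrite divr_gt0.
  near=> m; have : `|r - fine (u m)%:E| <= r / 2 by near: m; exact: H.
  rewrite /= ler_norml => /andP[]; lra.
- move=> _ /cvgeyPge H; exists 1 => //; near=> m; rewrite -lee_fin.
  by near: m; exact: H.
Unshelve. all: by end_near. Qed.

Theorem theorem3p3 (R : realType)
    (sigma : R) (nu : probability R R)
    (sigma_gt0 : 0 < sigma)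
    (nu0 : nu [set 0] = 0%E)
    (nu_neg : (0 < nu `]-oo, 0%R[%classic)%E) (nu_pos : (0 < nu `]0%R, +oo[%classic)%E)
    (n : nat -> nat) (p delta0 deltaA beta0 : nat -> R)
    (p_in01 : forall m, 0 < p m < 1)
    (delta0_gt0 : forall m, 0 < delta0 m) (deltaA_gt0 : forall m, 0 < deltaA m)
    (X : forall m, 'M[R]_(n m, m.+1))
    (m_lt_n : forall m, (m < n m)%N)
    (X_design : forall m, orthogonal_design (X m))
    (disp : nat -> measure_display) (T : forall m, measurableType (disp m))
    (P : forall m, probability (T m) R)
    (beta : forall m, 'I_m -> {RV (P m) >-> R})
    (eps : forall m, 'I_(n m) -> {RV (P m) >-> R})
    (model : forall m, random_regression (p m) sigma nu (beta m) (eps m))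
    (HB : assumption_B n p delta0 deltaA)
    (HC : assumption_C nu)
    (d : R) (L : nat -> nat)
    (L_small : (fun m => (L m)%:R : R) =o_\oo
       (fun m => (n m)%:R /
          ((ln (n m)%:R + 2 * ln m%:R) ^+ 2 * ln m%:R)))
    (eta : R) (eta_gt0 : 0 < eta)
    (L_large : \forall m \near \oo,
       m%:R * p m * (ln (n m)%:R) `^ (1 + eta) <= (L m)%:R)
    (sel : forall m, 'cV[R]_(n m) -> {set 'I_m})
    (sel_mBIC : forall m, mBIC_rule (X m) d (L m) (sel m))
    (sel_measurable : forall m (M : {set 'I_m}),
       measurable [set w | sel m (response (X m) (beta0 m) (beta m) (eps m) w)
                             = M]) :
  let Y m := response (X m) (beta0 m) (beta m) (eps m) in
  (forall s : \bar R, (0 < s)%E ->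
     (fun m => (m%:R * p m)%:E) @ \oo --> s ->
     (fun m => ln (m%:R * p m) / ln (n m)%:R) @ \oo --> (0 : R) ->
     ABOS
       (fun m => risk (P m) (delta0 m) (deltaA m) (beta m)
                   (fun w => sel m (Y m w)))
       (fun m => risk (P m) (delta0 m) (deltaA m) (beta m)
                   (fun w => Bayes_oracle (p m) (delta0 m) (deltaA m) sigma nu
                               (X m) (Y m w))))
  /\
  (forall s : \bar R, (0 < s)%E ->
     (fun m => (m%:R * p m)%:E) @ \oo --> s ->
     (fun m => m%:R * p m * Num.sqrt (ln (n m)%:R / (n m)%:R)) @ \oo --> (0 : R) ->
     (fun m => P m [set w | sel m (Y m w) = true_model (beta m) w])
       @ \oo --> 1%E).
Proof.
move=> Y.
have [n_cvg p_cvg dsmall [K dK]] := HB.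
have [kappa [r0 [c1 [K1 [k0 ball [r00 c10 K10] low gauss]]]]] := assumption_C_bounds HC.
have p_gt0 m : 0 < p m by case/andP: (p_in01 m).
have mt m (i : 'I_m) : measurable [set w | i \in true_model (beta m) w].
  exact: measurable_true_model.
have mS m (i : 'I_m) : measurable [set w | i \in sel m (Y m w)].
  exact: (measurable_selected (sel_measurable m)).
have mB m (i : 'I_m) : measurable [set w | i \in Bayes_oracle (p m) (delta0 m) (deltaA m) sigma nu (X m) (Y m w)].
  exact: (measurable_Bayes_oracle _ _ _ _ _ sigma_gt0 (X_design m) (size_gt0 m_lt_n m)).
pose F m (i : 'I_m) := prob (P m) [set w | i \in sel m (Y m w) :\: true_model (beta m) w].
pose M m (i : 'I_m) := prob (P m) [set w | i \in true_model (beta m) w :\: sel m (Y m w)].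
pose q := slab_radius n sigma (fun m => penalty m (n m) d).
have q_gt0 : \forall m \near \oo, 0 < q m.
  near=> m; rewrite /q /slab_radius divr_gt0 ?sqrtr_gt0 ?ltr0n ?size_gt0//.
  rewrite mulr_gt0// sqrtr_gt0 (lt_le_trans ltr01)//.
  by near: m; exact: penalty_cvg.
have rates c0 (c0_gt0 : 0 < c0) (mp_ge : \forall m \near \oo, c0 <= m%:R * p m) (e : R) :
    0 < e -> \forall m \near \oo, forall i : 'I_m,
  [/\ (1 - e) * (p m * (kappa * q m)) <= M m i,
      M m i <= (1 + e) * (p m * (kappa * q m)) & F m i <= e * (p m * q m)].
  exact: (mBIC_rates sigma_gt0 nu0 p_in01 m_lt_n X_design model n_cvg c0_gt0 mp_ge k0
    ball L_small eta_gt0 L_large sel_mBIC sel_measurable).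
split=> s s0 mps.
- move=> lnmp; rewrite /ABOS.
  have [c0 c0_gt0 mp_ge] := cvg_pos_bounded_below s0 mps.
  pose FB m (i : 'I_m) := prob (P m) [set w | i \in Bayes_oracle (p m) (delta0 m) (deltaA m)
    sigma nu (X m) (Y m w) :\: true_model (beta m) w].
  pose MB m (i : 'I_m) := prob (P m) [set w | i \in true_model (beta m) w :\:
    Bayes_oracle (p m) (delta0 m) (deltaA m) sigma nu (X m) (Y m w)].
  pose q' := slab_radius n sigma (oracle_level n p).
  have ratesB (e : R) : 0 < e -> \forall m \near \oo, forall i : 'I_m,
    [/\ (1 - e) * (p m * (kappa * q' m)) <= MB m i,
        MB m i <= (1 + e) * (p m * (kappa * q' m)) &
        delta0 m / deltaA m * FB m i <= e * (p m * q' m)].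
    exact: (oracle_rates sigma_gt0 nu0 _ p_in01 delta0_gt0 deltaA_gt0 m_lt_n X_design
      model n_cvg p_cvg dsmall dK c0_gt0 mp_ge k0 ball r00 c10 K10 low gauss).
  have level_ge := @oracle_level_ge R n p n_cvg p_in01 p_cvg.
  have A_gt0 : \forall m \near \oo, 0 < oracle_level n p m.
    near=> m; apply: (lt_le_trans ltr01); near: m; exact: (level_cvg n_cvg level_ge).
  have pen_gt0 : \forall m \near \oo, 0 < penalty m (n m) d.
    near=> m; apply: (lt_le_trans ltr01); near: m; exact: penalty_cvg.
  have q'_gt0 : \forall m \near \oo, 0 < q' m.
    near=> m; rewrite /q' /slab_radius divr_gt0 ?sqrtr_gt0 ?ltr0n ?size_gt0//.
    rewrite mulr_gt0// sqrtr_gt0; near: m; exact: A_gt0.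
  have w_gt0 (r : nat -> R) : (\forall m \near \oo, 0 < r m) ->
      \forall m \near \oo, 0 < deltaA m * (m%:R * (p m * (kappa * r m))).
    move=> r_gt0; near=> m; rewrite !mulr_gt0//; last by near: m.
    by rewrite ltr0n; near: m; exact: nbhs_infty_gt.
  (* Both risks are compared with the same expression in a radius, taken at [q] for the mBIC rule
     and at [q'] for the oracle, so it remains to show that [q / q'] tends to 1. *)
  apply: (ratio_cvg1 (w_gt0 _ q_gt0) (w_gt0 _ q'_gt0)).
  + have -> : (fun m => fine (risk (P m) (delta0 m) (deltaA m) (beta m) (fun w => sel m (Y m w))) /
        (deltaA m * (m%:R * (p m * (kappa * q m))))) =
      (fun m => (delta0 m * (\sum_i F m i) + deltaA m * (\sum_i M m i)) /
        (deltaA m * (m%:R * (p m * (kappa * q m))))).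
      by apply/funext => m; rewrite fine_risk.
    apply: risk_equivalent => //; first by move=> m i; exact: prob_ge0.
    move=> e e0; have K0 : 0 < K by apply: lt_le_trans (dK 0%N); rewrite divr_gt0.
    (* [rates] bounds unweighted false inclusions; the weight [delta0 / deltaA] costs at most the
       factor [K]. *)
    pose e1 := Num.min e (e / K).
    have e1_gt0 : 0 < e1 by rewrite lt_min e0 divr_gt0.
    near=> m.
    have H : forall i : 'I_m, [/\ (1 - e1) * (p m * (kappa * q m)) <= M m i,
      M m i <= (1 + e1) * (p m * (kappa * q m)) & F m i <= e1 * (p m * q m)].
      by near: m; exact: (rates c0 c0_gt0 mp_ge e1 e1_gt0).
    have qm : 0 < q m by near: m.
    have v0 : 0 <= p m * (kappa * q m) by rewrite !mulr_ge0// ltW.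
    have e1e : e1 <= e by rewrite ge_min lexx.
    move=> i; have [H1 H2 H3] := H i; split.
    * by apply: le_trans H1; apply: ler_wpM2r => //; rewrite lerB.
    * by apply: (le_trans H2); apply: ler_wpM2r => //; rewrite lerD2l.
    * apply: (@le_trans _ _ (K * (e / K * (p m * q m)))).
        apply: ler_pM => //; first by rewrite divr_ge0// ltW.
          exact: prob_ge0.
        apply: (le_trans H3); apply: ler_wpM2r; first by rewrite mulr_ge0// ltW.
        by rewrite ge_min lexx orbT.
      by rewrite mulrA [K * _]mulrC divfK// gt_eqF.
  + have -> : (fun m => fine (risk (P m) (delta0 m) (deltaA m) (beta m) (fun w =>
          Bayes_oracle (p m) (delta0 m) (deltaA m) sigma nu (X m) (Y m w))) /
        (deltaA m * (m%:R * (p m * (kappa * q' m))))) =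
      (fun m => (delta0 m * (\sum_i FB m i) + deltaA m * (\sum_i MB m i)) /
        (deltaA m * (m%:R * (p m * (kappa * q' m))))).
      by apply/funext => m; rewrite fine_risk.
    by apply: risk_equivalent => // m i; exact: prob_ge0.
  + have H : (fun m => Num.sqrt (penalty m (n m) d) / Num.sqrt (oracle_level n p m)) @ \oo --> (1 : R).
      apply: sqrt_ratio_cvg1 => //.
      apply/cvgrPdist_le => e e0; have e4 : 0 < e / 4 by rewrite divr_gt0.
      near=> m.
      have m0 : 0 < m%:R :> R by rewrite ltr0n; near: m; exact: nbhs_infty_gt.
      have x1 : 1 <= @log_size R n m by near: m; exact: log_size_ge.
      have lp : 0 <= - ln (p m) by near: m; exact: ln_p_ge.
      have h1 : `|0 - ln (m%:R * p m) / ln (n m)%:R| <= e / 4.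
        by near: m; move/cvgrPdist_le: lnmp; apply.
      have h2 : 2 * `|d| / e <= @log_size R n m by near: m; exact: log_size_ge.
      rewrite -/(log_size n m) sub0r normrN normrM normfV in h1.
      rewrite [`|log_size n m|]ger0_norm in h1; last by rewrite (le_trans _ x1).
      rewrite ler_pdivrMr ?(lt_le_trans ltr01 x1)// in h1.
      rewrite ler_pdivrMr// in h2.
      have -> : penalty m (n m) d - oracle_level n p m = 2 * ln (m%:R * p m) + d.
        by rewrite /penalty /oracle_level -/(log_size n m) lnM ?posrE//; ring.
      have Am : 0 < oracle_level n p m by near: m.
      rewrite sub0r normrN normrM normfV [`|oracle_level _ _ _|]gtr0_norm//.
      rewrite ler_pdivrMr//; apply: (le_trans (ler_normD _ _)).
      rewrite normrM ger0_norm//.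
      have : 0 <= e * - ln (p m) by rewrite mulr_ge0// ltW.
      rewrite /oracle_level; lra.
    apply: cvg_trans H; apply: near_eq_cvg; near=> m.
    have Am : 0 < Num.sqrt (oracle_level n p m) by rewrite sqrtr_gt0; near: m.
    have m0 : 0 < m%:R :> R by rewrite ltr0n; near: m; exact: nbhs_infty_gt.
    have sn : 0 < Num.sqrt (n m)%:R :> R by rewrite sqrtr_gt0 ltr0n size_gt0.
    by rewrite /q /q' /slab_radius; field; rewrite !gt_eqF.
- move=> mpn.
  have [c0 c0_gt0 mp_ge] := cvg_pos_bounded_below s0 mps.
  pose A m := [set w | sel m (Y m w) = true_model (beta m) w].
  pose B m (i : 'I_m) := [set w | i \in sel m (Y m w) :\: true_model (beta m) w] `|`
    [set w | i \in true_model (beta m) w :\: sel m (Y m w)].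
  have mBi m (i : 'I_m) : measurable (B m i).
    by apply: measurableU; exact: measurable_mem_setD.
  have AE m : ~` A m = [set w | exists i, B m i w].
    apply/seteqP; split => w /=.
      move=> /eqP; rewrite finset.eqEsubset negb_and => /orP[] /subsetPn[i i1 i2]; exists i.
        by left; rewrite /= finset.in_setD i1 i2.
      by right; rewrite /= finset.in_setD i1 i2.
    by move=> [i [|]] /= H SE; rewrite SE finset.in_setD andNb in H.
  have mA m : measurable (A m).
    by rewrite -[A m]setCK AE; apply: measurableC; exact: measurable_exists.
  have PA m : 1 - \sum_i (F m i + M m i) <= prob (P m) (A m).
    have h : 1 <= prob (P m) (A m) + prob (P m) (~` A m).
      rewrite -[leLHS](probT (P m)) -[setT](setUv (A m)).
      by apply: probU => //; exact: measurableC.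
    have : prob (P m) (~` A m) <= \sum_i (F m i + M m i).
      rewrite AE; apply: le_trans (prob_exists_le _ (mBi m)) _.
      by apply: ler_sum => i _; apply: probU; exact: measurable_mem_setD.
    lra.
  suff H : (fun m => prob (P m) (A m)) @ \oo --> (1 : R).
    have -> : (fun m => P m (A m)) = EFin \o (fun m => prob (P m) (A m)).
      by apply/funext => m; rewrite /= probE.
    by apply: cvg_EFin; [exact: nearW|exact: H].
  apply/cvgrPdist_le => e e0.
  (* Only the order of the error probabilities matters here. With error parameter 1, [rates] bounds
     the sum of the two errors of one regressor by [(1 + 2 * kappa) * (p m * q m)], and [2 * sigma]
     comes from the penalty being at most [4 log n]. *)
  pose C := (1 + 2 * kappa) * (2 * sigma).
  have C0 : 0 < C by rewrite !mulr_gt0// addr_gt0// mulr_gt0.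
  have eC : 0 < e / C by rewrite divr_gt0.
  near=> m.
  have H : forall i : 'I_m, [/\ (1 - 1) * (p m * (kappa * q m)) <= M m i,
    M m i <= (1 + 1) * (p m * (kappa * q m)) & F m i <= 1 * (p m * q m)].
    by near: m; exact: (rates c0 c0_gt0 mp_ge).
  have qm : q m <= 2 * sigma * Num.sqrt (ln (n m)%:R / (n m)%:R).
    have p4 : penalty m (n m) d <= 4 * @log_size R n m by near: m; exact: penalty_le.
    have x0 : 0 <= @log_size R n m by near: m; exact: log_size_ge.
    rewrite /q /slab_radius -/(log_size n m) sqrtrM// sqrtrV// [leRHS]mulrA.
    apply: ler_wpM2r; first by rewrite invr_ge0.
    rewrite [2 * _]mulrC -mulrA; apply: ler_wpM2l; first exact: ltW.
    have -> : 2 * Num.sqrt (log_size n m) = Num.sqrt (4 * @log_size R n m).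
      have -> : 4 = 2 ^+ 2 :> R by ring.
      by rewrite sqrtrM ?sqr_ge0// sqrtr_sqr ger0_norm.
    exact: ler_wsqrtr.
  have small : `|0 - m%:R * p m * Num.sqrt (ln (n m)%:R / (n m)%:R)| <= e / C.
    by near: m; move/cvgrPdist_le: mpn; apply.
  have mp0 : 0 <= m%:R * p m by rewrite mulr_ge0// ltW.
  rewrite sub0r normrN ger0_norm in small; last by rewrite mulr_ge0.
  rewrite ger0_norm; last by rewrite subr_ge0 prob_le1.
  rewrite lerBlDr addrC -lerBlDr; apply: le_trans (PA m); rewrite lerD2l lerN2.
  apply: (@le_trans _ _ (\sum_(i < m) (1 + 2 * kappa) * (p m * q m))).
    apply: ler_sum => i _; have [_ H2 H3] := H i.
    rewrite mulrDl; apply: lerD => //; apply: le_trans H2 _.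
    by rewrite le_eqVlt; apply/orP; left; apply/eqP; ring.
  rewrite sumr_const card_ord -[leLHS]mulr_natl.
  move: small; rewrite ler_pdivlMr// => small; apply: le_trans small.
  have -> : m%:R * ((1 + 2 * kappa) * (p m * q m)) = (1 + 2 * kappa) * (m%:R * p m) * q m by ring.
  rewrite /C; set r := Num.sqrt _ in qm *.
  have -> : m%:R * p m * r * ((1 + 2 * kappa) * (2 * sigma)) =
    (1 + 2 * kappa) * (m%:R * p m) * (2 * sigma * r) by ring.
  apply: ler_wpM2l => //; rewrite mulr_ge0// addr_ge0// mulr_ge0// ltW.
Unshelve. all: by end_near. Qed.
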